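(* Let $h:\mathbb{H}\to\mathbb{C}$ be a periodic holomorphic function on the upper half plane of the form $h(z)=\sum_{k=1}^\infty \widehat h_k\, e(kz)$, and suppose there are constants $C>0$ and $\beta>\frac14$ such that $|\widehat h_k|\le C/k^{\beta}$ for all $k\in\mathbb{N}$. Then the function $$\xi(z)=\sum_{n=1}^\infty h(n^2 z)$$ is a holomorphic almost modular form of weight $\frac12$.
   Context: Notation: $\mathbb{H}=\{z\in\mathbb{C}:\operatorname{Im} z>0\}$, $e(z)=\exp(2\pi i z)$, $\mathbb{N}=\{1,2,3,\ldots\}$; ''periodic'' means of period one, $h(z+1)=h(z)$. The square root $z^{1/2}$ is chosen with $-\pi/2<\arg z^{1/2}\le \pi/2$, and $z^{m/2}:=(z^{1/2})^m$ for $m\in\mathbb{Z}$. For $\gamma=\begin{pmatrix}a&b\\c&d\end{pmatrix}\in \mathrm{SL}(2,\mathbb{R})$ and $z\in\mathbb{H}$, $\gamma z=\frac{az+b}{cz+d}$. Generalized quadratic residue symbol: for an integer $a$ and an odd integer $b$, $\left(\frac{a}{b}\right)$ is characterized by: (i) $\left(\frac{a}{b}\right)=0$ if $\gcd(a,b)\ne1$; (ii) $\left(\frac{a}{-1}\right)=\operatorname{sgn} a$ for $a\neq 0$; (iii) if $b>0$ and $b=\prod_i b_i$ with $b_i$ primes, not necessarily distinct, then $\left(\frac{a}{b}\right)=\prod_i\left(\frac{a}{b_i}\right)$, where for $p$ prime not dividing $a$, $\left(\frac{a}{p}\right)$ is $1$ if $a$ is a square modulo $p$ and $-1$ otherwise;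 (iv) $\left(\frac{a}{-b}\right)=\left(\frac{a}{-1}\right)\left(\frac{a}{b}\right)$; (v) $\left(\frac{0}{\pm1}\right)=1$. Congruence subgroup: $\Gamma_1(N)=\left\{\begin{pmatrix}a&b\\c&d\end{pmatrix}\in \mathrm{SL}(2,\mathbb{Z}): a\equiv d\equiv1,\ c\equiv0 \bmod N\right\}$. Throughout, $N$ is a positive integer with $4\mid N$. Holomorphic modular form of weight $\kappa\in\frac12\mathbb{Z}$ for $\Gamma_1(N)$: a holomorphic function $f:\mathbb{H}\to\mathbb{C}$ with $f(\gamma z)=\left(\frac{c}{d}\right)^{2\kappa}(cz+d)^{\kappa}f(z)$ for all $\gamma=\begin{pmatrix}a&b\\c&d\end{pmatrix}\in\Gamma_1(N)$ and $z\in\mathbb{H}$, and which is holomorphic at every cusp, i.e. for every $\gamma=\begin{pmatrix}a&b\\c&d\end{pmatrix}\in \mathrm{SL}(2,\mathbb{Z})$ the function $z\mapsto (cz+d)^{-\kappa}f(\gamma z)$ has a Fourier expansion at $\infty$ with only non-negative exponents (equivalently, it is bounded on $\{\operatorname{Im} z\ge1\}$). Holomorphic almost modular form of weight $\frac12$: a holomorphic periodic function $\xi:\mathbb{H}\to\mathbb{C}$, $\xi(z)=\sum_{m=0}^\infty\widehat\xi_m\,e(mz)$, such that for every $\epsilon>0$ there are an $N=N(\epsilon)$ (with $4\mid N$) and a holomorphic modular form $f_\epsilon(z)=\sum_{m=0}^\infty\widehat f_{\epsilon,m}\,e(mz)$ of weight $\frac12$ for $\Gamma_1(N)$ with $$\limsup_{M\to\infty}\frac1{\sqrt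 M}\sum_{m=0}^M\big|\widehat\xi_m-\widehat f_{\epsilon,m}\big|^2<\epsilon^2.$$ *)

(* Defs.v *)
(* Stdlib reals and Coquelicot; the definitions use only [prime.logn] from
   MathComp. *)
From Stdlib Require Import Reals ZArith Znumtheory List Lia Lra Psatz.
From Coquelicot Require Import Coquelicot.
From mathcomp Require ssrbool eqtype ssrnat div prime.

Open Scope Z_scope.

Definition Zprod (l : list Z) : Z := fold_right Z.mul 1 l.

(* Legendre symbol; only meaningful for [p] prime. *)
Definition legendre (a p : Z) : Z :=
  if a mod p =? 0 then 0
  else if existsb (fun x => (x * x) mod p =? a mod p)
                  (map Z.of_nat (seq 0 (Z.to_nat p)))
  then 1 else -1.

(* (a / n) for n > 0; [logn p n] is the multiplicity of the prime [p] in [n],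
   and is 0 when [p] is not prime. *)
Definition jacobi (a : Z) (n : nat) : Z :=
  Zprod (map (fun p => legendre a (Z.of_nat p) ^ Z.of_nat (prime.logn p n))
             (seq 0 (S n))).

(* Characterized by [qsymbol_spec] below, for odd [b]. *)
Definition qsymbol (a b : Z) : Z :=
  if Z.gcd a b =? 1 then
    if a =? 0 then 1
    else (if b <? 0 then Z.sgn a else 1) * jacobi a (Z.abs_nat b)
  else 0.

Lemma legendre_spec (a p : Z) : prime p -> ~ (p | a) ->
  ((exists x, (p | x * x - a)) -> legendre a p = 1) /\
  (~ (exists x, (p | x * x - a)) -> legendre a p = -1).
Proof.
intros Hp Ha.
assert (p0 : 0 < p) by (destruct Hp; lia).
assert (E : forall x, (x * x) mod p = a mod p <-> (p | x * x - a)).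
{ intros x. split; intros H.
  - apply Z.mod_divide; [lia|].
    rewrite Zminus_mod, H, Z.sub_diag. apply Z.mod_0_l. lia.
  - destruct H as [k Hk].
    replace (x * x) with (a + k * p) by lia. apply Z.mod_add. lia. }
unfold legendre.
destruct (Z.eqb_spec (a mod p) 0) as [H0|H0].
{ exfalso. apply Ha. apply Z.mod_divide; lia. }
destruct (existsb _ _) eqn:Ex.
- split; [easy|]. intros Hn. exfalso. apply Hn.
  apply existsb_exists in Ex. destruct Ex as [x [_ Hx]].
  exists x. apply E. now apply Z.eqb_eq.
- split; [|easy]. intros [x Hx]. exfalso.
  assert (T : existsb (fun x => (x * x) mod p =? a mod p)
     (map Z.of_nat (seq 0 (Z.to_nat p))) = true); [|congruence].
  apply existsb_exists. exists (x mod p). split.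
  + apply in_map_iff. exists (Z.to_nat (x mod p)).
    pose proof (Z.mod_pos_bound x p p0).
    split; [lia|]. apply in_seq. lia.
  + apply Z.eqb_eq. rewrite <- Zmult_mod. now apply E.
Qed.

Lemma jacobi_widen (a : Z) (n B : nat) : (0 < n)%nat -> (n <= B)%nat ->
  jacobi a n =
  Zprod (map (fun p => legendre a (Z.of_nat p) ^ Z.of_nat (prime.logn p n))
             (seq 0 (S B))).
Proof.
intros Hn HB. induction B as [|B IH]; [lia|].
destruct (Nat.eq_dec n (S B)) as [->|Hne]; [reflexivity|].
rewrite IH by lia. rewrite (seq_S (S B)), map_app.
unfold Zprod. rewrite fold_right_app. cbn [fold_right map].
replace (prime.logn (0 + S B) n) with 0%nat; [reflexivity|].
symmetry. apply prime.ltn_log0.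
now apply (ssrbool.introT ssrnat.ltP); lia.
Qed.

Lemma jacobi_mul (a : Z) (m n : nat) : (0 < m)%nat -> (0 < n)%nat ->
  jacobi a (m * n) = jacobi a m * jacobi a n.
Proof.
intros Hm Hn.
rewrite (jacobi_widen a m (m * n)) by nia.
rewrite (jacobi_widen a n (m * n)) by nia.
unfold jacobi.
induction (seq 0 (S (m * n))) as [|p l IH]; [reflexivity|].
cbn [map Zprod fold_right]. fold Zprod in *. unfold Zprod in IH. rewrite IH.
replace (prime.logn p (m * n)) with (prime.logn p m + prime.logn p n)%nat.
- rewrite Nat2Z.inj_add, Z.pow_add_r by lia. ring.
- symmetry. apply prime.lognM; now apply (ssrbool.introT ssrnat.ltP).
Qed.

Lemma jacobi_prime (a p : Z) : prime p -> jacobi a (Z.to_nat p) = legendre a p.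
Proof.
intros Hp. assert (p1 : 1 < p) by (now destruct Hp).
assert (Hm : is_true (prime.prime (Z.to_nat p))).
{ apply (ssrbool.introT prime.primeP). split.
  - apply (ssrbool.introT ssrnat.ltP). lia.
  - intros d Hd. simpl.
    destruct (ssrbool.elimT div.dvdnP Hd) as [k Hk].
    change (ssrnat.muln k d) with (k * d)%nat in Hk.
    assert (D : (Z.of_nat d | p)) by (exists (Z.of_nat k); lia).
    apply prime_divisors in D; [|easy].
    apply (ssrbool.introT ssrbool.orP).
    destruct D as [D|[D|[D|D]]]; try lia.
    + left. apply (ssrbool.introT eqtype.eqP). lia.
    + right. apply (ssrbool.introT eqtype.eqP). lia. }
unfold jacobi. rewrite seq_S, map_app. unfold Zprod. rewrite fold_right_app.
cbn [map fold_right]. rewrite prime.logn_prime by easy.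
rewrite Nat.add_0_l, eqtype.eqxx, Z2Nat.id by lia.
replace (legendre a p ^ Z.of_nat (ssrnat.nat_of_bool true) * 1)
  with (legendre a p)
  by (change (Z.of_nat (ssrnat.nat_of_bool true)) with 1; ring).
generalize (legendre a p). intros y.
assert (H : forall q, In q (seq 0 (Z.to_nat p)) -> (q < Z.to_nat p)%nat)
  by (intros q Hq; apply in_seq in Hq; lia).
induction (seq 0 (Z.to_nat p)) as [|q l IH]; [reflexivity|].
cbn [map fold_right]. rewrite IH by (intros; apply H; now right).
rewrite prime.logn_prime by easy.
specialize (H q (or_introl eq_refl)).
assert (Eq : q <> Z.to_nat p) by lia.
replace (ssrnat.nat_of_bool _) with 0%nat
  by (symmetry; exact (f_equal ssrnat.nat_of_bool (ssrbool.introF eqtype.eqP Eq))).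
rewrite Z.pow_0_r. ring.
Qed.

Lemma qsymbol_mul (a m n : Z) : 0 < m -> 0 < n ->
  qsymbol a (m * n) = qsymbol a m * qsymbol a n.
Proof.
intros Hm Hn. unfold qsymbol.
rewrite Zabs2Nat.inj_mul.
replace (m * n <? 0) with false by (symmetry; apply Z.ltb_ge; nia).
replace (m <? 0) with false by (symmetry; apply Z.ltb_ge; nia).
replace (n <? 0) with false by (symmetry; apply Z.ltb_ge; nia).
rewrite jacobi_mul by lia.
destruct (Z.eqb_spec (Z.gcd a m) 1) as [Gm|Gm];
destruct (Z.eqb_spec (Z.gcd a n) 1) as [Gn|Gn].
- assert (G : Z.gcd a (m * n) = 1).
  { apply Zgcd_1_rel_prime. apply rel_prime_mult; now apply Zgcd_1_rel_prime. }
  rewrite G, Z.eqb_refl. destruct (a =? 0); ring.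
- destruct (Z.eqb_spec (Z.gcd a (m * n)) 1) as [G|G]; [|ring].
  exfalso. apply Gn. apply Zgcd_1_rel_prime. apply Zgcd_1_rel_prime in G.
  apply rel_prime_sym, rel_prime_div with (p := m * n);
    [now apply rel_prime_sym | exists m; ring].
- destruct (Z.eqb_spec (Z.gcd a (m * n)) 1) as [G|G]; [|ring].
  exfalso. apply Gm. apply Zgcd_1_rel_prime. apply Zgcd_1_rel_prime in G.
  apply rel_prime_sym, rel_prime_div with (p := m * n);
    [now apply rel_prime_sym | exists n; ring].
- destruct (Z.eqb_spec (Z.gcd a (m * n)) 1) as [G|G]; [|ring].
  exfalso. apply Gm. apply Zgcd_1_rel_prime. apply Zgcd_1_rel_prime in G.
  apply rel_prime_sym, rel_prime_div with (p := m * n);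
    [now apply rel_prime_sym | exists n; ring].
Qed.

Lemma qsymbol_spec (a : Z) :
  (forall b, Z.gcd a b <> 1 -> qsymbol a b = 0) /\
  (a <> 0 -> qsymbol a (-1) = Z.sgn a) /\
  (forall l, List.Forall prime l ->
     qsymbol a (Zprod l) = Zprod (map (qsymbol a) l)) /\
  (forall p, prime p -> ~ (p | a) ->
     ((exists x, (p | x * x - a)) -> qsymbol a p = 1) /\
     (~ (exists x, (p | x * x - a)) -> qsymbol a p = -1)) /\
  (forall b, 0 < b -> qsymbol a (- b) = qsymbol a (-1) * qsymbol a b) /\
  qsymbol 0 1 = 1 /\ qsymbol 0 (-1) = 1.
Proof.
assert (J1 : jacobi a 1 = 1).
{ reflexivity. }
assert (Q1 : qsymbol a (-1) = if a =? 0 then 1 else Z.sgn a).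
{ unfold qsymbol. replace (Z.gcd a (-1)) with 1
    by (change (-1) with (- (1)); now rewrite Z.gcd_opp_r, Z.gcd_1_r).
  simpl. change (Pos.to_nat 1) with 1%nat. rewrite J1.
  destruct (a =? 0); ring. }
repeat apply conj.
- intros b Hb. unfold qsymbol. now destruct (Z.eqb_spec (Z.gcd a b) 1).
- intros Ha. rewrite Q1. now destruct (Z.eqb_spec a 0).
- intros l Hl.
  assert (P : forall l, List.Forall prime l -> 0 < Zprod l).
  { intros l' H'. induction H' as [|p l' Hp _ IH]; simpl; [lia|].
    fold (Zprod l'). destruct Hp. nia. }
  induction Hl as [|p l Hp Hl IH].
  + change (qsymbol a 1 = 1). unfold qsymbol. rewrite Z.gcd_1_r.
    change (Z.abs_nat 1) with 1%nat. rewrite J1. now destruct (a =? 0).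
  + simpl. fold (Zprod l) (Zprod (map (qsymbol a) l)).
    rewrite qsymbol_mul by (try apply P; destruct Hp; easy || lia).
    now rewrite IH.
- intros p Hp Ha.
  assert (p1 : 1 < p) by (now destruct Hp).
  replace (qsymbol a p) with (legendre a p).
  { now apply legendre_spec. }
  unfold qsymbol.
  replace (Z.gcd a p) with 1.
  2:{ symmetry. apply Zgcd_1_rel_prime, rel_prime_sym. now apply prime_rel_prime. }
  simpl. destruct (Z.eqb_spec a 0) as [->|].
  { exfalso. apply Ha. apply Z.divide_0_r. }
  replace (p <? 0) with false by (symmetry; apply Z.ltb_ge; lia).
  replace (Z.abs_nat p) with (Z.to_nat p) by lia.
  rewrite jacobi_prime by easy. ring.
- intros b Hb. rewrite Q1. unfold qsymbol.
  rewrite Z.gcd_opp_r. replace (Z.abs_nat (- b)) with (Z.abs_nat b) by lia.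
  replace (- b <? 0) with true by (symmetry; apply Z.ltb_lt; lia).
  replace (b <? 0) with false by (symmetry; apply Z.ltb_ge; lia).
  destruct (Z.gcd a b =? 1), (a =? 0); ring.
- reflexivity.
- reflexivity.
Qed.

Close Scope Z_scope.
Open Scope R_scope.

Definition Csqrt (z : C) : C :=
  (sqrt ((Cmod z + Re z) / 2),
   (if Rle_dec 0 (Im z) then 1 else -1) * sqrt ((Cmod z - Re z) / 2)).

(* The right half-plane together with the upper imaginary half-axis is
   -PI/2 < arg <= PI/2. *)
Lemma Csqrt_spec (z : C) :
  (Csqrt z * Csqrt z)%C = z /\
  (0 < Re (Csqrt z) \/ (Re (Csqrt z) = 0 /\ 0 <= Im (Csqrt z))).
Proof.
assert (Hc := re_le_Cmod z). apply Rabs_le_between in Hc.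
assert (Hm : Cmod z * Cmod z = Re z * Re z + Im z * Im z).
{ replace (Cmod z * Cmod z) with (Cmod z ^ 2) by ring.
  rewrite Cmod2_alt. ring. }
set (s := (Cmod z + Re z) / 2). set (t := (Cmod z - Re z) / 2).
assert (s0 : 0 <= s) by (unfold s; lra).
assert (t0 : 0 <= t) by (unfold t; lra).
assert (Hs := sqrt_sqrt s s0). assert (Ht := sqrt_sqrt t t0).
assert (Ps := sqrt_pos s). assert (Pt := sqrt_pos t).
assert (Hst : sqrt s * sqrt t = Rabs (Im z) / 2).
{ rewrite <- sqrt_mult by easy.
  replace (s * t) with (Rsqr (Im z / 2)) by (unfold s, t, Rsqr; nra).
  rewrite sqrt_Rsqr_abs. unfold Rdiv. rewrite Rabs_mult.
  rewrite (Rabs_right (/ 2)) by lra. reflexivity. }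
unfold Csqrt. fold s t. split.
- destruct z as [x y]. unfold Re, Im in *. simpl in *.
  unfold Cmult. simpl.
  destruct (Rle_dec 0 y) as [Hy|Hy].
  + rewrite Rabs_right in Hst by lra. f_equal; unfold s, t in *; nra.
  + rewrite Rabs_left in Hst by lra. f_equal; unfold s, t in *; nra.
- unfold Re at 1 2, Im at 1. simpl.
  destruct Ps as [Ps|Ps]; [now left|]. right. split; [easy|].
  destruct (Rle_dec 0 (Im z)) as [Hy|Hy]; [nra|].
  exfalso. rewrite <- Ps, Rmult_0_l in Hst.
  rewrite Rabs_left in Hst by lra. lra.
Qed.

Definition Cpowz (z : C) (m : Z) : C :=
  match m with
  | Z0 => 1%C
  | Zpos p => (z ^ Pos.to_nat p)%C
  | Zneg p => (/ (z ^ Pos.to_nat p))%C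
  end.

(* z^(m/2) *)
Definition half_pow (z : C) (m : Z) : C := Cpowz (Csqrt z) m.

Definition Cexp (z : C) : C :=
  (exp (Re z) * cos (Im z), exp (Re z) * sin (Im z)).

Definition e2pi (z : C) : C := Cexp (2 * PI * Ci * z)%C.

(* Functions on the upper half-plane are total functions on [C]; all conditions
   are imposed on [upper] only. *)

Definition upper (z : C) : Prop := 0 < Im z.

Definition is_Cseries (a : nat -> C) (l : C) : Prop :=
  @is_series C_AbsRing C_NormedModule a l.

Definition holomorphic (f : C -> C) : Prop :=
  forall z, upper z -> @ex_derive C_AbsRing C_NormedModule f z.

Definition periodic (f : C -> C) : Prop :=
  forall z, upper z -> f (z + 1)%C = f z.

Definition fourier (w : nat) (a : nat -> C) (f : C -> C) : Prop :=
  forall z, upper z ->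
    is_Cseries (fun m => (a m * e2pi (INR m * z / INR w))%C) (f z).

Definition moebius (a b c d : Z) (z : C) : C :=
  ((IZR a * z + IZR b) / (IZR c * z + IZR d))%C.

Definition SL2Z (a b c d : Z) : Prop := (a * d - b * c = 1)%Z.

Definition Gamma1 (N a b c d : Z) : Prop :=
  SL2Z a b c d /\ (N | a - 1)%Z /\ (N | d - 1)%Z /\ (N | c)%Z.

(* Holomorphic modular form of weight k/2 for Gamma1(N), where 4 | N. At a
   cusp, the expansion at infinity is in powers of e(z/w) for some width w. *)
Definition modular_form (k N : Z) (f : C -> C) : Prop :=
  holomorphic f /\
  (forall a b c d z, Gamma1 N a b c d -> upper z ->
     f (moebius a b c d z) =
     (Cpowz (IZR (qsymbol c d)) k * half_pow (IZR c * z + IZR d) k * f z)%C) /\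
  (forall a b c d, SL2Z a b c d ->
     exists (w : nat) (g : nat -> C), (0 < w)%nat /\
       fourier w g (fun z =>
         half_pow (IZR c * z + IZR d) (- k) * f (moebius a b c d z))%C).

(* The Fourier coefficients [xi_hat], [f_hat] are determined by [xi], [f]. *)
Definition almost_modular_half (xi : C -> C) : Prop :=
  holomorphic xi /\ periodic xi /\
  exists xi_hat : nat -> C, fourier 1 xi_hat xi /\
    forall eps : R, 0 < eps ->
      exists (N : Z) (f : C -> C) (f_hat : nat -> C),
        (0 < N)%Z /\ (4 | N)%Z /\ modular_form 1 N f /\ fourier 1 f_hat f /\
        Rbar_lt
          (LimSup_seq (fun M => / sqrt (INR M) *
             sum_n (fun m => Cmod (xi_hat m - f_hat m)%C ^ 2) M))
          (eps ^ 2).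

(* Main.v *)
Require Import Defs.
From Stdlib Require Import Reals.
From Coquelicot Require Import Coquelicot.
From Stdlib Require ZArith Znumtheory Lia Lra Psatz ClassicalChoice ClassicalEpsilon.
From HB Require structures.
From mathcomp Require all_boot zify ssrZ.
Open Scope R_scope.

(** Let theta(z) be the sum of e(n^2 z) over all integers n. The m-th coefficient
    of xi is the sum of h_k over k n^2 = m, and xi is approximated by the
    modular form f = sum over k <= k0 of (h_k / 2) theta(k z), whose positive
    coefficients are the same sums restricted to k <= k0.

    Modularity. Splitting n into residue classes modulo the denominator of a
    rational point turns theta near this point into Gaussian sums, to which
    Poisson summation applies; the coefficients that appear are quadratic Gauss
    sums. This gives the expansions at all cusps. Comparing two such expansions
    at the same rational point gives the Landsberg-Schaar relation, which
    evaluates G(k, n) for n = 1 or -1 modulo 4k; together with G(b k, n) = (b / n)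
    G(k, n) it yields the multiplier (c / d) on Gamma1(4k) for theta(k z).

    Poisson summation is proved without integrals: A(j/N), where A is the
    periodized Gaussian, is a finite Fourier sum whose coefficients are Riemann
    sums of step 1/N. Shifting the contour, these are, up to O(1/N), a common
    constant kappa_N times the expected value, and second differences bound them
    by K / (1 + n^2), so one may let N tend to infinity. The case t = 1 shows that
    kappa_N tends to 1.

    Mean square. If k n^2 = m then k = s u^2 where s is the squarefree part of m,
    so u determines k. Cauchy-Schwarz with the weights u^rho and u^(-rho),
    1 < rho < 4 beta, bounds the sum up to M of |xi_m - f_m|^2 by
    O(sqrt M) times the sum over k > k0 of k^(-2 beta - 1/2) u^rho, the tail of a
    series dominated by the product of the sums of s^(-2 beta - 1/2) and of
    u^(-(4 beta + 1 - rho)). *)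

(** If k n^2 = m and s is the squarefree part of m, then k = s u^2 where u n is the square root of m
    / s. So one coefficient collects as many k as this root has divisors, and that number is
    unbounded; unweighted Cauchy-Schwarz would pay for it. The weights replace it by the convergent
    sum of u^(-rho). The hypothesis beta > 1/4 is what makes room for rho between 1 and 4 beta, and
    it puts both 2 beta + 1/2 and 4 beta + 1 - rho above 1.

    On Gamma1(N) with 4 k dividing N, d is 1 modulo 4 k, hence n = |d| is 1 or -1 modulo 4 k
    according to the sign of d. These are the only classes in which a Gauss sum must be evaluated.
    For d < 0 the Gauss sum contributes a factor i, and the branch of the square root turns it into
    the sign of c that the symbol (c / d) carries.

    Series are summed over unordered index sets, because the argument keeps regrouping them: by
    residue classes, by shifts, by equal exponents, by rows. The series given for h converges only
    in order; its coefficient bound makes it absolutely convergent, and uniqueness of limits links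
    the two notions. *)

Module ThetaSeries.
Import ZArith Znumtheory Lia Lra Psatz Coquelicot.
Import structures all_boot zify ssrZ.
Set Implicit Arguments. Unset Strict Implicit. Unset Printing Implicit Defensive.
Local Open Scope R_scope.
Delimit Scope R_scope with coqR.

(** * Finite sums over the real and complex numbers *)

HB.instance Definition _ := Monoid.isComLaw.Build R 0 Rplus
  (fun x y z => esym (Rplus_assoc x y z)) Rplus_comm Rplus_0_l.
HB.instance Definition _ := Monoid.isComLaw.Build C (RtoC 0) Cplus
  Cplus_assoc Cplus_comm Cplus_0_l.
HB.instance Definition _ := Monoid.isMulLaw.Build R 0 Rmult Rmult_0_l Rmult_0_r.
HB.instance Definition _ :=
  Monoid.isMulLaw.Build C (RtoC 0) Cmult Cmult_0_l Cmult_0_r.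
HB.instance Definition _ := Monoid.isAddLaw.Build R Rmult Rplus
  Rmult_plus_distr_r Rmult_plus_distr_l.
HB.instance Definition _ := Monoid.isAddLaw.Build C Cmult Cplus
  Cmult_plus_distr_r Cmult_plus_distr_l.

Notation "\rsum_ ( i <- r ) F" := (\big[Rplus/R0]_(i <- r) F)
  (at level 41, F at level 41, i, r at level 50).
Notation "\rsum_ ( i <- r | P ) F" := (\big[Rplus/R0]_(i <- r | P) F)
  (at level 41, F at level 41, i, r at level 50).
Notation "\csum_ ( i <- r ) F" := (\big[Cplus/RtoC 0]_(i <- r) F%C)
  (at level 41, F at level 41, i, r at level 50).
Notation "\csum_ ( i <- r | P ) F" := (\big[Cplus/RtoC 0]_(i <- r | P) F%C)
  (at level 41, F at level 41, i, r at level 50).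

Lemma INR_gt0 (n : nat) : (0 < n)%N -> 0 < INR n.
Proof. by move=> n0; apply: lt_0_INR; lia. Qed.

(** * Unconditional sums *)

Lemma rsum_ge0 (I : Type) (F : seq I) (P : pred I) (g : I -> R) :
  (forall i, 0 <= g i) -> 0 <= \rsum_(i <- F | P i) g i.
Proof.
move=> H; apply: (big_ind (fun x => 0 <= x)) => //; first exact: Rle_refl.
move=> x y; exact: Rplus_le_le_0_compat.
Qed.

Lemma rsum_le (I : eqType) (F : seq I) (P : pred I) (f g : I -> R) :
  (forall i, i \in F -> P i -> f i <= g i) ->
  \rsum_(i <- F | P i) f i <= \rsum_(i <- F | P i) g i.
Proof.
move=> H; rewrite big_seq_cond [X in _ <= X]big_seq_cond.
apply: (big_ind2 (fun x y => x <= y)); first by lra.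
- by move=> *; lra.
- by move=> i /andP[]; exact: H.
Qed.

Lemma csum_mod (I : Type) (F : seq I) (P : pred I) (f : I -> C) :
  Cmod (\csum_(i <- F | P i) f i) <= \rsum_(i <- F | P i) Cmod (f i).
Proof.
apply: (big_ind2 (fun x y => Cmod x <= y)).
- rewrite Cmod_0; lra.
- by move=> x1 x2 y1 y2 H1 H2; have := Cmod_triangle x1 y1; lra.
- by move=> *; lra.
Qed.

Lemma rsum_sub (I : eqType) (F G : seq I) (g : I -> R) :
  (forall i, 0 <= g i) -> uniq F -> uniq G -> {subset F <= G} ->
  \rsum_(i <- F) g i <= \rsum_(i <- G) g i.
Proof.
move=> g0 uF uG sFG.
rewrite [X in _ <= X](bigID (mem F)) /=.
have -> : \rsum_(i <- F) g i = \rsum_(i <- G | i \in F) g i.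
  rewrite -[RHS]big_filter; apply: perm_big; apply: uniq_perm => //.
    exact: filter_uniq.
  by move=> i; rewrite mem_filter; case: (boolP (i \in F)) => //= /sFG ->.
have := rsum_ge0 G (fun i => i \notin F) g0; lra.
Qed.

Lemma csum_re (I : Type) (F : seq I) (P : pred I) (f : I -> C) :
  Re (\csum_(i <- F | P i) f i) = \rsum_(i <- F | P i) Re (f i).
Proof. exact: (big_morph Re (id1 := 0) (op1 := Rplus)). Qed.

Lemma Cmod_Ci : Cmod Ci = 1.
Proof. by rewrite /Cmod /= -[RHS]sqrt_1; f_equal; ring. Qed.

Lemma Cmod_le_ReIm (z : C) : Cmod z <= Rabs (Re z) + Rabs (Im z).
Proof.
have {1}-> : z = (RtoC (Re z) + Ci * RtoC (Im z))%C.
  by case: z => x y; rewrite /Re /Im /RtoC /Ci /Cplus /Cmult /=; f_equal; ring.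
apply: Rle_trans (Cmod_triangle _ _) _.
rewrite Cmod_mult !Cmod_R Cmod_Ci; lra.
Qed.

Lemma im_le_Cmod (z : C) : Rabs (Im z) <= Cmod z.
Proof. exact: Rle_trans (Rmax_r _ _) (Rmax_Cmod z). Qed.

(* Convergence of the net of finite partial sums; [I] is not ordered. *)
Definition is_usum (I : eqType) (f : I -> C) (l : C) : Prop :=
  forall eps : R, 0 < eps -> exists F0 : seq I, forall F : seq I,
    uniq F -> {subset F0 <= F} -> Cmod (\csum_(i <- F) f i - l)%C < eps.

Definition rbounded (I : eqType) (g : I -> R) : Prop :=
  exists B : R, forall F : seq I, uniq F -> \rsum_(i <- F) g i <= B.

Lemma is_usum_ext (I : eqType) (f g : I -> C) (l : C) :
  (forall i, f i = g i) -> is_usum f l -> is_usum g l.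
Proof.
move=> E H eps e0; have [F0 HF] := H eps e0; exists F0 => F uF sF.
by have := HF F uF sF; rewrite (eq_bigr g).
Qed.

Lemma is_usum_unique (I : eqType) (f : I -> C) (l1 l2 : C) :
  is_usum f l1 -> is_usum f l2 -> l1 = l2.
Proof.
move=> H1 H2.
have H : forall eps, 0 < eps -> Cmod (l1 - l2)%C < eps.
  move=> eps e0; have e2 : 0 < eps / 2 by lra.
  have [F1 h1] := H1 _ e2; have [F2 h2] := H2 _ e2.
  set F := undup (F1 ++ F2).
  have s1 : {subset F1 <= F} by move=> i Hi; rewrite mem_undup mem_cat Hi.
  have s2 : {subset F2 <= F} by move=> i Hi; rewrite mem_undup mem_cat Hi orbT.
  have := h1 F (undup_uniq _) s1; have := h2 F (undup_uniq _) s2.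
  set s := \csum_(i <- F) _ => k2 k1.
  have -> : (l1 - l2 = (s - l2) - (s - l1))%C by ring.
  apply: Rle_lt_trans (Cmod_triangle _ _) _; rewrite Cmod_opp; lra.
have E : Cmod (l1 - l2)%C = 0.
  case: (Rtotal_order (Cmod (l1 - l2)%C) 0) => [|[//|]] K.
  - have := Cmod_ge_0 (l1 - l2)%C; lra.
  - have := H _ K; lra.
have := Cmod_eq_0 _ E => E0.
have -> : l1 = (l1 - l2 + l2)%C by ring.
by rewrite E0; ring.
Qed.

Lemma is_usum_0 (I : eqType) : is_usum (fun _ : I => RtoC 0) (RtoC 0).
Proof.
move=> eps e0; exists [::] => F _ _.
rewrite big1 //.
have -> : (RtoC 0 - RtoC 0)%C = RtoC 0 by ring.
by rewrite Cmod_0.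
Qed.

Lemma is_usum_plus (I : eqType) (f g : I -> C) (l m : C) :
  is_usum f l -> is_usum g m -> is_usum (fun i => f i + g i)%C (l + m)%C.
Proof.
move=> H1 H2 eps e0; have e2 : 0 < eps / 2 by lra.
have [F1 h1] := H1 _ e2; have [F2 h2] := H2 _ e2.
exists (F1 ++ F2) => F uF sF.
have s1 : {subset F1 <= F} by move=> i Hi; apply: sF; rewrite mem_cat Hi.
have s2 : {subset F2 <= F} by move=> i Hi; apply: sF; rewrite mem_cat Hi orbT.
have := h1 F uF s1; have := h2 F uF s2; rewrite big_split /=.
set s := \csum_(i <- F) _; set t := \csum_(i <- F) _ => k1 k2.
have -> : ((t + s) - (l + m) = (t - l) + (s - m))%C by ring.
apply: Rle_lt_trans (Cmod_triangle _ _) _; lra.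
Qed.

Lemma is_usum_scal (I : eqType) (c : C) (f : I -> C) (l : C) :
  is_usum f l -> is_usum (fun i => c * f i)%C (c * l)%C.
Proof.
move=> H eps e0.
have c0 := Cmod_ge_0 c.
have e1 : 0 < eps / (1 + Cmod c) by apply: Rdiv_lt_0_compat; lra.
have [F0 h] := H _ e1; exists F0 => F uF sF.
have {h} := h F uF sF.
rewrite -big_distrr /= => h.
set s := \csum_(i <- F) _ in h *.
have -> : (c * s - c * l = c * (s - l))%C by ring.
rewrite Cmod_mult.
have : (1 + Cmod c) * Cmod (s - l)%C < eps.
  have -> : eps = (1 + Cmod c) * (eps / (1 + Cmod c)) by field; lra.
  by apply: Rmult_lt_compat_l => //; lra.
have := Cmod_ge_0 (s - l)%C; lra.
Qed.

Lemma is_usum_finite (I : eqType) (J : Type) (r : seq J) (f : J -> I -> C)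
  (l : J -> C) :
  (forall j, is_usum (f j) (l j)) ->
  is_usum (fun i => \csum_(j <- r) f j i) (\csum_(j <- r) l j).
Proof.
move=> H; elim: r => [|j r IH].
- rewrite big_nil; apply: (@is_usum_ext I (fun _ => RtoC 0)).
    by move=> i; rewrite big_nil.
  exact: is_usum_0.
- rewrite big_cons.
  apply: is_usum_ext (is_usum_plus (H j) IH) => i.
  by rewrite big_cons.
Qed.

(** A finite set whose sum is within [eps] of the supremum [S] will do: a disjoint finite set
    contributing [eps] or more would push the union above [S]. *)
Lemma rbounded_tail (I : eqType) (g : I -> R) (eps : R) :
  (forall i, 0 <= g i) -> rbounded g -> 0 < eps ->
  exists F0 : seq I, forall F : seq I, uniq F ->
    (forall i, i \in F -> i \notin F0) -> \rsum_(i <- F) g i < eps.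
Proof.
move=> g0 [B HB] e0.
pose E x := exists F : seq I, uniq F /\ x = \rsum_(i <- F) g i.
have bE : bound E by exists B => x [F [uF ->]]; exact: HB.
have nE : exists x, E x by exists 0, [::]; rewrite big_nil.
have [S [ubS lubS]] := completeness E bE nE.
have [F0 [uF0 HF0]] : exists F0 : seq I, uniq F0 /\ S - eps < \rsum_(i <- F0) g i.
  apply: Classical_Prop.NNPP => N.
  have : S <= S - eps; last by lra.
  apply: lubS => x [F [uF ->]].
  case: (Rlt_le_dec (S - eps) (\rsum_(i <- F) g i)) => // K.
  by case: N; exists F.
exists F0 => F uF dF.
have : E (\rsum_(i <- F0 ++ F) g i).
  exists (F0 ++ F); split => //.
  rewrite cat_uniq uF0 uF andbT /=; apply/hasPn => i Hi; exact: dF.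
by move/ubS; rewrite big_cat /=; lra.
Qed.

Lemma rbounded_le (I : eqType) (f g : I -> R) :
  (forall i, f i <= g i) -> rbounded g -> rbounded f.
Proof.
move=> H [B HB]; exists B => F uF; apply: Rle_trans (HB F uF).
by apply: rsum_le => i _ _; exact: H.
Qed.

Lemma rbounded_scal (I : eqType) (c : R) (g : I -> R) :
  0 <= c -> rbounded g -> rbounded (fun i => c * g i).
Proof.
move=> c0 [B HB]; exists (c * B) => F uF.
rewrite -big_distrr /=.
by apply: Rmult_le_compat_l => //; exact: HB.
Qed.

Lemma rbounded_inj (I J : eqType) (p : I -> J) (g : I -> R) (h : J -> R) :
  injective p -> (forall i, g i <= h (p i)) -> rbounded h -> rbounded g.
Proof.
move=> ip H [B HB]; exists B => F uF.
apply: Rle_trans (HB (map p F) _); last by rewrite map_inj_uniq.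
by rewrite big_map; apply: rsum_le => i _ _; exact: H.
Qed.

Lemma is_usum_bound (I : eqType) (f : I -> C) (l : C) (B : R) :
  is_usum f l -> (forall F : seq I, uniq F -> \rsum_(i <- F) Cmod (f i) <= B) ->
  Cmod l <= B.
Proof.
move=> H HB; apply: le_epsilon => eps e0.
have [F0 h] := H eps e0.
have := h (undup F0) (undup_uniq _); set s := \csum_(i <- _) _ => k.
have {k} : Cmod (s - l)%C < eps by apply: k => i; rewrite mem_undup.
have k2 : Cmod s <= B.
  by apply: Rle_trans (csum_mod _ _ _) _; exact: HB (undup_uniq _).
have := Cmod_triangle s (- (s - l))%C; rewrite Cmod_opp.
have -> : (s + - (s - l) = l)%C by ring.
lra.
Qed.

Lemma rsum_split_le (I : eqType) (F0 F : seq I) (g : I -> R) :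
  (forall i, 0 <= g i) -> uniq F ->
  \rsum_(i <- F) g i <=
  \rsum_(i <- undup F0) g i + \rsum_(i <- [seq i <- F | i \notin F0]) g i.
Proof.
move=> g0 uF; rewrite (bigID (mem F0)) /=.
rewrite -[X in X + _ <= _]big_filter -[X in _ + X <= _]big_filter.
apply: Rplus_le_compat_r; apply: rsum_sub => //.
- exact: filter_uniq.
- exact: undup_uniq.
- by move=> i; rewrite mem_filter mem_undup => /andP[].
Qed.

(** The finite sets containing a given one generate a proper filter. By [rbounded_tail] the real and
    imaginary parts of the partial sums are Cauchy along it, so completeness of the reals applies to
    each part. *)
Lemma ex_usum (I : eqType) (f : I -> C) (g : I -> R) :
  (forall i, Cmod (f i) <= g i) -> rbounded g -> exists l, is_usum f l.
Proof.
move=> fg bg.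
have g0 i : 0 <= g i by apply: Rle_trans (fg i); exact: Cmod_ge_0.
pose Fil (P : seq I -> Prop) :=
  exists F0 : seq I, forall F : seq I, uniq F -> {subset F0 <= F} -> P F.
have PF : ProperFilter Fil.
  split.
  - move=> P [F0 H]; exists (undup F0); apply: H; first exact: undup_uniq.
    by move=> i; rewrite mem_undup.
  - split.
    + by exists [::].
    + move=> P Q [F1 H1] [F2 H2]; exists (F1 ++ F2) => F uF sF; split.
      * by apply: H1 => // i Hi; apply: sF; rewrite mem_cat Hi.
      * by apply: H2 => // i Hi; apply: sF; rewrite mem_cat Hi orbT.
    + by move=> P Q PQ [F0 H]; exists F0 => F uF sF; apply: PQ; exact: H.
have Cau (F0 : seq I) (eps : R) : (forall F : seq I, uniq F ->
    (forall i, i \in F -> i \notin F0) -> \rsum_(i <- F) g i < eps) ->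
    forall F, uniq F -> {subset F0 <= F} ->
    Cmod (\csum_(i <- F) f i - \csum_(i <- undup F0) f i)%C < eps.
  move=> H F uF sF; rewrite (bigID (mem F0)) /=.
  have -> : \csum_(i <- F | i \in F0) f i = \csum_(i <- undup F0) f i.
    rewrite -[LHS]big_filter; apply: perm_big; apply: uniq_perm.
    - exact: filter_uniq.
    - exact: undup_uniq.
    - move=> i; rewrite mem_filter mem_undup.
      by case: (boolP (i \in F0)) => //= /sF ->.
  set s := \csum_(i <- undup _) _; set t := \csum_(i <- F | _) _.
  have -> : (s + t - s = t)%C by ring.
  apply: Rle_lt_trans (csum_mod _ _ _) _; rewrite -big_filter.
  apply: Rle_lt_trans (_ : _ <= \rsum_(i <- [seq i <- F | i \notin F0]) g i) _.
    by apply: rsum_le.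
  apply: H; first exact: filter_uniq.
  by move=> i; rewrite mem_filter => /andP[].
have Lim (h : C -> R) : (forall x y, Rabs (h x - h y) <= Cmod (x - y)%C) ->
    exists y : R, filterlim (fun F => h (\csum_(i <- F) f i)) Fil (locally y).
  move=> hh.
  apply/(filterlim_locally_cauchy (U := R_CompleteSpace)) => eps.
  have e2 : 0 < eps / 2 by have := cond_pos eps; lra.
  have [F0 HF0] := rbounded_tail g0 bg e2.
  exists (fun F => uniq F /\ {subset F0 <= F}); split; first by exists F0.
  move=> u v [uu su] [uv sv].
  rewrite /ball /= /AbsRing_ball /= /abs /= /minus /= /plus /opp /=.
  apply: Rle_lt_trans (hh _ _) _.
  have := Cau _ _ HF0 u uu su; have := Cau _ _ HF0 v uv sv.
  set s := \csum_(i <- undup _) _; set a := \csum_(i <- u) _.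
  set b := \csum_(i <- v) _ => k1 k2.
  have -> : (b - a = (b - s) - (a - s))%C by ring.
  apply: Rle_lt_trans (Cmod_triangle _ _) _; rewrite Cmod_opp; lra.
have [x Hx] := Lim Re (fun x y => re_le_Cmod (x - y)%C).
have [y Hy] := Lim Im (fun x y => im_le_Cmod (x - y)%C).
exists (x, y) => eps e0.
have e2 : 0 < eps / 2 by lra.
have [F1 H1] := (filterlim_locally _ _).1 Hx (mkposreal _ e2).
have [F2 H2] := (filterlim_locally _ _).1 Hy (mkposreal _ e2).
exists (F1 ++ F2) => F uF sF.
have s1 : {subset F1 <= F} by move=> i Hi; apply: sF; rewrite mem_cat Hi.
have s2 : {subset F2 <= F} by move=> i Hi; apply: sF; rewrite mem_cat Hi orbT.
have := H1 F uF s1; have := H2 F uF s2.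
rewrite /ball /= /AbsRing_ball /= /abs /= /minus /= /plus /opp /= => k2 k1.
apply: Rle_lt_trans (Cmod_le_ReIm _) _.
rewrite /Cminus /=; move: k1 k2; rewrite /Re /Im /=; lra.
Qed.

(** Regrouping along a map with finite fibres. It collects the terms with equal exponent into one
    Fourier coefficient. *)
Lemma is_usum_push (I J : eqType) (p : I -> J) (fib : J -> seq I)
  (f : I -> C) (l : C) :
  (forall j, uniq (fib j)) -> (forall i j, (i \in fib j) = (p i == j)) ->
  is_usum f l -> is_usum (fun j => \csum_(i <- fib j) f i) l.
Proof.
move=> ufib Hfib H eps e0; have [F0 h] := H eps e0.
exists (map p F0) => G uG sG.
have -> : \csum_(j <- G) \csum_(i <- fib j) f i =
          \csum_(i <- flatten (map fib G)) f i.
  by rewrite big_flatten big_map.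
apply: h.
- elim: G uG {sG} => [//|j G IH] /= /andP[jG uG].
  rewrite cat_uniq ufib IH // andbT /=; apply/hasPn => i /flatten_mapP[j' Gj'].
  rewrite Hfib => /eqP E; rewrite /= Hfib E.
  by apply: contraNneq jG => <-.
- move=> i Hi; apply/flatten_mapP; exists (p i); last by rewrite Hfib.
  by apply: sG; apply: map_f.
Qed.

(** Terms off the image of [p] vanish, so a finite subset of [J] may be replaced by its preimage. No
    inverse of [p] is given; the preimage list is built by induction, deciding membership in the
    image classically. *)
Lemma is_usum_inj (I J : eqType) (p : I -> J) (f : J -> C) (l : C) :
  injective p -> (forall j, (forall i, p i <> j) -> f j = RtoC 0) ->
  is_usum (fun i => f (p i)) l -> is_usum f l.
Proof.
move=> ip H0 H eps e0; have [F0 h] := H eps e0.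
exists (map p F0) => G uG sG.
have [F [uF [sF EF]]] : exists F : seq I, uniq F /\ {subset F0 <= F} /\
    \csum_(j <- G) f j = \csum_(i <- F) f (p i).
  have D : forall G' : seq J, uniq G' -> exists F : seq I, uniq F /\
      (forall i, (i \in F) = (p i \in G')) /\
      \csum_(j <- G') f j = \csum_(i <- F) f (p i).
    elim=> [_|j G' IH /= /andP[jG /IH[F [uF [mF EF]]]]].
      by exists [::]; rewrite !big_nil.
    case: (Classical_Prop.classic (exists i, p i = j)) => [[i Ei]|N].
    - exists (i :: F); rewrite /= uF andbT mF Ei jG; split => //; split.
        by move=> i'; rewrite !in_cons mF -Ei (inj_eq ip).
      by rewrite !big_cons EF Ei.
    - exists F; split => //; split.
        move=> i'; rewrite in_cons mF; case: eqP => //= E.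
        by case: N; exists i'.
      rewrite big_cons EF H0 ?Cplus_0_l // => i E; by case: N; exists i.
  have [F [uF [mF EF]]] := D G uG; exists F; split => //; split => //.
  by move=> i Hi; rewrite mF; apply: sG; exact: map_f.
by rewrite EF; exact: h.
Qed.

Lemma is_usum_bij (I J : eqType) (p : I -> J) (q : J -> I) (f : J -> C) (l : C) :
  cancel p q -> cancel q p -> is_usum f l <-> is_usum (fun i => f (p i)) l.
Proof.
move=> pq qp; split => H.
- apply: (@is_usum_inj _ _ q); first exact: can_inj qp.
  + by move=> i /(_ (p i)); rewrite pq.
  + by apply: is_usum_ext H => j; rewrite qp.
- apply: (@is_usum_inj _ _ p) => //; first exact: can_inj pq.
  by move=> j /(_ (q j)); rewrite qp.
Qed.

Lemma is_usum_rows (I J : eqType) (f : I * J -> C) (g : I -> C) (l : C) :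
  is_usum f l -> (forall i, is_usum (fun j => f (i, j)) (g i)) -> is_usum g l.
Proof.
move=> H Hg eps e0; have e2 : 0 < eps / 2 by lra.
have [F0 h] := H _ e2.
exists (undup (map fst F0)) => G uG sG.
set d := eps / 2 / (INR (size G) + 1).
have sz0 := pos_INR (size G).
have d0 : 0 < d by apply: Rdiv_lt_0_compat; lra.
have dE : INR (size G) * d <= eps / 2.
  have -> : eps / 2 = (INR (size G) + 1) * d by rewrite /d; field; lra.
  by apply: Rmult_le_compat_r; lra.
clearbody d.
(* In each row a finite piece [K i] contains the part of [F0] in that row and has sum within [d] of
   [g i]. The union over [G] then contains [F0], and the row errors add up to at most [eps / 2] by
   the choice of [d]. *)
have [K HK] : exists K : I -> seq J, forall i, uniq (K i) /\
    (forall j, (i, j) \in F0 -> j \in K i) /\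
    Cmod (\csum_(j <- K i) f (i, j) - g i)%C < d.
  apply: (ClassicalChoice.choice (fun i (k : seq J) => uniq k /\
    (forall j, (i, j) \in F0 -> j \in k) /\
    Cmod (\csum_(j <- k) f (i, j) - g i)%C < d)) => i.
  have [F1 h1] := Hg i d d0.
  exists (undup (F1 ++ map snd F0)); split; first exact: undup_uniq.
  split.
    move=> j Hj; rewrite mem_undup mem_cat; apply/orP; right.
    by apply/mapP; exists (i, j).
  apply: h1; first exact: undup_uniq.
  by move=> j Hj; rewrite mem_undup mem_cat Hj.
set F := flatten [seq [seq (i, j) | j <- K i] | i <- G].
have uF : uniq F.
  apply: allpairs_uniq_dep => //.
  - by move=> i _; case: (HK i).
  - by move=> [i j] [i' j'] _ _ /= [-> ->].
have sF : {subset F0 <= F}.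
  move=> [i j] Hij; apply/allpairsPdep; exists i, j; split => //.
  - by apply: sG; rewrite mem_undup; apply/mapP; exists (i, j).
  - by have [_ [+ _]] := HK i; apply.
have EF : \csum_(x <- F) f x = \csum_(i <- G) \csum_(j <- K i) f (i, j).
  rewrite /F big_flatten big_map; apply: eq_bigr => i _.
  by rewrite big_map.
have kF := h F uF sF; rewrite EF in kF.
have kD : Cmod (\csum_(i <- G) g i -
    \csum_(i <- G) \csum_(j <- K i) f (i, j))%C <= INR (size G) * d.
  elim: (G) => [|i G' IH].
    rewrite !big_nil /= Rmult_0_l.
    have -> : (RtoC 0 - RtoC 0 = RtoC 0)%C by ring.
    by rewrite Cmod_0; lra.
  rewrite !big_cons.
  set a := \csum_(i <- G') _ in IH *; set b := \csum_(i <- G') _ in IH *.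
  set s := \csum_(j <- K i) _.
  have -> : (g i + a - (s + b) = (a - b) - (s - g i))%C by ring.
  apply: Rle_trans (Cmod_triangle _ _) _; rewrite Cmod_opp.
  have [_ [_ k]] := HK i.
  have -> : INR (size (i :: G')) = INR (size G') + 1 by exact: S_INR.
  rewrite Rmult_plus_distr_r Rmult_1_l.
  by apply: Rplus_le_compat => //; apply: Rlt_le.
set s := \csum_(i <- G) _ in kF kD *.
set a := \csum_(i <- G) _ in kD *.
have -> : (a - l = (a - s) + (s - l))%C by ring.
apply: Rle_lt_trans (Cmod_triangle _ _) _.
lra.
Qed.

(** Dominated convergence, in the form where the limit is 0: off a finite set the majorant is small
    uniformly in [n], and on this set convergence is termwise. Applications subtract the expected
    limit first. *)
Lemma tannery (I : eqType) (f : nat -> I -> C) (g : I -> R) (l : nat -> C) :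
  (forall n i, Cmod (f n i) <= g i) -> rbounded g ->
  (forall i, is_lim_seq (fun n => Cmod (f n i)) 0) ->
  (forall n, is_usum (f n) (l n)) ->
  is_lim_seq (fun n => Cmod (l n)) 0.
Proof.
move=> fg bg Hf Hl.
have g0 i : 0 <= g i by apply: Rle_trans (fg 0%N i); exact: Cmod_ge_0.
apply/is_lim_seq_spec => eps.
have e2 : 0 < eps / 2 by have := cond_pos eps; lra.
have [F0 HF0] := rbounded_tail g0 bg e2.
have L : is_lim_seq (fun n => \rsum_(i <- undup F0) Cmod (f n i)) 0.
  elim: (undup F0) => [|i F IH].
    apply: (is_lim_seq_ext (fun _ => 0)); last exact: is_lim_seq_const.
    by move=> n; rewrite big_nil.
  apply: (is_lim_seq_ext (fun n => Cmod (f n i) + \rsum_(i <- F) Cmod (f n i))).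
    by move=> n; rewrite big_cons.
  have -> : Rbar.Finite 0 = Rbar.Finite (0 + 0) by rewrite Rplus_0_l.
  by apply: is_lim_seq_plus' => //; exact: Hf.
have [n0 Hn0] := (is_lim_seq_spec _ _).2 L (mkposreal _ e2).
exists n0 => n Hn; have := Hn0 n Hn => /=; rewrite !Rminus_0_r.
rewrite Rabs_pos_eq; last by apply: rsum_ge0 => i; exact: Cmod_ge_0.
move=> k; rewrite Rabs_pos_eq; last exact: Cmod_ge_0.
set s := \rsum_(i <- _) _ in k.
case: (rbounded_tail g0 bg (_ : 0 < eps / 2 - s)) => [|F1 HF1]; first by lra.
have : Cmod (l n) <= s + eps / 2.
  apply: (is_usum_bound (Hl n)) => F uF.
  apply: Rle_trans (rsum_split_le F0 _ uF) _.
    by move=> i; exact: Cmod_ge_0.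
  apply: Rplus_le_compat_l; apply: Rlt_le.
  apply: Rle_lt_trans (HF0 [seq i <- F | i \notin F0] _ _).
  - by apply: rsum_le.
  - exact: filter_uniq.
  - by move=> i; rewrite mem_filter => /andP[].
lra.
Qed.

(** * Complex-valued functions of a real variable *)

Lemma is_derive_eq (f : R -> R) (x l m : R) :
  l = m -> is_derive f x l -> is_derive f x m.
Proof. by move=> ->. Qed.

(** Componentwise, because mean value arguments are real; this is the source of the factor 2 in
    [taylor1] and [mean_value_C]. *)
Definition Cder (f : R -> C) (x : R) (l : C) : Prop :=
  is_derive (fun y => Re (f y)) x (Re l) /\
  is_derive (fun y => Im (f y)) x (Im l).

Lemma Cder_const (c : C) (x : R) : Cder (fun _ => c) x (RtoC 0).
Proof. by split; exact: is_derive_const. Qed.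

Lemma Cder_RtoC (x : R) : Cder RtoC x (RtoC 1).
Proof. by split; [exact: is_derive_id | exact: is_derive_const]. Qed.

Lemma Cder_plus (f g : R -> C) (x : R) (l m : C) :
  Cder f x l -> Cder g x m -> Cder (fun y => f y + g y)%C x (l + m)%C.
Proof. by move=> [H1 H2] [H3 H4]; split; exact: is_derive_plus. Qed.

Lemma Cder_mult (f g : R -> C) (x : R) (l m : C) :
  Cder f x l -> Cder g x m ->
  Cder (fun y => f y * g y)%C x (l * g x + f x * m)%C.
Proof.
move=> [H1 H2] [H3 H4]; split.
- have := is_derive_minus _ _ _ _ _
    (is_derive_mult _ _ _ _ _ H1 H3 Rmult_comm)
    (is_derive_mult _ _ _ _ _ H2 H4 Rmult_comm).
  by apply: is_derive_eq; rewrite /mult /plus /minus /opp /= /plus /Re /Im /=; ring.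
- have := is_derive_plus _ _ _ _ _
    (is_derive_mult _ _ _ _ _ H1 H4 Rmult_comm)
    (is_derive_mult _ _ _ _ _ H2 H3 Rmult_comm).
  by apply: is_derive_eq; rewrite /mult /plus /= /Re /Im /=; ring.
Qed.

Lemma Cder_exp (f : R -> C) (x : R) (l : C) :
  Cder f x l -> Cder (fun y => Cexp (f y)) x (l * Cexp (f x))%C.
Proof.
move=> [H1 H2].
have He := is_derive_comp exp _ _ _ _ (is_derive_exp _) H1.
have Hc := is_derive_comp cos _ _ _ _ (is_derive_cos _) H2.
have Hs := is_derive_comp sin _ _ _ _ (is_derive_sin _) H2.
split.
- have := is_derive_mult _ _ _ _ _ He Hc Rmult_comm.
  by apply: is_derive_eq; rewrite /mult /plus /scal /= /mult /Re /Im /=; ring.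
- have := is_derive_mult _ _ _ _ _ He Hs Rmult_comm.
  by apply: is_derive_eq; rewrite /mult /plus /scal /= /mult /Re /Im /=; ring.
Qed.

Lemma Cder_ext (f g : R -> C) (x : R) (l m : C) :
  (forall y, f y = g y) -> l = m -> Cder f x l -> Cder g x m.
Proof.
move=> E -> [H1 H2]; split.
- by apply: is_derive_ext H1 => y /=; rewrite E.
- by apply: is_derive_ext H2 => y /=; rewrite E.
Qed.

(** The mean value inequality is used twice, for [f1] and then for [f t - t * f1 x], whence the
    constant [B] instead of [B / 2]. *)
Lemma taylor1_R (f f1 f2 : R -> R) (x h B : R) : 0 <= B ->
  (forall t, Rabs (t - x) <= Rabs h ->
     is_derive f t (f1 t) /\ is_derive f1 t (f2 t) /\ Rabs (f2 t) <= B) ->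
  Rabs (f (x + h) - f x - h * f1 x) <= B * h ^ 2.
Proof.
move=> B0 H.
have S1 t : Rabs (t - x) <= Rabs h -> Rabs (f1 t - f1 x) <= B * Rabs h.
  move=> tx; apply: Rle_trans (_ : B * Rabs (t - x) <= _).
    apply: (bounded_variation f1 f2) => s sx.
    by have [_ [? ?]] := H s (Rle_trans _ _ _ sx tx).
  exact: Rmult_le_compat_l.
have := bounded_variation (fun t => f t - t * f1 x) (fun t => f1 t - f1 x)
  (B * Rabs h) x (x + h).
have -> : x + h - x = h by ring.
move=> K; have -> : f (x + h) - f x - h * f1 x =
  f (x + h) - (x + h) * f1 x - (f x - x * f1 x) by ring.
have -> : B * h ^ 2 = B * Rabs h * Rabs h.
  by rewrite -(pow2_abs h) /=; ring.
apply: K => t tx; split; last exact: S1.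
have [D1 _] := H t tx.
apply: is_derive_minus => //.
by auto_derive => //; ring.
Qed.

Lemma taylor1 (f f1 f2 : R -> C) (x h B : R) : 0 <= B ->
  (forall t, Rabs (t - x) <= Rabs h ->
     Cder f t (f1 t) /\ Cder f1 t (f2 t) /\ Cmod (f2 t) <= B) ->
  Cmod (f (x + h)%coqR - f x - h * f1 x)%C <= 2 * B * h ^ 2.
Proof.
move=> B0 H.
apply: Rle_trans (Cmod_le_ReIm _) _.
have -> : 2 * B * h ^ 2 = B * h ^ 2 + B * h ^ 2 by ring.
apply: Rplus_le_compat.
- have -> : Re (f (x + h)%coqR - f x - h * f1 x)%C =
    Re (f (x + h)) - Re (f x) - h * Re (f1 x) by rewrite /Re /Im /=; ring.
  apply: (@taylor1_R (fun t => Re (f t)) (fun t => Re (f1 t))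
    (fun t => Re (f2 t))) => // t /H[[? _] [[? _] ?]].
  do 2!split => //; exact: Rle_trans (re_le_Cmod _) _.
- have -> : Im (f (x + h)%coqR - f x - h * f1 x)%C =
    Im (f (x + h)) - Im (f x) - h * Im (f1 x) by rewrite /Re /Im /=; ring.
  apply: (@taylor1_R (fun t => Im (f t)) (fun t => Im (f1 t))
    (fun t => Im (f2 t))) => // t /H[[_ ?] [[_ ?] ?]].
  do 2!split => //; exact: Rle_trans (im_le_Cmod _) _.
Qed.

Lemma mean_value_R (f f1 : R -> R) (B : R) :
  (forall t, 0 <= t <= 1 -> is_derive f t (f1 t) /\ Rabs (f1 t) <= B) ->
  Rabs (f 1 - f 0) <= B.
Proof.
move=> H.
(* [bounded_variation] wants the derivative on an interval symmetric about its base point. Based at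
   the midpoint, it reaches both ends without leaving [0, 1]. *)
have K x : Rabs (x - / 2) <= / 2 -> Rabs (f x - f (/ 2)) <= B * Rabs (x - / 2).
  move=> hx; apply: (bounded_variation f f1) => t ht; apply: H.
  have /Rabs_le_between ? : Rabs (t - / 2) <= / 2 by lra.
  lra.
have e1 : Rabs (1 - / 2) = / 2 by rewrite Rabs_pos_eq; lra.
have e0 : Rabs (0 - / 2) = / 2.
  by rewrite Rabs_left1; lra.
have := K 1; have := K 0; rewrite e1 e0 => k0 k1.
have -> : f 1 - f 0 = (f 1 - f (/ 2)) - (f 0 - f (/ 2)) by ring.
apply: Rle_trans (Rabs_triang _ _) _; rewrite Rabs_Ropp.
have := k0 (Rle_refl _); have := k1 (Rle_refl _); lra.
Qed.

Lemma mean_value_C (f f1 : R -> C) (B : R) :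
  (forall t, 0 <= t <= 1 -> Cder f t (f1 t) /\ Cmod (f1 t) <= B) ->
  Cmod (f 1 - f 0)%C <= 2 * B.
Proof.
move=> H; apply: Rle_trans (Cmod_le_ReIm _) _.
have -> : 2 * B = B + B by ring.
apply: Rplus_le_compat.
- apply: (@mean_value_R (fun t => Re (f t)) (fun t => Re (f1 t))) => t /H.
  move=> [[? ?] ?]; split => //; exact: Rle_trans (re_le_Cmod _) _.
- apply: (@mean_value_R (fun t => Im (f t)) (fun t => Im (f1 t))) => t /H.
  move=> [[? ?] ?]; split => //; exact: Rle_trans (im_le_Cmod _) _.
Qed.

(** * The complex exponential and square root *)

Lemma Ci2 : (Ci * Ci = - RtoC 1)%C.
Proof. by rewrite /Ci /Cmult /Copp /RtoC /=; f_equal; ring. Qed.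

Lemma Ci_neq0 : Ci <> RtoC 0.
Proof. by move=> [] /=; lra. Qed.

Lemma Cexp_plus (z w : C) : Cexp (z + w)%C = (Cexp z * Cexp w)%C.
Proof.
by rewrite /Cexp /Cmult /= /Re /Im /= exp_plus cos_plus sin_plus; f_equal; ring.
Qed.

Lemma Cexp_0 : Cexp (RtoC 0) = RtoC 1.
Proof. by rewrite /Cexp /= exp_0 cos_0 sin_0 /RtoC; f_equal; ring. Qed.

Lemma Cmod_Cexp (z : C) : Cmod (Cexp z) = exp (Re z).
Proof.
rewrite /Cmod /Cexp /=.
have -> : forall u v, exp (Re z) * u * (exp (Re z) * u * 1) +
    exp (Re z) * v * (exp (Re z) * v * 1) =
    Rsqr (exp (Re z)) * (v² + u²) by move=> u v; rewrite /Rsqr; ring.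
rewrite sin2_cos2 Rmult_1_r sqrt_Rsqr //; exact: Rlt_le (exp_pos _).
Qed.

Lemma Cexp_neq0 (z : C) : Cexp z <> RtoC 0.
Proof.
move=> E; have := Cmod_Cexp z; rewrite E Cmod_0.
by have := exp_pos (Re z); lra.
Qed.

Lemma e2pi_plus (z w : C) : e2pi (z + w)%C = (e2pi z * e2pi w)%C.
Proof. by rewrite /e2pi -Cexp_plus; f_equal; ring. Qed.

Lemma e2pi_0 : e2pi (RtoC 0) = RtoC 1.
Proof. by rewrite /e2pi Cmult_0_r Cexp_0. Qed.

Lemma Cmod_e2pi (z : C) : Cmod (e2pi z) = exp (- (2 * PI * Im z)).
Proof.
by rewrite /e2pi Cmod_Cexp; f_equal; case: z => x y; rewrite /Re /Im /=; ring.
Qed.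

Lemma e2pi_neq0 (z : C) : e2pi z <> RtoC 0.
Proof. exact: Cexp_neq0. Qed.

Lemma e2pi_nat (n : nat) : e2pi (RtoC (INR n)) = RtoC 1.
Proof.
elim: n => [|n IH]; first exact: e2pi_0.
rewrite S_INR RtoC_plus e2pi_plus IH Cmult_1_l /e2pi.
have -> : (2 * PI * Ci * 1)%C = (0, 2 * PI).
  by rewrite /Ci /Cmult /RtoC /=; f_equal; ring.
by rewrite /Cexp /Re /Im /= exp_0 cos_2PI sin_2PI /RtoC; f_equal; ring.
Qed.

Lemma e2pi_Z (n : Z) : e2pi (RtoC (IZR n)) = RtoC 1.
Proof.
case: (Z_le_gt_dec 0 n) => n0.
- by rewrite -(Z2Nat.id n) // -INR_IZR_INZ e2pi_nat.
- have E : (e2pi (IZR n) * e2pi (INR (Z.to_nat (- n))) = 1)%C.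
    rewrite -e2pi_plus INR_IZR_INZ Z2Nat.id; last by lia.
    by rewrite -RtoC_plus -plus_IZR Z.add_opp_diag_r e2pi_0.
  by rewrite e2pi_nat Cmult_1_r in E.
Qed.

Lemma e2pi_R_conj (x : R) : e2pi (RtoC (- x)) = Cconj (e2pi (RtoC x)).
Proof.
rewrite /e2pi.
have E y : (2 * PI * Ci * RtoC y)%C = (0, 2 * PI * y).
  by rewrite /Ci /Cmult /RtoC /=; f_equal; ring.
rewrite !E /Cexp /Cconj /Re /Im /=.
have -> : 2 * PI * - x = - (2 * PI * x) by ring.
by rewrite cos_neg sin_neg; f_equal; ring.
Qed.

Lemma Cmod_e2pi_R (x : R) : Cmod (e2pi (RtoC x)) = 1.
Proof. by rewrite Cmod_e2pi /= Rmult_0_r Ropp_0 exp_0. Qed.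

Lemma Csqrt_unique (w z : C) : (w * w)%C = z ->
  (0 < Re w \/ (Re w = 0 /\ 0 <= Im w)) -> Csqrt z = w.
Proof.
move=> ww pw; have [ss ps] := Csqrt_spec z.
set s := Csqrt z in ss ps *.
have E : ((s - w) * (s + w) = 0)%C.
  have -> : ((s - w) * (s + w) = s * s - w * w)%C by ring.
  by rewrite ss ww; ring.
have [E1|E1] : (s - w = 0 \/ s + w = 0)%C.
  case: (Classical_Prop.classic (s - w = 0)%C) => N; [by left|right].
  have -> : (s + w = / (s - w) * ((s - w) * (s + w)))%C by field.
  by rewrite E; ring.
- have -> : s = (s - w + w)%C by ring.
  by rewrite E1; ring.
- have Es : s = (- w)%C.
    have -> : s = (s + w - w)%C by ring.
    by rewrite E1; ring.
  move: ps; rewrite Es; case: (w) pw => x y; rewrite /Re /Im /= => pw ps.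
  have [x0 y0] : x = 0 /\ y = 0 by lra.
  by rewrite x0 y0 /Copp /=; f_equal; ring.
Qed.

(** The sector |arg| < PI / 4 is where exp(- PI w^2 y^2) decays for real y; below, [Re t > 0] enters
    through [w = Csqrt t] in this form. *)
Lemma Csqrt_half (z : C) : 0 < Re z ->
  0 < Re (Csqrt z) /\ Rabs (Im (Csqrt z)) < Re (Csqrt z).
Proof.
move=> z0; have [ss ps] := Csqrt_spec z.
move: ss ps; case: (Csqrt z) => x y; rewrite /Re /Im /= => ss ps.
have E : x * x - y * y = Re z by rewrite -ss.
have x0 : 0 < x by case: ps => // -[x0 _]; rewrite /Re in E z0; nra.
split => //; apply: Rabs_def1; nra.
Qed.

(** Two arguments below PI / 4 in absolute value add up to one below PI / 2, so the product of the
    roots is still the principal root. *)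
Lemma Csqrt_mult (z w : C) : 0 < Re z -> 0 < Re w ->
  Csqrt (z * w)%C = (Csqrt z * Csqrt w)%C.
Proof.
move=> /Csqrt_half[x1 y1] /Csqrt_half[x2 y2].
have [s1 _] := Csqrt_spec z; have [s2 _] := Csqrt_spec w.
apply: Csqrt_unique.
- rewrite -{3}s1 -{3}s2; ring.
- left; move: x1 y1 x2 y2; case: (Csqrt z) => a b; case: (Csqrt w) => c d.
  rewrite /Re /Im /= => x1 /Rabs_def2 y1 x2 /Rabs_def2 y2.
  nra.
Qed.

Lemma Csqrt_neq0 (z : C) : z <> RtoC 0 -> Csqrt z <> RtoC 0.
Proof.
move=> N E; apply: N; have [<- _] := Csqrt_spec z.
by rewrite E; ring.
Qed.

Lemma Csqrt_R (x : R) : 0 <= x -> Csqrt (RtoC x) = RtoC (sqrt x).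
Proof.
move=> x0; apply: Csqrt_unique; first by rewrite -RtoC_mult sqrt_sqrt.
rewrite /Re /Im /=; have := sqrt_pos x; lra.
Qed.

(** * Gaussian Riemann sums *)

Lemma rsum_nat_le (h : nat -> R) (B : R) (F : seq nat) :
  (forall j, 0 <= h j) -> (forall J, \rsum_(j <- iota 0 J) h j <= B) ->
  uniq F -> \rsum_(j <- F) h j <= B.
Proof.
move=> h0 H uF.
apply: Rle_trans (H (\max_(j <- F) j).+1).
apply: rsum_sub => //; first exact: iota_uniq.
move=> j Hj; rewrite mem_iota /= add0n ltnS.
exact: (@leq_bigmax_seq _ F xpredT id j Hj isT).
Qed.

Lemma rsum_Z_le (g : Z -> R) (h : nat -> R) (B : R) (F : seq Z) :
  (forall j, 0 <= h j) -> (forall J, \rsum_(j <- iota 0 J) h j <= B) ->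
  (forall m, g m <= h (Z.abs_nat m)) ->
  uniq F -> \rsum_(j <- F) g j <= 2 * B.
Proof.
move=> h0 H gh uF.
rewrite (bigID (fun m => (0 <=? m)%Z)) /=.
have -> : 2 * B = B + B by ring.
have D (P : pred Z) :
    (forall a b, P a -> P b -> Z.abs_nat a = Z.abs_nat b -> a = b) ->
    \rsum_(j <- F | P j) g j <= B.
  move=> inj; rewrite -big_filter.
  have E : \rsum_(j <- [seq j <- F | P j]) g j <=
      \rsum_(j <- map Z.abs_nat [seq j <- F | P j]) h j.
    by rewrite big_map; apply: rsum_le => i _ _.
  apply: Rle_trans E _; apply: rsum_nat_le => //.
  rewrite map_inj_in_uniq; first exact: filter_uniq.
  by move=> a b; rewrite !mem_filter => /andP[? _] /andP[? _]; exact: inj.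
by apply: Rplus_le_compat; apply: D => a b; lia.
Qed.

Lemma rsum_inv_sq (N : R) (J : nat) : 1 <= N ->
  \rsum_(j <- iota 0 J) / (N + INR j) ^ 2 <= 2 / N.
Proof.
move=> N1.
have D : forall J, \rsum_(j <- iota 0 J.+1) / (N + INR j) ^ 2 <=
    2 / N - / (N + INR J).
  elim=> [|j IH].
    rewrite /= big_seq1 /= Rplus_0_r.
    have -> : 2 / N - / N = / N by field; lra.
    rewrite Rmult_1_r; apply: Rinv_le_contravar; nra.
  have j0 := pos_INR j.
  move: IH; rewrite -(addn1 j.+1) (iotaD 0 j.+1 1).
  set r := iota 0 j.+1 => IH; rewrite big_cat add0n [iota _ 1]/= big_seq1 S_INR.
  move: IH => /=; set s := \rsum_(i <- r) _ => IH.
  suff : / ((N + (INR j + 1)) * ((N + (INR j + 1)) * 1)) <=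
    / (N + INR j) - / (N + (INR j + 1)) by lra.
  have -> : / (N + INR j) - / (N + (INR j + 1)) =
    / ((N + INR j) * (N + (INR j + 1))) by field; lra.
  by apply: Rinv_le_contravar; nra.
case: J => [|J].
  by rewrite big_nil; apply: Rlt_le; apply: Rdiv_lt_0_compat; lra.
apply: Rle_trans (D J) _.
have : 0 < / (N + INR J) by apply: Rinv_0_lt_compat; have := pos_INR J; lra.
lra.
Qed.

(** Linear growth in [N] is the point: per-term errors of order 1 / N^2 with this weight sum to O(1
    / N). The inequality N^2 + x^2 >= (N + x)^2 / 2 reduces it to a telescoping sum. *)
Lemma rsum_cauchy (N : R) (F : seq Z) : 1 <= N -> uniq F ->
  \rsum_(m <- F) / (1 + (IZR m / N) ^ 2) <= 8 * N.
Proof.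
move=> N1 uF.
have -> : 8 * N = 2 * (2 * N ^ 2 * (2 / N)) by field; lra.
apply: (@rsum_Z_le _ (fun j => 2 * N ^ 2 * / (N + INR j) ^ 2)) => //.
- move=> j; have := pos_INR j => j0.
  have : 0 < / (N + INR j) ^ 2 by apply: Rinv_0_lt_compat; nra.
  by nra.
- move=> J; rewrite -big_distrr /=.
  by apply: Rmult_le_compat_l; [nra | exact: rsum_inv_sq].
- move=> m; rewrite INR_IZR_INZ Zabs2Nat.id_abs abs_IZR.
  have -> : (IZR m / N) ^ 2 = (Rabs (IZR m) / N) ^ 2.
    by rewrite -(pow2_abs (IZR m / N)) Rabs_div ?(Rabs_pos_eq N) //; lra.
  set x := Rabs (IZR m); have x0 : 0 <= x by exact: Rabs_pos.
  have -> : 1 + (x / N) ^ 2 = (N ^ 2 + x ^ 2) / N ^ 2 by field; lra.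
  have -> : / ((N ^ 2 + x ^ 2) / N ^ 2) = N ^ 2 * / (N ^ 2 + x ^ 2).
    by field; split; nra.
  have -> : 2 * N ^ 2 * / (N + x) ^ 2 = N ^ 2 * / ((N + x) ^ 2 / 2).
    by field; nra.
  apply: Rmult_le_compat_l; first by nra.
  have H1 : 0 < (N + x) ^ 2 by apply: pow_lt; lra.
  have H2 := pow2_ge_0 (N - x).
  by apply: Rinv_le_contravar; [lra | nra].
Qed.

Lemma rbounded_cauchy (N : R) : 1 <= N ->
  rbounded (fun m : Z => / (1 + (IZR m / N) ^ 2)).
Proof. by move=> N1; exists (8 * N) => F uF; exact: rsum_cauchy. Qed.

Definition Psi (c : C) : C := Cexp (- PI * c * c)%C.

Lemma exp_le (u v : R) : u <= v -> exp u <= exp v.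
Proof.
by move=> [H1|->]; [apply: Rlt_le; exact: exp_increasing | exact: Rle_refl].
Qed.

(** Uniform in [w] and [s], since the contour will move. The exponent 6 leaves three powers for
    polynomial factors of degree up to 3 and three for the summable weight 1 / (1 + y^2). *)
Lemma Psi_decay (a b : R) : 0 < a -> exists M, 0 <= M /\ forall w s y,
  a <= Re (w * w)%C -> Cmod w <= b -> Cmod s <= b ->
  (1 + Rabs y) ^ 6 * Cmod (Psi (w * RtoC y + s)%C) <= M.
Proof.
move=> a0.
set L := 2 * PI * b ^ 2 + 6.
have PI0 := PI_RGT_0.
(* With (1 + |y|)^6 <= exp(6 |y|), the exponent is at most L v - PI a v^2 + PI b^2 for v = |y|, and
   L^2 / (4 PI a) is the maximum of the first two terms. *)
exists (exp (L ^ 2 / (4 * PI * a) + PI * b ^ 2)); split.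
  exact: Rlt_le (exp_pos _).
move=> w s y wa wb sb.
have y0 := Rabs_pos y.
apply: Rle_trans (_ : exp (6 * Rabs y) * Cmod (Psi (w * RtoC y + s)%C) <= _).
  apply: Rmult_le_compat_r; first exact: Cmod_ge_0.
  have -> : 6 * Rabs y = INR 6 * Rabs y by rewrite /=; ring.
  rewrite -Rpower_pow; last by lra.
  rewrite /Rpower; 
  have H := exp_ineq1_le (Rabs y).
  apply: exp_le; apply: Rmult_le_compat_l; first exact: pos_INR.
  rewrite -{2}(ln_exp (Rabs y)).
  case: H => [H|->]; last exact: Rle_refl.
  by apply: Rlt_le; apply: ln_increasing; lra.
rewrite /Psi Cmod_Cexp -exp_plus.
apply: exp_le.
have -> : Re (- PI * (w * y + s) * (w * y + s))%C =
  - PI * (Re (w * w)%C * y ^ 2 + 2 * Re (w * s)%C * y + Re (s * s)%C).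
  by case: (w) => ? ?; case: (s) => ? ?; rewrite /Re /Im /=; ring.
have B1 : Rabs (Re (w * s)%C) <= b ^ 2.
  apply: Rle_trans (re_le_Cmod _) _; rewrite Cmod_mult.
  have -> : b ^ 2 = b * b by ring.
  by apply: Rmult_le_compat => //; exact: Cmod_ge_0.
have B2 : Rabs (Re (s * s)%C) <= b ^ 2.
  apply: Rle_trans (re_le_Cmod _) _; rewrite Cmod_mult.
  have -> : b ^ 2 = b * b by ring.
  by apply: Rmult_le_compat => //; exact: Cmod_ge_0.
have B3 : - (b ^ 2 * Rabs y) <= Re (w * s)%C * y.
  have : Rabs (Re (w * s)%C * y) <= b ^ 2 * Rabs y.
    by rewrite Rabs_mult; apply: Rmult_le_compat_r.
  by move/Rabs_le_between; lra.
have B4 : - b ^ 2 <= Re (s * s)%C by move/Rabs_le_between: B2; lra.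
have B5 : a * Rabs y ^ 2 <= Re (w * w)%C * y ^ 2.
  by rewrite pow2_abs; apply: Rmult_le_compat_r => //; nra.
set v := Rabs y in y0 B3 B5 *.
apply: Rle_trans (_ : 6 * v - PI * (a * v ^ 2 - 2 * (b ^ 2 * v) - b ^ 2) <= _).
  have : PI * (a * v ^ 2 - 2 * (b ^ 2 * v) - b ^ 2) <=
    PI * (Re (w * w)%C * y ^ 2 + 2 * Re (w * s)%C * y + Re (s * s)%C).
    by apply: Rmult_le_compat_l; lra.
  by lra.
have -> : 6 * v - PI * (a * v ^ 2 - 2 * (b ^ 2 * v) - b ^ 2) =
  L * v - PI * a * v ^ 2 + PI * b ^ 2 by rewrite /L; ring.
have pa : 0 < PI * a by nra.
have -> : L ^ 2 / (4 * PI * a) = L * v - PI * a * v ^ 2 +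
   (L - 2 * (PI * a) * v) ^ 2 / (4 * (PI * a)) by field; lra.
have : 0 <= (L - 2 * (PI * a) * v) ^ 2 / (4 * (PI * a)).
  apply: Rmult_le_pos; first exact: pow2_ge_0.
  by apply: Rlt_le; apply: Rinv_0_lt_compat; lra.
lra.
Qed.

Lemma Psi_der (w s : C) (y : R) :
  Cder (fun y => Psi (w * RtoC y + s)%C) y
    (- (2 * PI * w * (w * y + s)) * Psi (w * y + s))%C.
Proof.
rewrite /Psi.
have D : Cder (fun y => w * RtoC y + s)%C y w.
  apply: Cder_ext (Cder_plus (Cder_mult (Cder_const w y) (Cder_RtoC y))
    (Cder_const s y)) => //; ring.
have D2 := Cder_mult (Cder_const (- PI)%C y) (Cder_mult D D).
apply: Cder_ext (Cder_exp D2) => [z|]; first by f_equal; ring.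
have -> : (- PI * ((w * y + s) * (w * y + s)) =
  - PI * (w * y + s) * (w * y + s))%C by ring.
ring.
Qed.

Lemma telescope_Z (F : Z -> C) (M : nat) (a : Z) :
  \csum_(i <- iota 0 M) (F (Z.of_nat i + a + 1)%Z - F (Z.of_nat i + a)%Z) =
  (F (Z.of_nat M + a)%Z - F a)%C.
Proof.
elim: M => [|M IH]; first by rewrite big_nil Z.add_0_l; ring.
rewrite -addn1 iotaD big_cat /= big_seq1 IH add0n.
have -> : (Z.of_nat M + a + 1 = Z.of_nat (M + 1) + a)%Z by lia.
ring.
Qed.

Lemma is_usum_Zsym (f : Z -> C) (l : C) (eps : R) : is_usum f l -> 0 < eps ->
  exists M0 : nat, forall M : nat, (M0 <= M)%N ->
  Cmod (\csum_(i <- iota 0 (2 * M)) f (Z.of_nat i + - Z.of_nat M)%Z - l)%C < eps.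
Proof.
move=> H e0; have [F0 HF] := H eps e0.
exists (\max_(m <- F0) (Z.abs_nat m)).+1 => M HM.
have := HF [seq (Z.of_nat i + - Z.of_nat M)%Z | i <- iota 0 (2 * M)].
rewrite big_map; apply.
- by rewrite map_inj_uniq ?iota_uniq // => i j; lia.
- move=> m Hm; apply/mapP.
  have := @leq_bigmax_seq _ F0 xpredT (fun m => Z.abs_nat m) m Hm isT => Hm2.
  exists (Z.to_nat (m + Z.of_nat M)); last by lia.
  rewrite mem_iota; lia.
Qed.

Lemma Cmod_mult_le (z w : C) (a b : R) :
  Cmod z <= a -> Cmod w <= b -> Cmod (z * w)%C <= a * b.
Proof.
by move=> ? ?; rewrite Cmod_mult; apply: Rmult_le_compat => //; exact: Cmod_ge_0.
Qed.

Lemma Cmod_plus_le (z w : C) (a b : R) :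
  Cmod z <= a -> Cmod w <= b -> Cmod (z + w)%C <= a + b.
Proof. by move=> ? ?; have := Cmod_triangle z w; lra. Qed.

Lemma Cmod_minus_le (z w : C) (a b : R) :
  Cmod z <= a -> Cmod w <= b -> Cmod (z - w)%C <= a + b.
Proof. by move=> ? ?; apply: Cmod_plus_le => //; rewrite Cmod_opp. Qed.

Lemma Cmod_2PI : Cmod (2 * PI)%C <= 8.
Proof.
have := PI_4; have := PI_RGT_0 => ? ?.
rewrite -RtoC_mult Cmod_R Rabs_pos_eq; lra.
Qed.

Lemma cauchy_weight (y p M : R) : 0 <= p -> (1 + Rabs y) ^ 6 * p <= M ->
  (1 + Rabs y) ^ 3 * p <= M * / (1 + y ^ 2).
Proof.
move=> p0 H; have y0 := Rabs_pos y; have := pow2_abs y => E.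
have q0 : 0 < 1 + y ^ 2 by have := pow2_ge_0 y; lra.
apply: (Rmult_le_reg_r (1 + y ^ 2)) => //.
rewrite [M * _ * _]Rmult_assoc Rinv_l; last by lra.
rewrite Rmult_1_r; apply: Rle_trans H.
rewrite -E; set X := Rabs y in y0 *.
have -> : (1 + X) ^ 6 * p = (1 + X) ^ 3 * p * (1 + X) ^ 3 by ring.
apply: Rmult_le_compat_l; last by nra.
by apply: Rmult_le_pos => //; apply: pow_le; lra.
Qed.

Lemma taylor_weight (F F1 F2 : R -> C) (B y h : R) : 0 <= B -> Rabs h <= 1 ->
  (forall t, Cder F t (F1 t) /\ Cder F1 t (F2 t) /\
     Cmod (F2 t) <= B * / (1 + t ^ 2)) ->
  Cmod (F (y + h)%coqR - F y - h * F1 y)%C <= 6 * B * h ^ 2 * / (1 + y ^ 2).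
Proof.
move=> B0 h1 H.
have -> : 6 * B * h ^ 2 * / (1 + y ^ 2) =
  2 * (B * (3 * / (1 + y ^ 2))) * h ^ 2 by ring.
have q0 : 0 < 1 + y ^ 2 by have := pow2_ge_0 y; lra.
apply: (@taylor1 F F1 F2).
  apply: Rmult_le_pos => //.
  by have := Rinv_0_lt_compat _ q0; lra.
move=> t ht; have [D1 [D2 D3]] := H t; do 2!split => //.
apply: Rle_trans D3 _; apply: Rmult_le_compat_l => //.
(* The weight at [t] is compared with the weight at [y]: |t - y| <= 1 gives 1 + y^2 <= 3 (1 +
   t^2). *)
have -> : 3 * / (1 + y ^ 2) = / ((1 + y ^ 2) / 3) by field; lra.
apply: Rinv_le_contravar; first by lra.
have : Rabs (t - y) <= 1 by lra.
move=> /Rabs_le_between ty.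
have : (t - y) ^ 2 <= 1 by nra.
have := pow2_ge_0 (2 * t - y); nra.
Qed.

(* [W x * Psi (c x y)] has the same derivative in [x] as [U y * Psi (c x y)] has
   in [y]. Hence its Riemann sums of step [1 / N] in [y] vary only by [O(1 / N)]
   while the contour [c x] moves from the real line to [y |-> w y + s]. *)
Section Deform.
Variables (w s : C).
Hypothesis w_half : Rabs (Im w) < Re w.

Let W (x : R) : C := (1 + x * (w - 1))%C.
Let S (x : R) : C := (x * s)%C.
Let c (x y : R) : C := (W x * y + S x)%C.
Let U (y : R) : C := ((w - 1) * y + s)%C.
Let F (x y : R) : C := (U y * Psi (c x y))%C.
Let F1 (x y : R) : C :=
  (((w - 1) - 2 * PI * W x * (c x y * U y)) * Psi (c x y))%C.
Let F2 (x y : R) : C :=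
  ((- (2 * PI * W x * (W x * U y + c x y * (w - 1))) +
   ((w - 1) - 2 * PI * W x * (c x y * U y)) * (- (2 * PI * W x * c x y)))
     * Psi (c x y))%C.

Lemma Cder_linear (u v : C) (y : R) : Cder (fun y => u * RtoC y + v)%C y u.
Proof.
apply: Cder_ext (Cder_plus (Cder_mult (Cder_const u y) (Cder_RtoC y))
    (Cder_const v y)) => //; ring.
Qed.

Lemma deform_F1 x y : Cder (F x) y (F1 x y).
Proof.
have := Cder_mult (Cder_linear (w - 1) s y) (Psi_der (W x) (S x) y).
apply: Cder_ext => //; rewrite /F1 /U /c; ring.
Qed.

Lemma deform_F2 x y : Cder (F1 x) y (F2 x y).
Proof.
have D := Cder_mult (Cder_linear (W x) (S x) y) (Cder_linear (w - 1) s y).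
have D2 := Cder_plus (Cder_const (w - 1) y)
  (Cder_mult (Cder_const (- (2 * PI * W x))%C y) D).
have := Cder_mult D2 (Psi_der (W x) (S x) y).
apply: Cder_ext => [z|]; rewrite /F1 /F2 /U /c; ring.
Qed.

Lemma deform_E x y : Cder (fun x => W x * Psi (c x y))%C x (F1 x y).
Proof.
have D1 : Cder W x (w - 1)%C.
  by apply: Cder_ext (Cder_linear (w - 1) 1 x) => // z; rewrite /W; ring.
have D2 := Psi_der (U y) (RtoC y) x.
have := Cder_mult D1 D2.
apply: Cder_ext => [z|].
  by rewrite /c /W /S /U; f_equal; f_equal; ring.
have -> : (U y * x + y = c x y)%C by rewrite /c /W /S /U; ring.
by rewrite /F1; ring.
Qed.

Lemma deform_bounds : exists b M, 1 <= b /\ 0 <= M /\ forall x y,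
  0 <= x <= 1 ->
  Cmod (W x) <= b /\ Cmod (c x y) <= b * (1 + Rabs y) /\
  Cmod (w - 1)%C <= b /\ Cmod (U y) <= b * (1 + Rabs y) /\
  (1 + Rabs y) ^ 6 * Cmod (Psi (c x y)) <= M.
Proof.
set b := 2 + Cmod w + Cmod s.
have w0 := Cmod_ge_0 w; have s0 := Cmod_ge_0 s.
(* [W x] is the convex combination of 1 and [w], so Re (W x) - Im (W x) and Re (W x) + Im (W x) are
   at least [m]; their product is the real part of the square of [W x]. *)
set m := Rmin 1 (Re w - Rabs (Im w)).
have m0 : 0 < m by apply: Rmin_pos; lra.
have m2 : 0 < m ^ 2 by nra.
have [M [M0 HM]] := Psi_decay b m2.
have m1 : m <= 1 by exact: Rmin_l.
have mw : m <= Re w - Rabs (Im w) by exact: Rmin_r.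
exists b, M; split; first by rewrite /b; lra.
split => // x y x01.
have Ww : Cmod (W x) <= b.
  have -> : W x = ((1 - x)%coqR + RtoC x * w)%C.
    by rewrite /W RtoC_minus; ring.
  apply: Rle_trans (_ : 1 + 1 * Cmod w <= _); last by rewrite /b; lra.
  apply: Cmod_plus_le; first by rewrite Cmod_R Rabs_pos_eq; lra.
  apply: Cmod_mult_le; last exact: Rle_refl.
  by rewrite Cmod_R Rabs_pos_eq; lra.
have Ss : Cmod (S x) <= Cmod s.
  rewrite /S; apply: Rle_trans (_ : 1 * Cmod s <= _); last by lra.
  apply: Cmod_mult_le; last exact: Rle_refl.
  by rewrite Cmod_R Rabs_pos_eq; lra.
have w1 : Cmod (w - 1)%C <= 1 + Cmod w.
  rewrite Rplus_comm; apply: Cmod_minus_le; first exact: Rle_refl.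
  by rewrite Cmod_1; lra.
have ylin u v a : Cmod u <= a -> Cmod v <= a ->
    Cmod (u * RtoC y + v)%C <= a * (1 + Rabs y).
  move=> ua va; have -> : a * (1 + Rabs y) = a * Rabs y + a by ring.
  apply: Cmod_plus_le => //; apply: Cmod_mult_le => //.
  by rewrite Cmod_R; exact: Rle_refl.
split => //; split; first by apply: ylin => //; rewrite /b; lra.
split; first by rewrite /b; lra.
split; first by apply: ylin; rewrite /b; lra.
apply: HM => //; last by rewrite /b; lra.
have -> : Re (W x * W x)%C =
  ((1 - x) + x * Re w - x * Im w) * ((1 - x) + x * Re w + x * Im w).
  by rewrite /W; case: (w) => p q; rewrite /Re /Im /=; ring.
have := Rle_abs (Im w); have := Rle_abs (- Im w); rewrite Rabs_Ropp => i1 i2.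
have a1 : m <= (1 - x) + x * Re w - x * Im w by nra.
have a2 : m <= (1 - x) + x * Re w + x * Im w by nra.
nra.
Qed.

Lemma deform_decay : exists B, 0 <= B /\ forall x y, 0 <= x <= 1 ->
  Cmod (F x y) <= B * / (1 + y ^ 2) /\ Cmod (F2 x y) <= B * / (1 + y ^ 2).
Proof.
have [b [M [b1 [M0 H]]]] := deform_bounds.
(* 88 = 24 + 64: with 2 PI <= 8, the factor of [Psi] in [F2] is at most 24 b^3 X + 64 b^5 X^3, where
   X = 1 + |y|. *)
exists (88 * b ^ 5 * M).
have b5 : b <= 88 * b ^ 5.
  have : 1 <= b ^ 4 by apply: pow_R1_Rle.
  have -> : 88 * b ^ 5 = b * (88 * b ^ 4) by ring.
  by move=> ?; nra.
split; first by apply: Rmult_le_pos => //; lra.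
move=> x y /(H x y)[hW [hc [hw [hU hP]]]].
have y0 := Rabs_pos y.
set X := 1 + Rabs y in hc hU hP.
have X1 : 1 <= X by rewrite /X; lra.
have P0 := Cmod_ge_0 (Psi (c x y)).
have K := cauchy_weight P0 hP; rewrite -/X in K.
have X2 : X <= X ^ 3.
  have : 1 <= X ^ 2 by apply: pow_R1_Rle.
  have -> : X ^ 3 = X * X ^ 2 by ring.
  by move=> ?; nra.
have fin k : k <= 88 * b ^ 5 * X ^ 3 ->
    k * Cmod (Psi (c x y)) <= 88 * b ^ 5 * M * / (1 + y ^ 2).
  move=> hk.
  apply: Rle_trans (_ : 88 * b ^ 5 * X ^ 3 * Cmod (Psi (c x y)) <= _).
    exact: Rmult_le_compat_r.
  have -> : 88 * b ^ 5 * X ^ 3 * Cmod (Psi (c x y)) =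
    88 * b ^ 5 * (X ^ 3 * Cmod (Psi (c x y))) by ring.
  rewrite [_ * M * _]Rmult_assoc; apply: Rmult_le_compat_l => //; lra.
split.
- apply: Rle_trans (_ : b * X * Cmod (Psi (c x y)) <= _).
    by apply: Cmod_mult_le => //; exact: Rle_refl.
  by apply: fin; apply: Rmult_le_compat; lra.
- have h2 := Cmod_2PI.
  apply: Rle_trans (_ : ((8 * b * (b * (b * X) + (b * X) * b)) +
    ((b + 8 * b * ((b * X) * (b * X))) * (8 * b * (b * X)))) *
    Cmod (Psi (c x y)) <= _).
    apply: Cmod_mult_le; last exact: Rle_refl.
    apply: Cmod_plus_le.
      rewrite Cmod_opp; apply: Cmod_mult_le; first exact: Cmod_mult_le.
      by apply: Cmod_plus_le; exact: Cmod_mult_le.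
    apply: Cmod_mult_le.
      apply: Cmod_minus_le => //; apply: Cmod_mult_le; exact: Cmod_mult_le.
    by rewrite Cmod_opp; apply: Cmod_mult_le => //; exact: Cmod_mult_le.
  apply: fin.
  have -> : 8 * b * (b * (b * X) + (b * X) * b) +
    (b + 8 * b * ((b * X) * (b * X))) * (8 * b * (b * X)) =
    24 * (b ^ 3 * X) + 64 * (b ^ 5 * X ^ 3) by ring.
  have b35 : b ^ 3 <= b ^ 5 by apply: Rle_pow => //; lia.
  have : b ^ 3 * X <= b ^ 5 * X ^ 3.
    apply: Rmult_le_compat => //; last by lra.
    by apply: pow_le; lra.
  lra.
Qed.

(** The sums are not divided by [N]: a difference bounded uniformly in [N] means Riemann sums that
    agree up to O(1 / N). *)
Lemma deform : exists K, 0 <= K /\ forall (N : nat) (l1 l0 : C), (0 < N)%N ->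
  is_usum (fun m : Z => w * Psi (w * RtoC (IZR m / INR N) + s))%C l1 ->
  is_usum (fun m : Z => Psi (RtoC (IZR m / INR N))) l0 ->
  Cmod (l1 - l0)%C <= K.
Proof.
have [B [B0 HB]] := deform_decay.
(* 100 = 2 (2 + 48): the boundary terms give 2 B / N, the Taylor remainders 48 B, and [mean_value_C]
   doubles. *)
exists (100 * B); split; first by lra.
move=> N l1 l0 Npos H1 H0.
have N1 : 1 <= INR N by rewrite -INR_1; apply: le_INR; lia.
apply: le_epsilon => eps e0; have e2 : 0 < eps / 2 by lra.
have [M1 K1] := is_usum_Zsym H1 e2; have [M0 K0] := is_usum_Zsym H0 e2.
(* At least N^2 points on each side, so the end points satisfy |y| >= N and the boundary values of
   [F] are at most B / N^2. *)
set M := (maxn (maxn M1 M0) (N * N)).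
have {K1} := K1 M (leq_trans (leq_maxl _ _) (leq_maxl _ _)).
have {K0} := K0 M (leq_trans (leq_maxr _ _) (leq_maxl _ _)).
pose X (i : nat) := IZR (Z.of_nat i + - Z.of_nat M) / INR N.
pose E (x : R) := \csum_(i <- iota 0 (2 * M)) (W x * Psi (c x (X i))).
have E1 : \csum_(i <- iota 0 (2 * M))
    (w * Psi (w * RtoC (IZR (Z.of_nat i + - Z.of_nat M) / INR N) + s)) = E 1.
  apply: eq_bigr => i _; rewrite /c /W /S /X.
  have -> : (1 + RtoC 1 * (w - 1) = w)%C by ring.
  by rewrite Cmult_1_l.
have E0 : \csum_(i <- iota 0 (2 * M))
    Psi (RtoC (IZR (Z.of_nat i + - Z.of_nat M) / INR N)) = E 0.
  apply: eq_bigr => i _; rewrite /c /W /S /X.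
  have -> : (1 + RtoC 0 * (w - 1) = 1)%C by ring.
  by rewrite Cmult_1_l Cmult_0_l Cplus_0_r Cmult_1_l.
rewrite E1 E0 => K0 K1.
have : Cmod (E 1 - E 0)%C <= 2 * (50 * B).
  apply: (@mean_value_C E
    (fun x => \csum_(i <- iota 0 (2 * M)) F1 x (X i))) => x x01; split.
    rewrite /E; elim: (iota 0 (2 * M)) => [|i r IH].
      rewrite big_nil.
      by apply: Cder_ext (Cder_const 0 x) => // y; rewrite big_nil.
    rewrite big_cons.
    by apply: Cder_ext (Cder_plus (deform_E x (X i)) IH) => // y; rewrite big_cons.
  pose G (m : Z) := F x (IZR m / INR N).
  have iN : 0 < / INR N by apply: Rinv_0_lt_compat; lra.
  have iN1 : / INR N <= 1 by rewrite -Rinv_1; apply: Rinv_le_contravar; lra.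
  have T := telescope_Z G (2 * M) (- Z.of_nat M).
  pose rem (i : nat) := (G (Z.of_nat i + - Z.of_nat M + 1)%Z -
    G (Z.of_nat i + - Z.of_nat M)%Z - RtoC (/ INR N) * F1 x (X i))%C.
  have rem_le i : Cmod (rem i) <= 6 * B * (/ INR N) ^ 2 * / (1 + X i ^ 2).
    have -> : rem i = (F x (X i + / INR N)%coqR - F x (X i) -
        RtoC (/ INR N) * F1 x (X i))%C.
      rewrite /rem /G; f_equal; f_equal; f_equal; rewrite /X plus_IZR; field; lra.
    apply: (@taylor_weight (F x) (F1 x) (F2 x)) => //.
      by rewrite Rabs_pos_eq; lra.
    move=> t; split; first exact: deform_F1.
    by split; [exact: deform_F2 | have [_ ?] := HB x t x01].
  (* One step of [F] in [y] is [F1 / N] plus a second order remainder [rem]. The steps telescope,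
     which leaves two boundary values and the sum of the remainders. *)
  have -> : \csum_(i <- iota 0 (2 * M)) F1 x (X i) =
    (RtoC (INR N) * ((G (Z.of_nat (2 * M) + - Z.of_nat M)%Z - G (- Z.of_nat M)%Z)
      - \csum_(i <- iota 0 (2 * M)) rem i))%C.
    rewrite -T.
    have -> : \csum_(i <- iota 0 (2 * M)) F1 x (X i) =
      (RtoC (INR N) * (\csum_(i <- iota 0 (2 * M)) (RtoC (/ INR N) * F1 x (X i))))%C.
      rewrite -big_distrr /= Cmult_assoc -RtoC_mult Rinv_r ?Cmult_1_l //; lra.
    f_equal; rewrite {1}/rem.
    elim: (iota 0 (2 * M)) => [|i r IH]; first by rewrite !big_nil; ring.
    rewrite !big_cons IH; ring.
  have gM m : (Z.of_nat M <= Z.abs m)%Z -> Cmod (G m) <= B / INR N ^ 2.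
    move=> hm; apply: Rle_trans (proj1 (HB x (IZR m / INR N) x01)) _.
    apply: Rmult_le_compat_l => //; apply: Rinv_le_contravar.
      by apply: pow_lt; lra.
    have h1 : INR N * INR N <= Rabs (IZR m).
      by rewrite -mult_INR INR_IZR_INZ -abs_IZR; apply: IZR_le; lia.
    have h2 : INR N <= Rabs (IZR m / INR N).
      rewrite Rabs_div; last by lra.
      rewrite (Rabs_pos_eq (INR N)); last by lra.
      apply: (Rmult_le_reg_r (INR N)); first by lra.
      by rewrite /Rdiv Rmult_assoc Rinv_l; lra.
    rewrite -(pow2_abs (IZR m / INR N)); nra.
  apply: Rle_trans (_ : INR N * ((B / INR N ^ 2 + B / INR N ^ 2) +
     6 * B * (/ INR N) ^ 2 * (8 * INR N)) <= _).
    apply: Cmod_mult_le; first by rewrite Cmod_R Rabs_pos_eq; lra.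
    apply: Cmod_minus_le.
      by apply: Cmod_minus_le; apply: gM; lia.
    apply: Rle_trans (csum_mod _ _ _) _.
    apply: Rle_trans (_ : \rsum_(i <- iota 0 (2 * M))
        (6 * B * (/ INR N) ^ 2 * / (1 + X i ^ 2)) <= _).
      by apply: rsum_le => i _ _; exact: rem_le.
    rewrite -big_distrr /=; apply: Rmult_le_compat_l.
      by apply: Rmult_le_pos; [lra | nra].
    have := @rsum_cauchy (INR N)
      [seq (Z.of_nat i + - Z.of_nat M)%Z | i <- iota 0 (2 * M)] N1.
    rewrite big_map; apply.
    by rewrite map_inj_uniq ?iota_uniq // => i j; lia.
  have -> : INR N * (B / INR N ^ 2 + B / INR N ^ 2 + 6 * B * (/ INR N) ^ 2 *
    (8 * INR N)) = 2 * B * / INR N + 48 * B by field; lra.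
  have : 2 * B * / INR N <= 2 * B * 1 by apply: Rmult_le_compat_l; lra.
  lra.
move=> K2.
have -> : (l1 - l0 = (E 1 - E 0) - ((E 1 - l1) - (E 0 - l0)))%C by ring.
have K3 : Cmod (E 1 - l1 - (E 0 - l0))%C <= eps / 2 + eps / 2.
  by apply: Cmod_minus_le; apply: Rlt_le.
have := Cmod_minus_le K2 K3; lra.
Qed.

End Deform.

(** An arbitrary value if the sum diverges; this keeps functions such as [theta] total on [C]. *)
Definition usum (I : eqType) (f : I -> C) : C :=
  ClassicalEpsilon.epsilon (inhabits (RtoC 0)) (is_usum f).

Lemma usum_correct (I : eqType) (f : I -> C) :
  (exists l, is_usum f l) -> is_usum f (usum f).
Proof. exact: ClassicalEpsilon.epsilon_spec. Qed.

Lemma is_usum_shift (f : Z -> C) (l : C) (a : Z) :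
  is_usum f l -> is_usum (fun m => f (m + a)%Z) l.
Proof.
move=> H.
have pq : cancel (fun m => m + a)%Z (fun m => m - a)%Z by move=> x; lia.
have qp : cancel (fun m => m - a)%Z (fun m => m + a)%Z by move=> x; lia.
exact: (proj1 (is_usum_bij f l pq qp) H).
Qed.

(** * Poisson summation for Gaussians *)

Section GaussianDecay.
Variable w : C.
Hypothesis w_half : Rabs (Im w) < Re w.

Lemma Re_sq_pos : 0 < Re (w * w)%C.
Proof.
have -> : Re (w * w)%C = (Re w - Im w) * (Re w + Im w).
  by case: (w) => a b; rewrite /Re /Im /=; ring.
have := Rle_abs (Im w); have := Rle_abs (- Im w); rewrite Rabs_Ropp => i1 i2.
nra.
Qed.

(** The second expression is the second derivative of [Psi (w * y)] in [y], see [gauss_der2]; it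
    controls second differences. *)
Lemma gauss_decay : exists B, 0 <= B /\ forall y : R,
  Cmod (Psi (w * y)%C) <= B * / (1 + y ^ 2) /\
  Cmod ((((2 * PI * w * (w * y)) * (2 * PI * w * (w * y))) - 2 * PI * w * w)
    * Psi (w * y))%C <= B * / (1 + y ^ 2).
Proof.
set b := 1 + Cmod w; have w0 := Cmod_ge_0 w.
have wb : Cmod w <= b by rewrite /b; lra.
have b1 : 1 <= b by rewrite /b; lra.
have [M [M0 HM]] := Psi_decay b Re_sq_pos.
exists (100 * b ^ 4 * M); split.
  by apply: Rmult_le_pos => //; have := pow_le b 4; lra.
move=> y.
have hP := HM w (RtoC 0) y (Rle_refl _) wb.
have {hP}hP : (1 + Rabs y) ^ 6 * Cmod (Psi (w * RtoC y)%C) <= M.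
  by rewrite -[(w * y)%C]Cplus_0_r; apply: hP; rewrite Cmod_0; lra.
have P0 := Cmod_ge_0 (Psi (w * y)%C).
have := cauchy_weight P0 hP; have := Rabs_pos y.
set X := 1 + Rabs y => y0 K.
have X1 : 1 <= X by rewrite /X; lra.
have b4 : 1 <= b ^ 4 by apply: pow_R1_Rle.
have X3 : 1 <= X ^ 3 by apply: pow_R1_Rle.
have fin k : k <= 100 * b ^ 4 * X ^ 3 ->
    k * Cmod (Psi (w * y)%C) <= 100 * b ^ 4 * M * / (1 + y ^ 2).
  move=> hk.
  apply: Rle_trans (_ : 100 * b ^ 4 * X ^ 3 * Cmod (Psi (w * y)%C) <= _).
    exact: Rmult_le_compat_r.
  have -> : 100 * b ^ 4 * X ^ 3 * Cmod (Psi (w * y)%C) =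
    100 * b ^ 4 * (X ^ 3 * Cmod (Psi (w * y)%C)) by ring.
  rewrite [_ * M * _]Rmult_assoc; apply: Rmult_le_compat_l => //; lra.
split.
- by rewrite -[Cmod _]Rmult_1_l; apply: fin; nra.
- have h2 := Cmod_2PI.
  have hy : Cmod (w * y)%C <= b * X.
    by apply: Cmod_mult_le => //; rewrite Cmod_R /X; lra.
  apply: Rle_trans (_ : (8 * b * (b * X) * (8 * b * (b * X)) + 8 * b * b) *
     Cmod (Psi (w * y)%C) <= _).
    apply: Cmod_mult_le; last exact: Rle_refl.
    apply: Cmod_minus_le.
      by apply: Cmod_mult_le; apply: Cmod_mult_le => //; exact: Cmod_mult_le.
    by apply: Cmod_mult_le => //; exact: Cmod_mult_le.
  apply: fin.
  have -> : 8 * b * (b * X) * (8 * b * (b * X)) + 8 * b * b =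
    64 * (b ^ 4 * X ^ 2) + 8 * (b ^ 2 * 1) by ring.
  have k1 : b ^ 4 * X ^ 2 <= b ^ 4 * X ^ 3.
    by apply: Rmult_le_compat_l; [lra | apply: Rle_pow => //; lia].
  have k2 : b ^ 2 * 1 <= b ^ 4 * X ^ 3.
    apply: Rmult_le_compat; try lra; first exact: pow2_ge_0.
    by apply: Rle_pow => //; lia.
  have -> : 100 * b ^ 4 * X ^ 3 = 100 * (b ^ 4 * X ^ 3) by ring.
  have p0 : 0 <= b ^ 2 * 1 by rewrite Rmult_1_r; exact: pow2_ge_0.
  move: k1 k2 p0; set p := b ^ 4 * X ^ 3; set q := b ^ 2 * 1.
  set r := b ^ 4 * X ^ 2; lra.
Qed.

Lemma gauss_der2 (y : R) :
  Cder (fun y => Psi (w * y)%C) y (- (2 * PI * w * (w * y)) * Psi (w * y))%C /\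
  Cder (fun y => - (2 * PI * w * (w * y)) * Psi (w * y))%C y
   ((((2 * PI * w * (w * y)) * (2 * PI * w * (w * y))) - 2 * PI * w * w)
    * Psi (w * y))%C.
Proof.
have D1 : Cder (fun y => Psi (w * y)%C) y
    (- (2 * PI * w * (w * y)) * Psi (w * y))%C.
  apply: Cder_ext (Psi_der w 0 y) => [z|]; first by rewrite Cplus_0_r.
  by rewrite !Cplus_0_r.
split => //.
apply: Cder_ext (Cder_mult (Cder_linear (- (2 * PI * w * w))%C 0 y) D1) => [z|].
  by ring.
ring.
Qed.

Lemma gauss_usum (N : nat) (u : Z -> C) : (0 < N)%N ->
  (forall m, Cmod (u m) <= 1) ->
  exists l, is_usum (fun m : Z => Psi (w * RtoC (IZR m / INR N)) * u m)%C l.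
Proof.
move=> Npos u1; have [B [B0 HB]] := gauss_decay.
have N1 : 1 <= INR N by rewrite -INR_1; apply: le_INR; lia.
apply: (ex_usum (g := fun m => B * / (1 + (IZR m / INR N) ^ 2))); last first.
  apply: rbounded_scal => //; exact: rbounded_cauchy.
move=> m; rewrite -[X in _ <= X]Rmult_1_r.
by apply: Cmod_mult_le => //; have [] := HB (IZR m / INR N).
Qed.

Lemma one_minus_cos (x : R) : Rabs x <= PI -> x ^ 2 / 18 <= 1 - cos x.
Proof.
move=> hx.
have -> : 1 - cos x = 2 * (sin (Rabs x / 2)) ^ 2.
  have -> : cos x = cos (Rabs x).
    by rewrite /Rabs; case: Rcase_abs => // _; rewrite cos_neg.
  have {1}-> : Rabs x = 2 * (Rabs x / 2) by field.
  rewrite cos_2a_sin; ring.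
have P4 := PI_4; have P0 := PI_RGT_0; have x0 := Rabs_pos x.
rewrite -(pow2_abs x); set v := Rabs x in hx x0 *.
have hs : v / 2 - (v / 2) ^ 3 / 6 <= sin (v / 2).
  have h1 : 0 <= v / 2 by lra.
  have h2 : v / 2 <= PI by lra.
  have [+ _] := @sin_bound (v / 2) 0 h1 h2.
  rewrite /sin_approx /sin_term /=; lra.
(* Since v / 2 <= PI / 2 <= 2, the factor 1 - (v / 2)^2 / 6 is at least 1 / 3. Then 2 (v / 6)^2 =
   v^2 / 18. *)
have : v / 6 <= sin (v / 2).
  apply: Rle_trans hs.
  have : (v / 2) ^ 2 <= 4 by nra.
  have -> : v / 2 - (v / 2) ^ 3 / 6 = v / 2 * (1 - (v / 2) ^ 2 / 6) by field.
  nra.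
nra.
Qed.

Lemma e2pi_R (x : R) : e2pi (RtoC x) = (cos (2 * PI * x), sin (2 * PI * x)).
Proof.
rewrite /e2pi.
have -> : (2 * PI * Ci * RtoC x)%C = (0, 2 * PI * x).
  by rewrite /Ci /Cmult /RtoC /=; f_equal; ring.
by rewrite /Cexp /Re /Im /= exp_0; f_equal; ring.
Qed.

(* The sum of the second differences is [2 cos (2 PI n / N) - 2] times [l], and
   [2 - 2 cos (2 PI n / N)] is at least [n ^ 2 / N ^ 2] when [2 |n| <= N]. *)
Lemma fourier_decay : exists K, 0 <= K /\ forall (N : nat) (n : Z) (l : C),
  (0 < N)%N -> (2 * Z.abs n <= Z.of_nat N)%Z ->
  is_usum (fun m : Z => Psi (w * RtoC (IZR m / INR N)) *
    e2pi (RtoC (- (IZR n * IZR m / INR N))))%C l ->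
  Cmod (l / INR N)%C <= K * / (1 + IZR n ^ 2).
Proof.
have [B [B0 HB]] := gauss_decay.
(* The trivial bound 8 B serves the summand 1 of 1 + n^2, the second differences give 96 B for
   n^2. *)
exists (200 * B); split; first by lra.
move=> N n l Npos nN H.
have N1 : 1 <= INR N by rewrite -INR_1; apply: le_INR; lia.
have iN : 0 < / INR N by apply: Rinv_0_lt_compat; lra.
have iN1 : / INR N <= 1 by rewrite -Rinv_1; apply: Rinv_le_contravar; lra.
pose f (m : Z) := Psi (w * RtoC (IZR m / INR N))%C.
pose u (m : Z) := e2pi (RtoC (- (IZR n * IZR m / INR N))).
have u1 m : Cmod (u m) = 1 by exact: Cmod_e2pi_R.
pose om := e2pi (RtoC (- (IZR n / INR N))).
pose omi := e2pi (RtoC (IZR n / INR N)).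
have omK : (om * omi = 1)%C.
  by rewrite /om /omi -e2pi_plus -RtoC_plus Rplus_opp_l e2pi_0.
have uS m : (u (m + 1)%Z = u m * om)%C.
  rewrite /u /om -e2pi_plus -RtoC_plus; f_equal; f_equal.
  rewrite plus_IZR; field; lra.
have b1 : Cmod l <= 8 * B * INR N.
  apply: (is_usum_bound H) => F uF.
  apply: Rle_trans (_ : \rsum_(i <- F) (B * / (1 + (IZR i / INR N) ^ 2)) <= _).
    apply: rsum_le => i _ _; rewrite Cmod_mult Cmod_e2pi_R Rmult_1_r.
    by have [] := HB (IZR i / INR N).
  rewrite -big_distrr /=.
  have := rsum_cauchy N1 uF => hr.
  have -> : 8 * B * INR N = B * (8 * INR N) by ring.
  exact: Rmult_le_compat_l.
have H1 : is_usum (fun m => f (m + 1)%Z * u m)%C (omi * l)%C.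
  apply: is_usum_ext (is_usum_scal omi (is_usum_shift 1 H)) => m.
  rewrite -/(u (m + 1)%Z) uS -/(f _).
  have -> : (omi * (f (m + 1)%Z * (u m * om)) = f (m + 1)%Z * u m * (om * omi))%C.
    by ring.
  by rewrite omK; ring.
have H2 : is_usum (fun m => f (m + -1)%Z * u m)%C (om * l)%C.
  apply: is_usum_ext (is_usum_scal om (is_usum_shift (-1) H)) => m.
  rewrite -/(u (m + -1)%Z) -/(f _).
  have -> : u m = (u (m + -1)%Z * om)%C by rewrite -uS; f_equal; lia.
  by ring.
have H3 : is_usum (fun m => (f (m + 1)%Z - 2 * f m + f (m + -1)%Z) * u m)%C
    ((om + omi - 2) * l)%C.
  have := is_usum_plus (is_usum_plus H1 H2) (is_usum_scal (- RtoC 2)%C H).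
  have -> : (omi * l + om * l + - RtoC 2 * l = (om + omi - 2) * l)%C by ring.
  apply: is_usum_ext => m; rewrite -/(u m) -/(f _); ring.
have b2 : Cmod ((om + omi - 2) * l)%C <= 96 * B * / INR N.
  apply: (is_usum_bound H3) => F uF.
  apply: Rle_trans (_ : \rsum_(i <- F) (12 * B * (/ INR N) ^ 2 *
      / (1 + (IZR i / INR N) ^ 2)) <= _).
    apply: rsum_le => i _ _; rewrite Cmod_mult u1 Rmult_1_r.
    have tw (h : R) := @taylor_weight (fun y => Psi (w * RtoC y)%C)
      (fun y => - (2 * PI * w * (w * y)) * Psi (w * y))%C
      (fun y => (((2 * PI * w * (w * y)) * (2 * PI * w * (w * y)))
        - 2 * PI * w * w) * Psi (w * y))%C B (IZR i / INR N) h B0.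
    have tw' (h : R) : Rabs h <= 1 -> _ := fun hh => tw h hh (fun t =>
      conj (proj1 (gauss_der2 t)) (conj (proj2 (gauss_der2 t)) (proj2 (HB t)))).
    have t1 := tw' (/ INR N); have t2 := tw' (- / INR N).
    rewrite Rabs_Ropp Rabs_pos_eq in t1 t2; last by lra.
    have {}t1 := t1 iN1; have {}t2 := t2 iN1.
    have := Cmod_plus_le t1 t2.
    have -> : 6 * B * (/ INR N) ^ 2 * / (1 + (IZR i / INR N) ^ 2) +
      6 * B * (- / INR N) ^ 2 * / (1 + (IZR i / INR N) ^ 2) =
      12 * B * (/ INR N) ^ 2 * / (1 + (IZR i / INR N) ^ 2) by ring.
    apply: Rle_trans; right; f_equal; rewrite /f.
    have -> : IZR (i + 1) / INR N = IZR i / INR N + / INR N.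
      by rewrite plus_IZR; field; lra.
    have -> : IZR (i + -1) / INR N = IZR i / INR N + - / INR N.
      by rewrite plus_IZR; field; lra.
    by rewrite (RtoC_opp (/ INR N)); ring.
  rewrite -big_distrr /=.
  have := rsum_cauchy N1 uF => hr.
  have -> : 96 * B * / INR N = 12 * B * (/ INR N) ^ 2 * (8 * INR N) by field; lra.
  by apply: Rmult_le_compat_l => //; nra.
have n0 : 0 <= IZR n ^ 2 by exact: pow2_ge_0.
have om2 : IZR n ^ 2 / INR N ^ 2 <= Cmod (om + omi - 2)%C.
  have hx : Rabs (2 * PI * (IZR n / INR N)) <= PI.
    have P0 := PI_RGT_0.
    rewrite Rabs_mult (Rabs_pos_eq (2 * PI)); last by lra.
    rewrite Rabs_div ?(Rabs_pos_eq (INR N)); try lra.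
    have : 2 * Rabs (IZR n) <= INR N.
      by rewrite -abs_IZR INR_IZR_INZ -mult_IZR; apply: IZR_le.
    move=> hn.
    have : 2 * (Rabs (IZR n) / INR N) <= 1.
      apply: (Rmult_le_reg_r (INR N)); first by lra.
      have -> : 2 * (Rabs (IZR n) / INR N) * INR N = 2 * Rabs (IZR n) by field; lra.
      lra.
    nra.
  have := one_minus_cos hx.
  have -> : (2 * PI * (IZR n / INR N)) ^ 2 / 18 =
    (4 * PI ^ 2 / 18) * (IZR n ^ 2 / INR N ^ 2) by field; lra.
  (* So 4 PI^2 / 18 >= 1 / 2, and twice the bound on 1 - cos is at least n^2 / N^2. *)
  have P2 : 9 <= 4 * PI ^ 2.
    by have := PI2_3_2; rewrite /PI2 => ?; nra.
  have q0 : 0 <= IZR n ^ 2 / INR N ^ 2.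
    by apply: Rmult_le_pos => //; apply: Rlt_le; apply: Rinv_0_lt_compat; nra.
  move=> hc.
  apply: Rle_trans (re_le_Cmod _).
  have -> : Re (om + omi - 2)%C = - (2 * (1 - cos (2 * PI * (IZR n / INR N)))).
    rewrite /om /omi !e2pi_R /Re /=.
    have -> : 2 * PI * - (IZR n / INR N) = - (2 * PI * (IZR n / INR N)) by ring.
    by rewrite cos_neg; ring.
  rewrite Rabs_Ropp; apply: Rle_trans (Rle_abs _); nra.
rewrite Cmod_mult in b2.
have iNC : RtoC (INR N) <> RtoC 0 by move/RtoC_inj; lra.
rewrite Cmod_div // Cmod_R (Rabs_pos_eq (INR N)); last by lra.
apply: (Rmult_le_reg_r (1 + IZR n ^ 2)); first by lra.
rewrite [_ * _ * / _ * _]Rmult_assoc Rinv_l; last by lra.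
rewrite Rmult_1_r.
have l0 := Cmod_ge_0 l.
have b3 : Cmod l / INR N * IZR n ^ 2 <= 96 * B.
  have -> : Cmod l / INR N * IZR n ^ 2 = INR N * (IZR n ^ 2 / INR N ^ 2 * Cmod l).
    by field; lra.
  apply: Rle_trans (_ : INR N * (96 * B * / INR N) <= _); last first.
    by right; field; lra.
  apply: Rmult_le_compat_l; first by lra.
  apply: Rle_trans b2; exact: Rmult_le_compat_r.
have b4 : Cmod l / INR N <= 8 * B.
  apply: (Rmult_le_reg_r (INR N)); first by lra.
  by rewrite /Rdiv Rmult_assoc Rinv_l; lra.
lra.
Qed.
End GaussianDecay.

(** Replacing [k] by its residue of least absolute value brings the angle into [-PI, PI], where
    [one_minus_cos] separates the cosine from 1. *)
Lemma e2pi_ne1 (k : Z) (N : nat) : (0 < N)%N -> ~ (Z.of_nat N | k)%Z ->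
  e2pi (RtoC (IZR k / INR N)) <> RtoC 1.
Proof.
move=> Npos kN.
have N0 : 0 < INR N by exact: INR_gt0.
have Nz : (0 < Z.of_nat N)%Z by lia.
have [r [q [kE [r1 r2]]]] : exists r q : Z, k = (Z.of_nat N * q + r)%Z /\
    r <> 0%Z /\ (2 * Z.abs r <= Z.of_nat N)%Z.
  have E := Z.div_mod k (Z.of_nat N) ltac:(lia).
  have := Z.mod_pos_bound k _ Nz => b.
  have r0 : (k mod Z.of_nat N <> 0)%Z.
    by move=> E0; apply: kN; apply/Z.mod_divide => //; lia.
  case: (Z_le_gt_dec (2 * (k mod Z.of_nat N)) (Z.of_nat N)) => h.
  - by exists (k mod Z.of_nat N)%Z, (k / Z.of_nat N)%Z; lia.
  - by exists (k mod Z.of_nat N - Z.of_nat N)%Z, (k / Z.of_nat N + 1)%Z; lia.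
have -> : RtoC (IZR k / INR N) = (IZR q + RtoC (IZR r / INR N))%C.
  rewrite kE -RtoC_plus plus_IZR mult_IZR -INR_IZR_INZ; f_equal; field; lra.
rewrite e2pi_plus e2pi_Z Cmult_1_l e2pi_R => - [E _].
have P0 := PI_RGT_0.
have hr : Rabs (IZR r / INR N) <= / 2.
  rewrite Rabs_div ?(Rabs_pos_eq (INR N)); try lra.
  apply: (Rmult_le_reg_r (INR N)) => //.
  rewrite /Rdiv Rmult_assoc Rinv_l; last by lra.
  have : 2 * Rabs (IZR r) <= INR N.
    by rewrite -abs_IZR INR_IZR_INZ -mult_IZR; apply: IZR_le.
  by lra.
have := @one_minus_cos (2 * PI * (IZR r / INR N)).
rewrite E Rabs_mult (Rabs_pos_eq (2 * PI)); last by lra.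
have h1 : 2 * PI * Rabs (IZR r / INR N) <= PI by nra.
move=> /(_ h1).
have : IZR r / INR N <> 0.
  move=> Er; apply: r1; apply: eq_IZR.
  have -> : IZR r = IZR r / INR N * INR N by field; lra.
  by rewrite Er; ring.
move=> r0.
have : 0 < (2 * PI * (IZR r / INR N)) ^ 2.
  by apply: pow2_gt_0; apply: Rmult_integral_contrapositive_currified => //; lra.
lra.
Qed.

Lemma csum_e2pi (N : nat) (k : Z) : (0 < N)%N ->
  \csum_(i <- iota 0 N) e2pi (RtoC (INR i * (IZR k / INR N))) =
  if (k mod Z.of_nat N =? 0)%Z then RtoC (INR N) else RtoC 0.
Proof.
move=> Npos.
have N0 : 0 < INR N by exact: INR_gt0.
case: Z.eqb_spec => [E|E].
- have [q kE] : (Z.of_nat N | k)%Z by apply/Z.mod_divide => //; lia.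
  have H i : e2pi (RtoC (INR i * (IZR k / INR N))) = RtoC 1.
    have -> : INR i * (IZR k / INR N) = IZR (Z.of_nat i * q).
      rewrite kE !mult_IZR -!INR_IZR_INZ; field; lra.
    exact: e2pi_Z.
  rewrite (eq_bigr _ (fun i _ => H i)).
  elim: (N) => [|n IH]; first by rewrite big_nil.
  rewrite -addn1 iotaD big_cat /= big_seq1 IH -RtoC_plus.
  by rewrite plus_INR.
- set z := e2pi (RtoC (IZR k / INR N)).
  have z1 : z <> RtoC 1.
    by apply: e2pi_ne1 => // D; apply: E; apply/Z.mod_divide => //; lia.
  set S := \csum_(i <- _) _.
  have zS i : e2pi (RtoC (INR i.+1 * (IZR k / INR N))) =
      (z * e2pi (RtoC (INR i * (IZR k / INR N))))%C.
    by rewrite /z -e2pi_plus -RtoC_plus S_INR; f_equal; f_equal; ring.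
  have T : forall M, ((z - 1) * (\csum_(i <- iota 0 M)
      e2pi (RtoC (INR i * (IZR k / INR N)))))%C =
      (e2pi (RtoC (INR M * (IZR k / INR N))) - 1)%C.
    elim=> [|n IH]; first by rewrite big_nil Rmult_0_l e2pi_0; ring.
    rewrite -(addn1 n) iotaD big_cat /= big_seq1 Cmult_plus_distr_l IH add0n addn1.
    rewrite zS; ring.
  have := T N.
  have -> : INR N * (IZR k / INR N) = IZR k by field; lra.
  rewrite e2pi_Z -/S => ES.
  have z1' : (z - 1)%C <> RtoC 0.
    move=> E0; apply: z1; have -> : z = (z - 1 + 1)%C by ring.
    by rewrite E0; ring.
  have -> : S = (/ (z - 1) * ((z - 1) * S))%C by field.
  by rewrite ES; ring.
Qed.

Lemma is_usum_fin (I : eqType) (r : seq I) (g : I -> C) : uniq r ->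
  is_usum (fun i => if i \in r then g i else RtoC 0) (\csum_(i <- r) g i).
Proof.
move=> ur eps e0; exists r => F uF sF.
have -> : \csum_(i <- F) (if i \in r then g i else RtoC 0) = \csum_(i <- r) g i.
  rewrite -big_mkcond /= -big_filter; apply: perm_big; apply: uniq_perm => //.
    exact: filter_uniq.
  by move=> i; rewrite mem_filter; case: (boolP (i \in r)) => //= /sF ->.
set s := \csum_(i <- r) _.
have -> : (s - s = RtoC 0)%C by ring.
by rewrite Cmod_0.
Qed.

(** Residues nearest to 0, because [fourier_decay] is only available for 2 |n| <= N. *)
Definition centered (N : nat) : seq Z :=
  [seq (Z.of_nat i - Z.of_nat (N %/ 2))%Z | i <- iota 0 N].

Lemma centered_uniq N : uniq (centered N).
Proof. by rewrite map_inj_uniq ?iota_uniq // => i j; lia. Qed.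

Lemma centered_abs N n : n \in centered N -> (2 * Z.abs n <= Z.of_nat N)%Z.
Proof. move/mapP => [i]; rewrite mem_iota => hi ->; lia. Qed.

Lemma centered_mem N n : (2 * Z.abs n < Z.of_nat N)%Z -> n \in centered N.
Proof.
move=> h; apply/mapP; exists (Z.to_nat (n + Z.of_nat (N %/ 2))).
  by rewrite mem_iota; lia.
lia.
Qed.

(* Discrete Fourier inversion on [Z / N], applied to a periodized Gaussian. *)
Lemma finite_fourier (w : C) (N : nat) (j : Z) (l : Z -> C) (A : C) :
  (0 < N)%N ->
  (forall n, is_usum (fun m : Z => Psi (w * RtoC (IZR m / INR N)) *
     e2pi (RtoC (- (IZR n * IZR m / INR N))))%C (l n)) ->
  is_usum (fun q : Z => Psi (w * RtoC (IZR q + IZR j / INR N))%C) A ->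
  \csum_(n <- centered N) (l n / INR N * e2pi (RtoC (IZR n * (IZR j / INR N)))) = A.
Proof.
move=> Npos Hl HA.
have N0 : 0 < INR N by exact: INR_gt0.
have NC : RtoC (INR N) <> RtoC 0 by move/RtoC_inj; lra.
have H1 := is_usum_finite (centered N) (fun n =>
  is_usum_scal (/ INR N * e2pi (RtoC (IZR n * (IZR j / INR N))))%C (Hl n)).
have -> : \csum_(n <- centered N)
    (l n / INR N * e2pi (RtoC (IZR n * (IZR j / INR N)))) =
  \csum_(n <- centered N)
    (/ INR N * e2pi (RtoC (IZR n * (IZR j / INR N))) * l n).
  by apply: eq_bigr => n _; rewrite /Cdiv; ring.
apply: (is_usum_unique H1) => {H1}.
pose c := Z.of_nat (N %/ 2).
(* Summing over [n] first, orthogonality of the characters leaves exactly the [m] congruent to [j]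
   modulo [N]. *)
apply: (@is_usum_ext _ (fun m : Z => if ((j - m) mod Z.of_nat N =? 0)%Z then
    Psi (w * RtoC (IZR m / INR N))%C else RtoC 0)).
  move=> m; rewrite /centered big_map.
  have E i : (/ INR N * e2pi (RtoC (IZR (Z.of_nat i - c) * (IZR j / INR N))) *
     (Psi (w * RtoC (IZR m / INR N)) *
      e2pi (RtoC (- (IZR (Z.of_nat i - c) * IZR m / INR N)))))%C =
    (/ INR N * Psi (w * RtoC (IZR m / INR N)) *
     e2pi (RtoC (- (IZR c * (IZR (j - m) / INR N)))) *
     e2pi (RtoC (INR i * (IZR (j - m) / INR N))))%C.
    have -> : e2pi (RtoC (INR i * (IZR (j - m) / INR N))) =
      (e2pi (RtoC (IZR (Z.of_nat i - c) * (IZR j / INR N))) *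
      e2pi (RtoC (- (IZR (Z.of_nat i - c) * IZR m / INR N))) *
      e2pi (RtoC (IZR c * (IZR (j - m) / INR N))))%C.
      rewrite -!e2pi_plus -!RtoC_plus; f_equal; f_equal.
      by rewrite !minus_IZR -INR_IZR_INZ; field; lra.
    set x := RtoC (- (IZR c * (IZR (j - m) / _))).
    set y := RtoC (IZR c * (IZR (j - m) / _)).
    have EK : (e2pi x * e2pi y = 1)%C.
      by rewrite -e2pi_plus /x /y -RtoC_plus Rplus_opp_l e2pi_0.
    set e1 := e2pi (RtoC (IZR (Z.of_nat i - c) * _)).
    set e2 := e2pi (RtoC (- _)); set P := Psi _.
    transitivity (/ INR N * P * (e1 * e2) * (e2pi x * e2pi y))%C; last by ring.
    by rewrite EK; ring.
  rewrite (eq_bigr _ (fun i _ => E i)) -big_distrr /= csum_e2pi //.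
  case: Z.eqb_spec => h; last by ring.
  have [q jm] : (Z.of_nat N | j - m)%Z by apply/Z.mod_divide => //; lia.
  have -> : - (IZR c * (IZR (j - m) / INR N)) = IZR (- (c * q)).
    by rewrite jm opp_IZR !mult_IZR -INR_IZR_INZ; field; lra.
  by rewrite e2pi_Z; field.
(* These are m = j + N q, and m / N = q + j / N is the argument in the periodized sum. *)
apply: (@is_usum_inj _ _ (fun q : Z => (j + Z.of_nat N * q)%Z)).
- by move=> a b; nia.
- move=> m hm; case: Z.eqb_spec => // h.
  have [q jm] : (Z.of_nat N | j - m)%Z by apply/Z.mod_divide => //; lia.
  by case: (hm (- q)%Z); lia.
- apply: is_usum_ext HA => q.
  have -> : ((j - (j + Z.of_nat N * q)) mod Z.of_nat N =? 0)%Z = true.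
    apply/Z.eqb_eq; apply/Z.mod_divide; first by lia.
    by exists (- q)%Z; lia.
  f_equal; f_equal; f_equal; rewrite plus_IZR mult_IZR -INR_IZR_INZ; field; lra.
Qed.

Lemma usum_re_ge (I : eqType) (f : I -> C) (l : C) (i0 : I) :
  (forall i, 0 <= Re (f i)) -> is_usum f l -> Re (f i0) <= Re l.
Proof.
move=> f0 H; apply: le_epsilon => eps e0; have [F0 HF] := H eps e0.
have := HF (undup (i0 :: F0)) (undup_uniq _).
set s := \csum_(i <- _) _ => h.
have {}h : Cmod (s - l)%C < eps.
  by apply: h => i Hi; rewrite mem_undup in_cons Hi orbT.
have : Rabs (Re (s - l)%C) < eps by apply: Rle_lt_trans (re_le_Cmod _) h.
have -> : Re (s - l)%C = Re s - Re l by [].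
move/Rabs_def2 => [h1 h2].
suff : Re (f i0) <= Re s by lra.
rewrite /s csum_re.
have := @rsum_sub _ [:: i0] (undup (i0 :: F0)) (fun i => Re (f i)) f0 isT
  (undup_uniq _).
rewrite big_seq1; apply => i; rewrite mem_seq1 => /eqP ->.
by rewrite mem_undup in_cons eqxx.
Qed.

Lemma is_lim_seq_div_S (c : R) : is_lim_seq (fun k => c / INR k.+1) 0.
Proof.
have -> : Rbar.Finite 0 = Rbar_mult c (Rbar_inv p_infty) by rewrite /= Rmult_0_r.
apply: is_lim_seq_scal_l; apply: is_lim_seq_inv => //.
exact: (proj1 (is_lim_seq_incr_1 INR p_infty) is_lim_seq_INR).
Qed.

Lemma is_lim_seq_squeeze (u v : nat -> R) :
  (forall k, 0 <= u k) -> (exists k0, forall k, (k0 <= k)%coq_nat -> u k <= v k) ->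
  is_lim_seq v 0 -> is_lim_seq u 0.
Proof.
move=> u0 [k0 uv] Hv.
apply: (is_lim_seq_le_le_loc (fun _ => 0) u v 0) => //.
  by exists k0 => k hk; split => //; exact: uv.
exact: is_lim_seq_const.
Qed.

Definition theta_kernel (t : C) (y : R) : C := Cexp (- PI * t * (y * y))%C.

Lemma Psi_sqrt (t : C) (y : R) : Psi (Csqrt t * y)%C = theta_kernel t y.
Proof.
rewrite /Psi /theta_kernel; f_equal.
have [E _] := Csqrt_spec t; rewrite -{3}E; ring.
Qed.

(** Riemann sum of step 1 / N for the integral of exp(- PI y^2); the kappa_N of the overview. *)
Definition gauss_mean (N : nat) : C :=
  (usum (fun m : Z => Psi (RtoC (IZR m / INR N))) / INR N)%C.

Section ThetaInversion.
Variables (t : C) (j : Z) (D : nat).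
Hypotheses (t_pos : 0 < Re t) (D_pos : (0 < D)%N).

Let w := Csqrt t.
(** Only multiples of [D] occur, so that x = j / D lies on every grid. *)
Let N (k : nat) : nat := (D * k.+1)%N.
Let x : R := IZR j / INR D.
Let kappa (k : nat) : C := gauss_mean (N k).

Let w_half : Rabs (Im w) < Re w.
Proof. by have [] := Csqrt_half t_pos. Qed.

Let w0 : w <> RtoC 0.
Proof. by move=> E; have := w_half; rewrite E Rabs_R0 /=; lra. Qed.

Let one_half : Rabs (Im (RtoC 1)) < Re (RtoC 1).
Proof. by rewrite /Im /Re /= Rabs_R0; lra. Qed.

Let winv_half : Rabs (Im (/ w)%C) < Re (/ w)%C.
Proof.
have := w_half; case: (w) w0 => a b; rewrite /Re /Im /= => _ h.
have a0 : 0 < a by have := Rabs_pos b; lra.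
have d0 : 0 < a * (a * 1) + b * (b * 1) by nra.
rewrite /Rdiv !Rabs_mult Rabs_Ropp (Rabs_pos_eq (/ _)); last first.
  by apply: Rlt_le; exact: Rinv_0_lt_compat.
by apply: Rmult_lt_compat_r => //; exact: Rinv_0_lt_compat.
Qed.

Let N_pos k : (0 < N k)%N. Proof. by rewrite /N muln_gt0 D_pos. Qed.
Let N_ge k : INR k.+1 <= INR (N k).
Proof. by apply: le_INR; rewrite /N; nia. Qed.

Lemma kernel_usum (u : C) (v : Z -> C) (M : nat) : Rabs (Im u) < Re u ->
  (0 < M)%N -> (forall m, Cmod (v m) = 1) ->
  is_usum (fun m : Z => Psi (u * RtoC (IZR m / INR M)) * v m)%C
   (usum (fun m : Z => Psi (u * RtoC (IZR m / INR M)) * v m)%C).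
Proof.
move=> hu hM hv; apply: usum_correct; apply: gauss_usum => // m.
by rewrite hv; exact: Rle_refl.
Qed.

Let kappa_usum k :
  is_usum (fun m : Z => Psi (RtoC (IZR m / INR (N k)))) (INR (N k) * kappa k)%C.
Proof.
have NC : RtoC (INR (N k)) <> RtoC 0.
  by move/RtoC_inj; have := N_ge k; have := lt_0_INR k.+1 (Nat.lt_0_succ k); lra.
have -> : (INR (N k) * kappa k =
    usum (fun m : Z => Psi (RtoC (IZR m / INR (N k)))))%C.
  by rewrite /kappa /gauss_mean; field.
apply: usum_correct.
have := @kernel_usum 1 (fun _ => RtoC 1) (N k) one_half (N_pos k) (fun _ => Cmod_1).
set s := usum _ => h; exists s.
by apply: is_usum_ext h => m; rewrite Cmult_1_r Cmult_1_l.
Qed.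

(** By [finite_fourier], [A] is an exact finite Fourier sum for each [k]. Its coefficients are
    compared with kappa_k / w times the dual Gaussian; [fourier_decay] supplies the majorant that
    [tannery] needs. *)
Lemma theta_approx (A B : C) :
  is_usum (fun q : Z => theta_kernel t (IZR q + x)) A ->
  is_usum (fun n : Z => theta_kernel (/ t) (IZR n) * e2pi (RtoC (IZR n * x)))%C B ->
  is_lim_seq (fun k => Cmod (A - kappa k / w * B)%C) 0.
Proof.
move=> HA HB.
pose l k (n : Z) := usum (fun m : Z => Psi (w * RtoC (IZR m / INR (N k))) *
  e2pi (RtoC (- (IZR n * IZR m / INR (N k)))))%C.
have Hl k n : is_usum (fun m : Z => Psi (w * RtoC (IZR m / INR (N k))) *
  e2pi (RtoC (- (IZR n * IZR m / INR (N k)))))%C (l k n).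
  by apply: kernel_usum => // m; exact: Cmod_e2pi_R.
have xN k : IZR (j * Z.of_nat k.+1) / INR (N k) = x.
  have D0 : 0 < INR D by exact: INR_gt0.
  have k0 : 0 < INR k.+1 by apply: lt_0_INR; lia.
  rewrite /x /N mult_INR mult_IZR -INR_IZR_INZ; field; lra.
have HF k : \csum_(n <- centered (N k))
    (l k n / INR (N k) * e2pi (RtoC (IZR n * x))) = A.
  rewrite -(xN k); apply: (finite_fourier (N_pos k) (Hl k)).
  by apply: is_usum_ext HA => q; rewrite xN Psi_sqrt.
pose f k (n : Z) := ((if n \in centered (N k) then
    l k n / INR (N k) * e2pi (RtoC (IZR n * x)) else RtoC 0) +
    - (kappa k / w) * (theta_kernel (/ t) (IZR n) * e2pi (RtoC (IZR n * x))))%C.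
have Hf k : is_usum (f k) (A - kappa k / w * B)%C.
  have -> : (A - kappa k / w * B = A + - (kappa k / w) * B)%C by ring.
  apply: is_usum_plus; last exact: is_usum_scal.
  by rewrite -(HF k); apply: is_usum_fin; exact: centered_uniq.
have [K [K0 HK]] := fourier_decay w_half.
have [B1 [B10 HB1]] := gauss_decay one_half.
have [B2 [B20 HB2]] := gauss_decay winv_half.
have tw : (/ t = / w * / w)%C.
  have [E _] := Csqrt_spec t; rewrite -/w in E; rewrite -E; field; exact: w0.
have kern n : theta_kernel (/ t) (IZR n) = Psi (/ w * RtoC (IZR n))%C.
  by rewrite /theta_kernel /Psi tw; f_equal; ring.
have kap k : Cmod (kappa k) <= 8 * B1.
  have N1 : 1 <= INR (N k) by rewrite -INR_1; apply: le_INR; have := N_pos k; lia.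
  apply: (Rmult_le_reg_l (INR (N k))); first by lra.
  have -> : INR (N k) * Cmod (kappa k) = Cmod (INR (N k) * kappa k)%C.
    by rewrite Cmod_mult Cmod_R Rabs_pos_eq //; lra.
  apply: (is_usum_bound (kappa_usum k)) => F uF.
  apply: Rle_trans (_ : \rsum_(i <- F) (B1 * / (1 + (IZR i / INR (N k)) ^ 2)) <= _).
    apply: rsum_le => i _ _; rewrite -[RtoC _]Cmult_1_l.
    by have [] := HB1 (IZR i / INR (N k)).
  rewrite -big_distrr /=.
  have -> : INR (N k) * (8 * B1) = B1 * (8 * INR (N k)) by ring.
  by apply: Rmult_le_compat_l => //; exact: rsum_cauchy.
have wi0 := Cmod_ge_0 (/ w)%C.
apply: (@tannery _ f (fun n => (K + 8 * B1 * Cmod (/ w)%C * B2) *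
   / (1 + (IZR n / 1) ^ 2)) _ _ _ _ Hf).
- move=> k n; rewrite Rdiv_1_r Rmult_plus_distr_r.
  have p0 : 0 <= / (1 + IZR n ^ 2).
    by apply: Rlt_le; apply: Rinv_0_lt_compat; have := pow2_ge_0 (IZR n); lra.
  apply: Cmod_plus_le.
    case: ifP => [h|_]; last by rewrite Cmod_0; exact: Rmult_le_pos.
    rewrite Cmod_mult Cmod_e2pi_R Rmult_1_r.
    exact: (HK _ _ _ (N_pos k) (centered_abs h) (Hl k n)).
  rewrite [_ * B2 * _]Rmult_assoc.
  apply: Cmod_mult_le.
    by rewrite Cmod_opp; apply: Cmod_mult_le => //; exact: Rle_refl.
  rewrite Cmod_mult Cmod_e2pi_R Rmult_1_r kern.
  by have [] := HB2 (IZR n).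
- apply: rbounded_scal; last by apply: rbounded_cauchy; lra.
  have : 0 <= 8 * B1 * Cmod (/ w)%C * B2.
    by apply: Rmult_le_pos => //; apply: Rmult_le_pos => //; lra.
  lra.
- move=> n.
  (* Completing the square: Psi (w y + i n / w) = Psi (w y) e(- n y) exp(PI n^2 / t). The last
     factor is [E], the inverse of the dual kernel at [n], so the shift by i n / w produces the n-th
     Fourier coefficient. *)
  have [Kn [Kn0 HKn]] := deform (Ci * IZR n / w)%C w_half.
  pose E := Cexp (PI * (IZR n * IZR n) * / t)%C.
  have E0 : E <> RtoC 0 by exact: Cexp_neq0.
  have EK : (theta_kernel (/ t) (IZR n) * E = 1)%C.
    rewrite /theta_kernel /E -Cexp_plus -Cexp_0; f_equal; ring.
  apply: (is_lim_seq_squeeze (v := fun k => Kn / Cmod (w * E)%C / INR k.+1)).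
  + by move=> k; exact: Cmod_ge_0.
  + exists (2 * Z.abs_nat n)%N => k hk.
    have nk : n \in centered (N k).
      by apply: centered_mem; rewrite /N; move/leP: hk => hk; nia.
    have N0 : 0 < INR (N k) by apply: lt_0_INR; have := N_pos k; lia.
    have NC : RtoC (INR (N k)) <> RtoC 0 by move/RtoC_inj; lra.
    have kp := lt_0_INR k.+1 (Nat.lt_0_succ k).
    have wE : 0 < Cmod (w * E)%C.
      by apply/Cmod_gt_0; exact: Cmult_neq_0.
    have H : is_usum (fun m : Z => w * Psi (w * RtoC (IZR m / INR (N k)) +
        Ci * IZR n / w))%C (w * E * l k n)%C.
      apply: is_usum_ext (is_usum_scal (w * E)%C (Hl k n)) => m.
      rewrite -Cmult_assoc; f_equal.
      rewrite /E /Psi /e2pi -!Cexp_plus; f_equal.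
      rewrite tw.
      have -> : RtoC (- (IZR n * IZR m / INR (N k))) =
        (- (IZR n * RtoC (IZR m / INR (N k))))%C.
        by rewrite -RtoC_mult -RtoC_opp; f_equal; rewrite /Rdiv; ring.
      set y := RtoC (IZR m / INR (N k)).
      transitivity (- PI * ((w * y) * (w * y) + 2 * Ci * IZR n * y * (w * / w)
        + (Ci * Ci) * IZR n * IZR n * / w * / w))%C; last by rewrite /Cdiv; ring.
      by rewrite Ci2 Cinv_r //; ring.
    have := HKn (N k) _ _ (N_pos k) H (kappa_usum k) => hd.
    rewrite /f nk.
    have -> : (l k n / INR (N k) * e2pi (RtoC (IZR n * x)) +
      - (kappa k / w) * (theta_kernel (/ t) (IZR n) * e2pi (RtoC (IZR n * x))) =
      / (INR (N k) * (w * E)) * (w * E * l k n - INR (N k) * kappa k) *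
        e2pi (RtoC (IZR n * x)))%C.
      have -> : theta_kernel (/ t) (IZR n) = (/ E)%C.
        have -> : (/ E = theta_kernel (/ t) (IZR n) * E * / E)%C by rewrite EK; ring.
        by field.
      by field; do !split.
    rewrite Cmod_mult Cmod_e2pi_R Rmult_1_r Cmod_mult Cmod_inv; last first.
      by apply: Cmult_neq_0 => //; exact: Cmult_neq_0.
    rewrite Cmod_mult Cmod_R Rabs_pos_eq; last by lra.
    have -> : Kn / Cmod (w * E)%C / INR k.+1 = / (INR k.+1 * Cmod (w * E)%C) * Kn.
      by field; lra.
    apply: Rmult_le_compat => //; last first.
      apply: Rinv_le_contravar; first by nra.
      by apply: Rmult_le_compat_r; [lra | exact: N_ge].
    + exact: Cmod_ge_0.
    + by apply: Rlt_le; apply: Rinv_0_lt_compat; nra.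
  + exact: is_lim_seq_div_S.
Qed.
End ThetaInversion.

Lemma theta_kernel_usum (t : C) (v : Z -> C) : 0 < Re t ->
  (forall m, Cmod (v m) = 1) ->
  exists l, is_usum (fun m : Z => theta_kernel t (IZR m) * v m)%C l.
Proof.
move=> t0 v1; have [_ wh] := Csqrt_half t0.
have [l Hl] := gauss_usum wh (ltn0Sn 0) (fun m => Req_le _ _ (v1 m)).
exists l; apply: is_usum_ext Hl => m.
by rewrite -Psi_sqrt /= Rdiv_1_r.
Qed.

Lemma Cexp_R (x : R) : Cexp (RtoC x) = RtoC (exp x).
Proof. by rewrite /Cexp /Re /Im /= cos_0 sin_0 /RtoC; f_equal; ring. Qed.

Lemma Re_inv_pos (t : C) : 0 < Re t -> 0 < Re (/ t)%C.
Proof.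
case: t => a b; rewrite /Re /= => a0.
by apply: Rdiv_lt_0_compat => //; nra.
Qed.

(* At [t = 1], [x = 0] both sums in [theta_approx] are the same nonzero number;
   this gives the limit of [gauss_mean], and the Gaussian integral is not needed. *)
Lemma theta_inversion (t : C) (j : Z) (D : nat) (A B : C) :
  0 < Re t -> (0 < D)%N ->
  is_usum (fun q : Z => theta_kernel t (IZR q + IZR j / INR D)) A ->
  is_usum (fun n : Z => theta_kernel (/ t) (IZR n) *
    e2pi (RtoC (IZR n * (IZR j / INR D))))%C B ->
  B = (Csqrt t * A)%C.
Proof.
move=> t0 D0 HA HB.
have one0 : 0 < Re (RtoC 1) by rewrite /Re /=; lra.
have [th Hth] := @theta_kernel_usum 1 (fun _ => RtoC 1) one0 (fun _ => Cmod_1).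
have Hth1 : is_usum (fun q : Z => theta_kernel 1 (IZR q + IZR 0 / INR D)) th.
  apply: is_usum_ext Hth => m; rewrite Cmult_1_r /Rdiv Rmult_0_l Rplus_0_r //.
have Hth2 : is_usum (fun n : Z => theta_kernel (/ 1) (IZR n) *
    e2pi (RtoC (IZR n * (IZR 0 / INR D))))%C th.
  apply: is_usum_ext Hth => m.
  have -> : (/ 1 = 1)%C by field.
  by rewrite /Rdiv Rmult_0_l Rmult_0_r e2pi_0.
have := theta_approx one0 D0 Hth1 Hth2.
have := theta_approx t0 D0 HA HB.
(* All terms are positive and the term at 0 is 1. *)
have th0 : th <> RtoC 0.
  move=> E.
  have := @usum_re_ge _ _ _ 0%Z _ Hth; rewrite E.
  have kR m : (theta_kernel 1 (IZR m) * 1 = exp (- PI * (IZR m * IZR m)))%C.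
    by rewrite /theta_kernel !Cmult_1_r -Cexp_R -RtoC_opp -!RtoC_mult.
  rewrite kR Rmult_0_l Rmult_0_r exp_0 => H.
  have : 1 <= 0; last by lra.
  by apply: H => m; rewrite kR; exact: Rlt_le (exp_pos _).
have sq1 : Csqrt 1 = RtoC 1 by rewrite Csqrt_R ?sqrt_1 //; lra.
have w0 : Csqrt t <> RtoC 0.
  by apply: Csqrt_neq0 => E; move: t0; rewrite E /Re /=; lra.
have thp : 0 < Cmod th by apply/Cmod_gt_0.
rewrite sq1; set w := Csqrt t in w0 *; pose ka k := gauss_mean (D * k.+1)%N.
rewrite -/(ka _) => L1 L2.
(* The special case says that (1 - kappa_k) th tends to 0; dividing by [th] removes kappa_k from the
   general case. *)
have Z0 : is_lim_seq (fun _ : nat => Cmod (A - / w * B)%C) 0.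
  apply: (is_lim_seq_squeeze (v := fun k => Cmod (A - ka k / w * B)%C +
     Cmod (th - ka k / 1 * th)%C * (/ Cmod th * Cmod (/ w * B)%C))).
  - by move=> k; exact: Cmod_ge_0.
  - exists 0%N => k _.
    have -> : (A - / w * B = (A - ka k / w * B) - (1 - ka k) * (/ w * B))%C.
      by rewrite /Cdiv; ring.
    apply: Cmod_minus_le; first exact: Rle_refl.
    rewrite Cmod_mult -Rmult_assoc; apply: Rmult_le_compat_r.
      exact: Cmod_ge_0.
    have -> : (th - ka k / 1 * th = (1 - ka k) * th)%C by field.
    by rewrite Cmod_mult Rmult_assoc Rinv_r; lra.
  - have -> : Rbar.Finite 0 =
      Rbar.Finite (0 + 0 * (/ Cmod th * Cmod (/ w * B)%C)) by f_equal; ring.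
    apply: is_lim_seq_plus'; first exact: L1.
    apply: is_lim_seq_mult'; first exact: L2.
    exact: is_lim_seq_const.
have := is_lim_seq_unique _ _ Z0; rewrite Lim_seq_const => - [E].
have E2 := Cmod_eq_0 _ E.
have -> : A = (A - / w * B + / w * B)%C by ring.
by rewrite E2; field.
Qed.

(** * Quadratic Gauss sums and theta functions *)

Definition gsum (A m : Z) (q : nat) : C :=
  \csum_(r <- iota 0 q)
    e2pi (RtoC (IZR (A * (Z.of_nat r * Z.of_nat r) + m * Z.of_nat r) / INR q)).

Definition theta (z : C) : C := usum (fun n : Z => e2pi (IZR (n * n) * z)%C).

Lemma e2pi_kernel (z : C) (y : R) :
  e2pi (RtoC (y * y) * z)%C = theta_kernel (- (2 * Ci * z))%C y.
Proof. by rewrite /e2pi /theta_kernel; f_equal; rewrite RtoC_mult; ring. Qed.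

Lemma Re_mul_Ci (z : C) : Re (- (2 * Ci * z))%C = 2 * Im z.
Proof. by case: z => a b; rewrite /Re /Im /=; ring. Qed.

Lemma theta_usum (z : C) : upper z ->
  is_usum (fun n : Z => e2pi (IZR (n * n) * z)%C) (theta z).
Proof.
move=> z0; apply: usum_correct.
have [|l Hl] := @theta_kernel_usum (- (2 * Ci * z))%C (fun _ => RtoC 1) _
  (fun _ => Cmod_1).
  by rewrite Re_mul_Ci; rewrite /upper in z0; lra.
exists l; apply: is_usum_ext Hl => m.
by rewrite Cmult_1_r mult_IZR e2pi_kernel.
Qed.

Lemma is_usum_residues (f : Z -> C) (q : nat) (l : nat -> C) : (0 < q)%N ->
  (forall r, (r < q)%N ->
    is_usum (fun k : Z => f (Z.of_nat r + Z.of_nat q * k)%Z) (l r)) ->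
  is_usum f (\csum_(r <- iota 0 q) l r).
Proof.
move=> q0 H.
(* Each class is extended by 0 to all integers, so that the q sums have one index set and can be
   added. *)
have H1 (r : nat) : is_usum (fun n => if (r < q)%N && (n mod Z.of_nat q =? Z.of_nat r)%Z
    then f n else RtoC 0) (if (r < q)%N then l r else RtoC 0).
  case: (ltnP r q) => rq /=; last exact: is_usum_0.
  apply: (@is_usum_inj _ _ (fun k : Z => (Z.of_nat r + Z.of_nat q * k)%Z)).
  - by move=> a b; nia.
  - move=> n hn; case: Z.eqb_spec => // E.
    by case: (hn (n / Z.of_nat q)%Z); have := Z.div_mod n (Z.of_nat q); lia.
  - apply: is_usum_ext (H r rq) => k.
    have -> // : ((Z.of_nat r + Z.of_nat q * k) mod Z.of_nat q =? Z.of_nat r)%Z = true.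
    apply/Z.eqb_eq.
    have -> : (Z.of_nat r + Z.of_nat q * k = Z.of_nat r + k * Z.of_nat q)%Z by lia.
    by rewrite Z.mod_add ?Z.mod_small; lia.
have := is_usum_finite (iota 0 q) H1.
have -> : \csum_(j <- iota 0 q) (if (j < q)%N then l j else RtoC 0) =
    \csum_(r <- iota 0 q) l r.
  by apply: eq_big_seq => r; rewrite mem_iota /= add0n => ->.
apply: is_usum_ext => n.
set r := Z.to_nat (n mod Z.of_nat q).
have b := Z.mod_pos_bound n (Z.of_nat q) ltac:(lia).
have rin : r \in iota 0 q by rewrite mem_iota; lia.
rewrite (bigD1_seq r rin (iota_uniq _ _)) /=.
have -> : (r < q)%N by lia.
have -> /= : (n mod Z.of_nat q =? Z.of_nat r)%Z = true by apply/Z.eqb_eq; lia.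
rewrite big1 ?Cplus_0_r // => i /eqP ir.
case: ifP => // /andP[_ /Z.eqb_eq E]; case: ir; lia.
Qed.

(* [z = A / q + Ci * tau A q z / (2 q ^ 2)]. *)
Definition tau (A : Z) (q : nat) (z : C) : C :=
  (- (2 * Ci * INR q * (INR q * z - IZR A)))%C.

Lemma Re_tau (A : Z) (q : nat) (z : C) :
  Re (tau A q z) = 2 * INR q ^ 2 * Im z.
Proof. by rewrite /tau; case: z => a b; rewrite /Re /Im /=; ring. Qed.

Lemma theta_gauss (A : Z) (q : nat) (z : C) : upper z -> (0 < q)%N ->
  is_usum (fun m : Z => theta_kernel (/ tau A q z) (IZR m) * gsum A m q)%C
    (Csqrt (tau A q z) * theta z)%C.
Proof.
move=> z0 q0; set t := tau A q z.
have Q0 : 0 < INR q by exact: INR_gt0.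
have QC : RtoC (INR q) <> RtoC 0 by move/RtoC_inj; lra.
have t0 : 0 < Re t.
  by rewrite Re_tau; rewrite /upper in z0; apply: Rmult_lt_0_compat => //; nra.
(* For n = r + q k the phase e(A n^2 / q) is [c r], and what remains of e(n^2 z) is the Gaussian of
   parameter [t] at k + r / q. Inverting the shifted sum [a r] yields e(m r / q), which together
   with [c r] builds the Gauss sum. *)
pose c (r : nat) := e2pi (RtoC (IZR (A * (Z.of_nat r * Z.of_nat r)) / INR q)).
pose a (r : nat) := (/ c r * usum (fun k : Z => e2pi (IZR ((Z.of_nat r + Z.of_nat q * k) *
   (Z.of_nat r + Z.of_nat q * k)) * z)))%C.
have c0 r : c r <> RtoC 0 by exact: e2pi_neq0.
have zE : z = (RtoC (IZR A / INR q) + Ci * t / (2 * INR q * INR q))%C.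
  have -> : (Ci * t / (2 * INR q * INR q) =
    - (Ci * Ci) * (INR q * z - IZR A) / INR q)%C.
    by rewrite /t /tau; field.
  by rewrite Ci2 RtoC_div; [field | lra].
have E r k : e2pi (IZR ((Z.of_nat r + Z.of_nat q * k) *
   (Z.of_nat r + Z.of_nat q * k)) * z)%C =
   (c r * theta_kernel t (IZR k + IZR (Z.of_nat r) / INR q))%C.
  set n := (Z.of_nat r + Z.of_nat q * k)%Z.
  have -> : c r = e2pi (IZR (n * n) * RtoC (IZR A / INR q))%C.
    have -> : (IZR (n * n) * RtoC (IZR A / INR q) =
      RtoC (IZR (A * (Z.of_nat r * Z.of_nat r)) / INR q) +
      IZR (A * (2 * Z.of_nat r * k + Z.of_nat q * (k * k))))%C.
      rewrite -RtoC_mult -RtoC_plus /n !(mult_IZR, plus_IZR) -!INR_IZR_INZ.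
      f_equal; field; lra.
    by rewrite e2pi_plus e2pi_Z Cmult_1_r.
  rewrite {1}zE Cmult_plus_distr_l e2pi_plus; f_equal.
  rewrite /e2pi /theta_kernel; f_equal.
  transitivity ((Ci * Ci) * PI * t * (RtoC (IZR n / INR q) * RtoC (IZR n / INR q)))%C.
    by rewrite mult_IZR RtoC_div ?RtoC_mult; [field | lra].
  rewrite Ci2.
  have -> : IZR k + IZR (Z.of_nat r) / INR q = IZR n / INR q.
    by rewrite /n !(mult_IZR, plus_IZR) -!INR_IZR_INZ; field; lra.
  by rewrite RtoC_mult; ring.
have ex r : exists l, is_usum (fun k : Z => e2pi (IZR ((Z.of_nat r + Z.of_nat q * k) *
   (Z.of_nat r + Z.of_nat q * k)) * z)%C) l.
  have [||l Hl] := @ex_usum Z (fun k : Z => e2pi (IZR ((Z.of_nat r + Z.of_nat q * k) *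
   (Z.of_nat r + Z.of_nat q * k)) * z)%C) (fun k : Z => Cmod (e2pi (IZR ((Z.of_nat r + Z.of_nat q * k) *
   (Z.of_nat r + Z.of_nat q * k)) * z)%C)).
  - by move=> k; exact: Rle_refl.
  - have [_ wh] := Csqrt_half (z := - (2 * Ci * z))%C ltac:(rewrite Re_mul_Ci; rewrite /upper in z0; lra).
    have [B [B0 HB]] := gauss_decay wh.
    apply: (rbounded_inj (p := fun k : Z => (Z.of_nat r + Z.of_nat q * k)%Z)
      (h := fun n => B * / (1 + (IZR n / 1) ^ 2))).
    + by move=> x y; nia.
    + move=> k; rewrite mult_IZR e2pi_kernel -Psi_sqrt Rdiv_1_r.
      by have [] := HB (IZR (Z.of_nat r + Z.of_nat q * k)).
    + by apply: rbounded_scal => //; apply: rbounded_cauchy; lra.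
  - by exists l.
have Ha r : is_usum (fun k : Z => theta_kernel t (IZR k + IZR (Z.of_nat r) / INR q)) (a r).
  apply: is_usum_ext (is_usum_scal (/ c r)%C (usum_correct (ex r))) => k.
  by rewrite E; field.
have thE : theta z = \csum_(r <- iota 0 q) (c r * a r)%C.
  apply: (is_usum_unique (theta_usum z0)).
  apply: (is_usum_residues q0) => r _.
  by apply: is_usum_ext (is_usum_scal (c r) (Ha r)) => k; rewrite E.
rewrite thE big_distrr /=.
have Hb r : is_usum (fun n : Z => theta_kernel (/ t) (IZR n) *
    e2pi (RtoC (IZR n * (IZR (Z.of_nat r) / INR q))))%C (Csqrt t * a r)%C.
  have [B HB] := @theta_kernel_usum (/ t)%C
    (fun n => e2pi (RtoC (IZR n * (IZR (Z.of_nat r) / INR q)))) (Re_inv_pos t0)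
    (fun n => Cmod_e2pi_R _).
  by rewrite -(theta_inversion t0 q0 (Ha r) HB).
have := is_usum_finite (iota 0 q) (fun r => is_usum_scal (c r) (Hb r)).
have -> : \csum_(j <- iota 0 q) (c j * (Csqrt t * a j)) =
  \csum_(i <- iota 0 q) (Csqrt t * (c i * a i)).
  by apply: eq_bigr => i _; ring.
apply: is_usum_ext => m; rewrite /gsum big_distrr /=.
apply: eq_bigr => r _.
have -> : RtoC (IZR (A * (Z.of_nat r * Z.of_nat r) + m * Z.of_nat r) / INR q) =
  (RtoC (IZR (A * (Z.of_nat r * Z.of_nat r)) / INR q) +
   RtoC (IZR m * (IZR (Z.of_nat r) / INR q)))%C.
  rewrite -RtoC_plus !(mult_IZR, plus_IZR) -!INR_IZR_INZ; f_equal; field; lra.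
rewrite e2pi_plus -/(c r); ring.
Qed.

(** The kernel at m <> 0 is at most 1 / Re (u k), hence tends to 0, and Re (u k) >= 1 makes exp(- PI
    m^2) a common majorant. *)
Lemma const_term_limit (c : Z -> C) (K : R) (u l : nat -> C) :
  (forall m, Cmod (c m) <= K) -> (forall k, INR k.+1 <= Re (u k)) ->
  (forall k, is_usum (fun m : Z => theta_kernel (u k) (IZR m) * c m)%C (l k)) ->
  is_lim_seq (fun k => Cmod (l k - c 0%Z)%C) 0.
Proof.
move=> cK uk H.
have K0 : 0 <= K by apply: Rle_trans (cK 0%Z); exact: Cmod_ge_0.
have kmod k m : Cmod (theta_kernel (u k) (IZR m)) =
    exp (- (PI * Re (u k) * IZR m ^ 2)).
  rewrite /theta_kernel Cmod_Cexp; f_equal.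
  by case: (u k) => a b; rewrite /Re /=; ring.
have one_half : Rabs (Im (RtoC 1)) < Re (RtoC 1).
  by rewrite /Im /Re /= Rabs_R0; lra.
have [B [B0 HB]] := gauss_decay one_half.
have PI1 : 1 <= PI by have := PI2_3_2; rewrite /PI2; lra.
pose f k (m : Z) := (if m \in [:: 0%Z] then RtoC 0 else
  theta_kernel (u k) (IZR m) * c m)%C.
have u1 k : 1 <= Re (u k).
  by apply: Rle_trans (uk k); rewrite -INR_1; apply: le_INR; lia.
apply: (@tannery _ f (fun m => B * K * / (1 + (IZR m / 1) ^ 2))).
- move=> k m; have p0 : 0 <= B * K * / (1 + (IZR m / 1) ^ 2).
    apply: Rmult_le_pos; first exact: Rmult_le_pos.
    by apply: Rlt_le; apply: Rinv_0_lt_compat; have := pow2_ge_0 (IZR m / 1); lra.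
  rewrite /f; case: ifP => _; first by rewrite Cmod_0.
  have -> : B * K * / (1 + (IZR m / 1) ^ 2) = B * / (1 + (IZR m / 1) ^ 2) * K by ring.
  apply: Cmod_mult_le => //; rewrite Rdiv_1_r.
  apply: Rle_trans (proj1 (HB (IZR m))); rewrite kmod /Psi Cmod_Cexp.
  apply: exp_le.
  have -> : Re (- PI * (1 * IZR m) * (1 * IZR m))%C = - (PI * 1 * IZR m ^ 2).
    by rewrite /Re /=; ring.
  apply: Ropp_le_contravar; apply: Rmult_le_compat_r; first exact: pow2_ge_0.
  by apply: Rmult_le_compat_l; [lra | exact: u1].
- by apply: rbounded_scal; [exact: Rmult_le_pos | apply: rbounded_cauchy; lra].
- move=> m; rewrite /f mem_seq1; case: eqP => [_|m0].
    by rewrite Cmod_0; exact: is_lim_seq_const.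
  apply: (is_lim_seq_squeeze (v := fun k => K / INR k.+1)).
  + by move=> k; exact: Cmod_ge_0.
  + exists 0%N => k _; have kp := lt_0_INR k.+1 (Nat.lt_0_succ k).
    have -> : K / INR k.+1 = / INR k.+1 * K by field; lra.
    apply: Cmod_mult_le => //; rewrite kmod exp_Ropp.
    apply: Rinv_le_contravar => //.
    have m1 : 1 <= IZR m ^ 2.
      rewrite -pow2_abs -abs_IZR.
      have : 1 <= IZR (Z.abs m) by apply: IZR_le; lia.
      by move=> ?; nra.
    have := exp_ineq1_le (PI * Re (u k) * IZR m ^ 2).
    have := uk k.
    have : 1 * Re (u k) * 1 <= PI * Re (u k) * IZR m ^ 2.
      by apply: Rmult_le_compat; try lra; [have := u1 k; lra |
        apply: Rmult_le_compat_r => //; have := u1 k; lra].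
    lra.
  + exact: is_lim_seq_div_S.
- move=> k.
  have := is_usum_plus (H k) (is_usum_scal (- RtoC 1)%C
    (@is_usum_fin _ [:: 0%Z] (fun m => theta_kernel (u k) (IZR m) * c m)%C isT)).
  rewrite big_seq1.
  have -> : (theta_kernel (u k) (IZR 0) * c 0%Z = c 0%Z)%C.
    by rewrite /theta_kernel -RtoC_mult Rmult_0_l Cmult_0_r Cexp_0; ring.
  have -> : (l k + - RtoC 1 * c 0%Z = l k - c 0%Z)%C by ring.
  by apply: is_usum_ext => m; rewrite /f; case: ifP => _; ring.
Qed.

Lemma gsum_mod (A m A' m' : Z) (q : nat) : (0 < q)%N ->
  (Z.of_nat q | A - A')%Z -> (Z.of_nat q | m - m')%Z ->
  gsum A m q = gsum A' m' q.
Proof.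
move=> q0 [a Ea] [b Eb]; apply: eq_bigr => r _.
have Q0 : 0 < INR q by exact: INR_gt0.
have -> : (A = A' + a * Z.of_nat q)%Z by lia.
have -> : (m = m' + b * Z.of_nat q)%Z by lia.
set n := Z.of_nat r.
have -> : RtoC (IZR ((A' + a * Z.of_nat q) * (n * n) +
    (m' + b * Z.of_nat q) * n) / INR q) =
  (RtoC (IZR (A' * (n * n) + m' * n) / INR q) + IZR (a * (n * n) + b * n))%C.
  rewrite -RtoC_plus !(mult_IZR, plus_IZR) -!INR_IZR_INZ; f_equal; field; lra.
by rewrite e2pi_plus e2pi_Z Cmult_1_r.
Qed.

Lemma csum_conj (I : Type) (r : seq I) (f : I -> C) :
  Cconj (\csum_(i <- r) f i) = \csum_(i <- r) Cconj (f i).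
Proof.
apply: (big_morph Cconj (id1 := RtoC 0) (op1 := Cplus)).
- by case=> a b [c d]; rewrite /Cconj /Cplus /=; f_equal; ring.
- by rewrite /Cconj /RtoC /=; f_equal; ring.
Qed.

Lemma gsum_conj (A m : Z) (q : nat) :
  gsum (- A) (- m) q = Cconj (gsum A m q).
Proof.
rewrite /gsum csum_conj; apply: eq_bigr => r _.
rewrite -e2pi_R_conj; f_equal; f_equal.
rewrite !(mult_IZR, plus_IZR, opp_IZR) /Rdiv; ring.
Qed.

Lemma gsum_1 (A m : Z) : gsum A m 1 = RtoC 1.
Proof. by rewrite /gsum /= big_seq1 !Z.mul_0_r /Rdiv Rmult_0_l e2pi_0. Qed.

Lemma Cmod_gsum (A m : Z) (q : nat) : Cmod (gsum A m q) <= INR q.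
Proof.
apply: Rle_trans (csum_mod _ _ _) _; rewrite (eq_bigr (fun _ => 1)); last first.
  by move=> r _; exact: Cmod_e2pi_R.
elim: q => [|q IH]; first by rewrite big_nil /=; lra.
by rewrite -(addn1 q) iotaD big_cat /= big_seq1 plus_INR INR_1; lra.
Qed.

Lemma Csqrt_scal (x : R) (z : C) : 0 < x ->
  Csqrt (RtoC x * z)%C = (RtoC (sqrt x) * Csqrt z)%C.
Proof.
move=> x0; have [E p] := Csqrt_spec z.
have s0 := sqrt_lt_R0 x x0.
apply: Csqrt_unique.
- rewrite -{3}E -{3}(sqrt_sqrt x) ?RtoC_mult; [ring | lra].
- move: p; case: (Csqrt z) => a b; rewrite /Re /Im /=; case=> [a0|[a0 b0]].
  + by left; nra.
  + by right; rewrite a0; split; nra.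
Qed.

Lemma upper_neg_inv (z : C) : upper z -> upper (- (/ z))%C.
Proof.
rewrite /upper; case: z => a b; rewrite /Im /= => b0.
have d0 : 0 < a * (a * 1) + b * (b * 1) by nra.
have -> : - (- b / (a * (a * 1) + b * (b * 1))) = b / (a * (a * 1) + b * (b * 1)).
  by field; lra.
exact: Rdiv_lt_0_compat.
Qed.

Lemma upper_scal (x : R) (z : C) : 0 < x -> upper z -> upper (x * z)%C.
Proof. by rewrite /upper; case: z => a b; rewrite /Im /=; nra. Qed.

(** The case A = 0, q = 1 of [theta_gauss]. The 4 comes from the normalization e(n^2 z), which is of
    period one in z. *)
Lemma theta_inv_4 (z : C) : upper z ->
  theta (- (/ (4 * z)))%C = (Csqrt (- (2 * Ci * z)) * theta z)%C.
Proof.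
move=> z0.
have zC : z <> RtoC 0 by move=> E; move: z0; rewrite /upper E /=; lra.
have z0' : upper (- (/ (4 * z)))%C.
  by apply: upper_neg_inv; apply: upper_scal => //; lra.
have H := theta_gauss 0 z0 (ltn0Sn 0).
have E1 : tau 0 1 z = (- (2 * Ci * z))%C by rewrite /tau /=; ring.
rewrite E1 in H.
apply: (is_usum_unique (theta_usum z0')).
apply: is_usum_ext H => m; rewrite gsum_1 Cmult_1_r mult_IZR e2pi_kernel.
f_equal; have iC := Ci_neq0.
transitivity (- (Ci * Ci) * / (- (2 * Ci * z)))%C; last by field.
by rewrite Ci2; ring.
Qed.

(* Compare the behaviour of [theta z] as [z] tends vertically to [k / n], expanded
   directly and after the inversion [z |-> - 1 / (4 z)]. *)
Lemma landsberg_schaar (k n : nat) : (0 < k)%N -> (0 < n)%N ->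
  (sqrt (INR n) * gsum (- Z.of_nat n) 0 (4 * k))%C =
  (Csqrt (- (8 * Ci * INR k)) * gsum (Z.of_nat k) 0 n)%C.
Proof.
move=> k0 n0.
have K0 : 0 < INR k by exact: INR_gt0.
have N0 : 0 < INR n by exact: INR_gt0.
have NC : RtoC (INR n) <> RtoC 0 by move/RtoC_inj; lra.
(* Chosen so that 1 / tau equals 4 (i + 1) at [z i] and has real part i + 1 at the inverted point,
   as [const_term_limit] requires. *)
pose d (i : nat) := / (8 * INR n ^ 2 * INR i.+1).
have I0 i : 0 < INR i.+1 by apply: lt_0_INR; lia.
have d0 i : 0 < d i.
  by apply: Rinv_0_lt_compat; apply: Rmult_lt_0_compat => //; nra.
pose z i : C := (INR k / INR n, d i).
have zu i : upper (z i) by exact: d0.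
have zE i : z i = (INR k / INR n + Ci * d i)%C.
  by rewrite /z /Ci /RtoC /Cmult /Cplus /Cdiv /Cinv /=; f_equal; field; nra.
have zC i : z i <> RtoC 0 by case=> _ /=; have := d0 i; lra.
pose z' i := (- (/ (4 * z i)))%C.
have z'u i : upper (z' i).
  by apply: upper_neg_inv; apply: upper_scal => //; lra.
have H1 i := theta_gauss (Z.of_nat k) (zu i) n0.
have H3 i := theta_gauss (- Z.of_nat n) (z'u i) (ltac:(lia) : (0 < 4 * k)%N).
have t1 i : tau (Z.of_nat k) n (z i) = RtoC (2 * INR n ^ 2 * d i).
  rewrite /tau zE -INR_IZR_INZ.
  transitivity (- (Ci * Ci) * 2 * INR n * INR n * d i)%C; first by field.
  by rewrite Ci2 /= !RtoC_mult; ring.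
have t3 i : tau (- Z.of_nat n) (4 * k) (z' i) =
    (RtoC (8 * INR k * INR n * d i) / z i)%C.
  rewrite /tau opp_IZR -INR_IZR_INZ mult_INR RtoC_opp RtoC_mult /z'.
  have -> : RtoC (INR 4) = RtoC 4 by f_equal; rewrite /=; ring.
  transitivity (- (8 * Ci * INR k * (INR n * z i - INR k) / z i))%C.
    by field.
  rewrite {1}zE.
  transitivity (- (Ci * Ci) * 8 * INR k * INR n * d i / z i)%C; first by field.
  by rewrite Ci2 !RtoC_mult; field.
have L1 := @const_term_limit (fun m => gsum (Z.of_nat k) m n) (INR n)
   _ _ (fun m => Cmod_gsum _ m n) _ H1.
have {}L1 := L1 _; have L3 := @const_term_limit (fun m => gsum (- Z.of_nat n) m (4 * k))
   (INR (4 * k)) _ _ (fun m => Cmod_gsum _ m _) _ H3.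
have R1 i : INR i.+1 <= Re (/ tau (Z.of_nat k) n (z i))%C.
  rewrite t1 -RtoC_inv; last first.
    by apply: Rgt_not_eq; apply: Rmult_lt_0_compat => //; nra.
  move: (I0 i); rewrite /d; set s := INR i.+1 => s0.
  rewrite /Re /=.
  have -> : / (2 * (INR n * (INR n * 1)) * / (8 * (INR n * (INR n * 1)) * s)) =
    4 * s by field; lra.
  lra.
have R3 i : INR i.+1 <= Re (/ tau (- Z.of_nat n) (4 * k) (z' i))%C.
  rewrite t3.
  have p0 : 0 < 8 * INR k * INR n * d i.
    by have := d0 i => ?; do !apply: Rmult_lt_0_compat => //; lra.
  have -> : (/ (RtoC (8 * INR k * INR n * d i) / z i) =
    RtoC (/ (8 * INR k * INR n * d i)) * z i)%C.
    by rewrite RtoC_inv; [field; split => //; move/RtoC_inj; lra | lra].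
  move: (I0 i); rewrite /z /d; set s := INR i.+1 => s0.
  by rewrite /Re /=; right; field; lra.
(* The prefactors agree for every [i], not only in the limit: under the roots, both products are -
   16 i k n^2 d. Roots may be merged because the complex factors lie in the right half-plane or are
   scaled by positive reals. *)
have E i : (sqrt (INR n) * (Csqrt (tau (- Z.of_nat n) (4 * k) (z' i)) * theta (z' i)) =
   Csqrt (- (8 * Ci * INR k)) * (Csqrt (tau (Z.of_nat k) n (z i)) * theta (z i)))%C.
  rewrite /z' theta_inv_4 // -/(z' i) Cmult_assoc Cmult_assoc Cmult_assoc; f_equal.
  have p1 : 0 < Re (tau (- Z.of_nat n) (4 * k) (z' i)).
    rewrite Re_tau; have := z'u i; rewrite /upper => ?.
    have : 0 < INR (4 * k) by apply: lt_0_INR; lia.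
    by move=> ?; apply: Rmult_lt_0_compat => //; nra.
  have p2 : 0 < Re (- (2 * Ci * z i))%C.
    by rewrite Re_mul_Ci; have := zu i; rewrite /upper; lra.
  rewrite -Cmult_assoc -Csqrt_mult // -Csqrt_scal //.
  have p3 : 0 < 2 * INR n ^ 2 * d i by apply: Rmult_lt_0_compat => //; nra.
  rewrite t1 (Csqrt_R (Rlt_le _ _ p3)) [RHS]Cmult_comm -Csqrt_scal // t3; f_equal.
  by rewrite /= !RtoC_mult; field.
have Z0 : is_lim_seq (fun _ : nat =>
    Cmod (sqrt (INR n) * gsum (- Z.of_nat n) 0 (4 * k) -
    Csqrt (- (8 * Ci * INR k)) * gsum (Z.of_nat k) 0 n)%C) 0.
  apply: (is_lim_seq_squeeze (v := fun i =>
    sqrt (INR n) * Cmod (Csqrt (tau (- Z.of_nat n) (4 * k) (z' i)) * theta (z' i) -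
      gsum (- Z.of_nat n) 0 (4 * k))%C +
    Cmod (Csqrt (- (8 * Ci * INR k))) *
    Cmod (Csqrt (tau (Z.of_nat k) n (z i)) * theta (z i) -
      gsum (Z.of_nat k) 0 n)%C)).
  - by move=> i; exact: Cmod_ge_0.
  - exists 0%N => i _.
    set a := gsum _ _ _; set b := gsum _ _ _; have := E i.
    set x := (Csqrt _ * theta _)%C; set y := (Csqrt _ * theta _)%C => Ei.
    have -> : (sqrt (INR n) * a - Csqrt (- (8 * Ci * INR k)) * b =
      Csqrt (- (8 * Ci * INR k)) * (y - b) - sqrt (INR n) * (x - a))%C.
      transitivity (sqrt (INR n) * a - Csqrt (- (8 * Ci * INR k)) * b +
        (Csqrt (- (8 * Ci * INR k)) * y - sqrt (INR n) * x))%C; last by ring.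
      by rewrite Ei; ring.
    rewrite Rplus_comm; apply: Cmod_minus_le.
      by rewrite Cmod_mult; exact: Rle_refl.
    rewrite Cmod_mult Cmod_R Rabs_pos_eq; [exact: Rle_refl | exact: sqrt_pos].
  - have -> : Rbar.Finite 0 = Rbar.Finite (sqrt (INR n) * 0 +
      Cmod (Csqrt (- (8 * Ci * INR k))) * 0) by f_equal; ring.
    apply: is_lim_seq_plus'.
      by apply: is_lim_seq_mult'; [exact: is_lim_seq_const | exact: L3].
    by apply: is_lim_seq_mult'; [exact: is_lim_seq_const | exact: L1].
have := is_lim_seq_unique _ _ Z0; rewrite Lim_seq_const => - [Em].
have E2 := Cmod_eq_0 _ Em.
set a := (sqrt _ * _)%C in E2 *; set b := (Csqrt _ * _)%C in E2 *.
have -> : a = (a - b + b)%C by ring.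
by rewrite E2; ring.
Qed.

Lemma Csqrt_8k (k : nat) : (0 < k)%N ->
  Csqrt (- (8 * Ci * INR k))%C = (sqrt (4 * INR k) * (1 - Ci))%C.
Proof.
move=> k0; have K0 : 0 < INR k by exact: INR_gt0.
have s0 : 0 < sqrt (4 * INR k) by apply: sqrt_lt_R0; lra.
apply: Csqrt_unique; last by left; rewrite /Re /=; nra.
transitivity (sqrt (4 * INR k) * sqrt (4 * INR k) * (1 - 2 * Ci + Ci * Ci))%C.
  by ring.
have -> : (sqrt (4 * INR k) * sqrt (4 * INR k) = 4 * INR k)%C.
  by rewrite -!RtoC_mult sqrt_sqrt //; lra.
by rewrite Ci2; ring.
Qed.

(** The left side of [landsberg_schaar] sees [n] only modulo 4 k, apart from the square root. The
    case n = 1 evaluates it for the class of 1; the class of -1 is its complex conjugate, and (1 +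
    i) / (1 - i) = i. *)
Lemma gsum_pm1 (k n : nat) : (0 < k)%N -> (0 < n)%N ->
  ((Z.of_nat (4 * k) | Z.of_nat n - 1)%Z ->
     gsum (Z.of_nat k) 0 n = RtoC (sqrt (INR n))) /\
  ((Z.of_nat (4 * k) | Z.of_nat n + 1)%Z ->
     gsum (Z.of_nat k) 0 n = (Ci * sqrt (INR n))%C).
Proof.
move=> k0 n0; have L := landsberg_schaar k0 n0.
have k40 : (0 < 4 * k)%N by lia.
have s0 : 0 < sqrt (4 * INR k).
  by apply: sqrt_lt_R0; have : 0 < INR k by [apply: lt_0_INR; lia]; lra.
have sC : (sqrt (4 * INR k) * (1 - Ci))%C <> RtoC 0.
  apply: Cmult_neq_0; first by move/RtoC_inj; lra.
  by move=> [] /=; lra.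
have G1 : gsum (-1) 0 (4 * k) = (sqrt (4 * INR k) * (1 - Ci))%C.
  have := landsberg_schaar k0 (ltn0Sn 0).
  by rewrite gsum_1 sqrt_1 Cmult_1_l Cmult_1_r Csqrt_8k.
have can (a b c : C) : c <> RtoC 0 -> (b * c = c * a)%C -> a = b.
  move=> c0 E; have -> : a = (/ c * (c * a))%C by field.
  by rewrite -E; field.
rewrite Csqrt_8k // in L; split=> D.
- apply: can sC _; rewrite -L; f_equal.
  rewrite -G1; apply: gsum_mod => //; last by exists 0%Z; lia.
  by case: D => q E; exists q; lia.
- apply: can sC _; rewrite -L.
  have -> : gsum (- Z.of_nat n) 0 (4 * k) = gsum (- (-1)) (- 0) (4 * k).
    apply: gsum_mod => //; last by exists 0%Z; lia.
    by case: D => q E; exists (- q)%Z; lia.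
  rewrite gsum_conj G1.
  have -> : Cconj (sqrt (4 * INR k) * (1 - Ci))%C = (sqrt (4 * INR k) * (1 + Ci))%C.
    by rewrite /Cconj /Ci /Cmult /RtoC /Cplus /Copp /=; f_equal; ring.
  transitivity (sqrt (INR n) * sqrt (4 * INR k) * (Ci - Ci * Ci))%C.
    by ring.
  by rewrite Ci2; ring.
Qed.

(** * Arithmetic of quadratic Gauss sums *)

Definition ez (q : nat) (x : Z) : C := e2pi (RtoC (IZR x / INR q)).

Lemma gsumE (A : Z) (q : nat) :
  gsum A 0 q = \csum_(r <- iota 0 q) ez q (A * (Z.of_nat r * Z.of_nat r)).
Proof. by apply: eq_bigr => r _; rewrite /ez; do 4!f_equal; lia. Qed.

Lemma ez_plus (q : nat) (x y : Z) : ez q (x + y) = (ez q x * ez q y)%C.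
Proof. by rewrite /ez -e2pi_plus -RtoC_plus plus_IZR /Rdiv; do 2!f_equal; ring. Qed.

Lemma ez_scal (m q : nat) (x : Z) : (0 < m)%N -> (0 < q)%N ->
  ez (m * q) (Z.of_nat m * x) = ez q x.
Proof.
move=> m0 q0; have M0 : 0 < INR m by exact: INR_gt0.
have Q0 : 0 < INR q by exact: INR_gt0.
rewrite /ez mult_INR mult_IZR -INR_IZR_INZ; do 2!f_equal; field; lra.
Qed.

Lemma ez_mult (q : nat) (x : Z) : (0 < q)%N -> (Z.of_nat q | x)%Z -> ez q x = RtoC 1.
Proof.
move=> q0 [k ->]; have Q0 : 0 < INR q by exact: INR_gt0.
rewrite /ez mult_IZR -INR_IZR_INZ.
have -> : IZR k * INR q / INR q = IZR k by field; lra.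
exact: e2pi_Z.
Qed.

Lemma ez_mod (q : nat) (x y : Z) : (0 < q)%N -> (Z.of_nat q | x - y)%Z ->
  ez q x = ez q y.
Proof.
move=> q0 d; have -> : x = (y + (x - y))%Z by lia.
by rewrite ez_plus [ez q (x - y)]ez_mult // Cmult_1_r.
Qed.

Lemma csum_ez (q : nat) (k : Z) : (0 < q)%N ->
  \csum_(i <- iota 0 q) ez q (k * Z.of_nat i) =
  if (k mod Z.of_nat q =? 0)%Z then RtoC (INR q) else RtoC 0.
Proof.
move=> q0; rewrite -csum_e2pi //; apply: eq_bigr => i _; rewrite /ez.
by rewrite mult_IZR -INR_IZR_INZ /Rdiv; do 2!f_equal; ring.
Qed.

(** By counting, q pairwise incongruent integers meet every class. All changes of variable in Gauss
    sums go through this lemma. *)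
Lemma csum_residue_system (q : nat) (s : seq Z) (f : Z -> C) : (0 < q)%N ->
  (forall x y, (Z.of_nat q | x - y)%Z -> f x = f y) -> size s = q ->
  uniq [seq (x mod Z.of_nat q)%Z | x <- s] ->
  \csum_(x <- s) f x = \csum_(r <- iota 0 q) f (Z.of_nat r).
Proof.
move=> q0 fq ss us.
have -> : \csum_(x <- s) f x = \csum_(x <- [seq (x mod Z.of_nat q)%Z | x <- s]) f x.
  rewrite big_map; apply: eq_bigr => x _; apply: fq.
  exists (x / Z.of_nat q)%Z; have := Z.div_mod x (Z.of_nat q); lia.
have -> : \csum_(r <- iota 0 q) f (Z.of_nat r) =
    \csum_(x <- map Z.of_nat (iota 0 q)) f x by rewrite big_map.
apply: perm_big; apply: uniq_perm => //.
  by rewrite map_inj_uniq ?iota_uniq // => a b; lia.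
have [//||_ E] := @uniq_min_size _ [seq (x mod Z.of_nat q)%Z | x <- s]
    (map Z.of_nat (iota 0 q)) us; last by [].
  move=> y /mapP[x _ ->]; apply/mapP.
  have b := Z.mod_pos_bound x (Z.of_nat q) ltac:(lia).
  by exists (Z.to_nat (x mod Z.of_nat q)); rewrite ?mem_iota; lia.
by rewrite !size_map size_iota ss.
Qed.

Lemma uniq_modP (I : eqType) (q : nat) (s : seq I) (h : I -> Z) : (0 < q)%N ->
  uniq s ->
  (forall a b, a \in s -> b \in s -> (Z.of_nat q | h a - h b)%Z -> a = b) ->
  uniq [seq (x mod Z.of_nat q)%Z | x <- map h s].
Proof.
move=> q0 us H; rewrite -map_comp map_inj_in_uniq // => a b ha hb /= E.
apply: H => //; exists (h a / Z.of_nat q - h b / Z.of_nat q)%Z.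
have := Z.div_mod (h a) (Z.of_nat q); have := Z.div_mod (h b) (Z.of_nat q); lia.
Qed.

Lemma csum_split (m n : nat) (f : nat -> C) :
  \csum_(i <- iota 0 (m * n)) f i =
  \csum_(b <- iota 0 n) \csum_(a <- iota 0 m) f (a + m * b)%N.
Proof.
elim: n => [|n IH]; first by rewrite muln0 !big_nil.
rewrite -(addn1 n) mulnDr muln1 !iotaD !big_cat IH /= big_seq1 !add0n.
by f_equal; rewrite -[X in iota X _]addn0 iotaDl big_map; apply: eq_bigr => a _;
  rewrite addnC.
Qed.

Lemma divide_small (q x : Z) : (q | x)%Z -> (Z.abs x < q)%Z -> x = 0%Z.
Proof. by move=> [k ->] h; have -> : k = 0%Z by nia. Qed.

Lemma gsum_unit (A c : Z) (q : nat) : (0 < q)%N -> Z.gcd c (Z.of_nat q) = 1%Z ->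
  gsum (A * (c * c)) 0 q = gsum A 0 q.
Proof.
move=> q0 cq; rewrite !gsumE.
pose f x := ez q (A * (x * x)).
have fq x y : (Z.of_nat q | x - y)%Z -> f x = f y.
  by move=> [k E]; apply: ez_mod => //; exists (A * k * (x + y))%Z; nia.
rewrite -(csum_residue_system (s := map (fun r => (c * Z.of_nat r)%Z) (iota 0 q))
  q0 fq).
- by rewrite big_map; apply: eq_bigr => r _; rewrite /f; f_equal; ring.
- by rewrite size_map size_iota.
- apply: uniq_modP => //; first exact: iota_uniq.
  move=> a b; rewrite !mem_iota => ha hb d.
  have {}d : (Z.of_nat q | c * (Z.of_nat a - Z.of_nat b))%Z.
    by have -> : (c * (Z.of_nat a - Z.of_nat b) =
      c * Z.of_nat a - c * Z.of_nat b)%Z by ring.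
  have := divide_small (Z.gauss _ _ _ d ltac:(by rewrite Z.gcd_comm)); lia.
Qed.

(** The integers n a + m b represent the classes modulo m n, and the cross term of their square is a
    multiple of m n. *)
Lemma gsum_crt (A : Z) (m n : nat) : (0 < m)%N -> (0 < n)%N ->
  Z.gcd (Z.of_nat m) (Z.of_nat n) = 1%Z ->
  gsum A 0 (m * n) = (gsum (A * Z.of_nat m) 0 n * gsum (A * Z.of_nat n) 0 m)%C.
Proof.
move=> m0 n0 mn; have mn0 : (0 < m * n)%N by rewrite muln_gt0 m0.
rewrite !gsumE.
pose f x := ez (m * n) (A * (x * x)).
have fq x y : (Z.of_nat (m * n) | x - y)%Z -> f x = f y.
  by move=> [k E]; apply: ez_mod => //; exists (A * k * (x + y))%Z; nia.
pose h (x : nat * nat) := (Z.of_nat n * Z.of_nat x.1 + Z.of_nat m * Z.of_nat x.2)%Z.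
rewrite -(csum_residue_system (s := map h [seq (a, b) | a <- iota 0 m, b <- iota 0 n])
  mn0 fq).
- rewrite big_map big_allpairs /=.
  rewrite big_distrr /=; apply: eq_bigr => a _.
  rewrite big_distrl /=; apply: eq_bigr => b _.
  rewrite /f /h /=.
  set x := Z.of_nat a; set y := Z.of_nat b.
  have -> : (A * ((Z.of_nat n * x + Z.of_nat m * y) * (Z.of_nat n * x + Z.of_nat m * y)) =
    Z.of_nat m * (A * Z.of_nat m * (y * y)) + Z.of_nat n * (A * Z.of_nat n * (x * x))
    + Z.of_nat (m * n) * (2 * A * x * y))%Z by rewrite Nat2Z.inj_mul; ring.
  rewrite !ez_plus ez_scal // [ez (m * n) (Z.of_nat (m * n) * _)]ez_mult //; last first.
    exact: Z.divide_factor_l.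
  by rewrite mulnC ez_scal // Cmult_1_r.
- by rewrite size_map size_allpairs !size_iota.
- apply: uniq_modP => //.
    by apply: allpairs_uniq; rewrite ?iota_uniq // => -[? ?] [? ?].
  move=> [a0 b0] [a1 b1] /allpairsP[[a b] /= [+ + [-> ->]]]
    /allpairsP[[a' b'] /= [+ + [-> ->]]].
  rewrite !mem_iota /h /= => ha hb ha' hb' [k].
  rewrite Nat2Z.inj_mul => E.
  have E1 : (Z.of_nat m | Z.of_nat n * (Z.of_nat a - Z.of_nat a'))%Z.
    exists (k * Z.of_nat n - (Z.of_nat b - Z.of_nat b'))%Z.
    by move: E; clear; nia.
  have E2 : (Z.of_nat n | Z.of_nat m * (Z.of_nat b - Z.of_nat b'))%Z.
    exists (k * Z.of_nat m - (Z.of_nat a - Z.of_nat a'))%Z.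
    by move: E; clear; nia.
  have := divide_small (Z.gauss _ _ _ E1 mn).
  have := divide_small (Z.gauss _ _ _ E2 ltac:(by rewrite Z.gcd_comm)).
  by move=> ? ?; f_equal; lia.
Qed.

(** Write the variable as a + p (u + m t). The sum over [t] is a complete character sum modulo [p]
    with frequency 2 A (a + p u), which vanishes unless a = 0. *)
Lemma gsum_sq (A : Z) (p m : nat) : (0 < p)%N -> (0 < m)%N ->
  Z.gcd (A * 2) (Z.of_nat p) = 1%Z ->
  gsum A 0 (p * (m * p)) = (INR p * gsum A 0 m)%C.
Proof.
move=> p0 m0 Ap; rewrite !gsumE csum_split csum_split exchange_big /= big_distrr /=.
apply: eq_bigr => u _; rewrite exchange_big /=.
have E a t : ez (p * (m * p)) (A * (Z.of_nat (a + p * (u + m * t)) *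
      Z.of_nat (a + p * (u + m * t)))) =
  (ez (p * (m * p)) (A * (Z.of_nat (a + p * u) * Z.of_nat (a + p * u))) *
   ez p (A * 2 * Z.of_nat (a + p * u) * Z.of_nat t))%C.
  rewrite -(@ez_scal (p * m) p) ?muln_gt0 ?p0 ?m0 // mulnA -ez_plus.
  apply: ez_mod; first by rewrite !muln_gt0 p0 m0.
  exists (A * Z.of_nat m * (Z.of_nat t * Z.of_nat t))%Z.
  rewrite !(Nat2Z.inj_add, Nat2Z.inj_mul); ring.
have -> : \csum_(a <- iota 0 p) \csum_(t <- iota 0 p)
   ez (p * (m * p)) (A * (Z.of_nat (a + p * (u + m * t)) *
      Z.of_nat (a + p * (u + m * t)))) =
  \csum_(a <- iota 0 p) (ez (p * (m * p)) (A * (Z.of_nat (a + p * u) * Z.of_nat (a + p * u))) *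
    (if (a == 0)%N then RtoC (INR p) else RtoC 0)).
  apply: eq_big_seq => a; rewrite mem_iota => ha.
  rewrite (eq_bigr _ (fun t _ => E a t)) -big_distrr /= csum_ez //.
  f_equal; case: Z.eqb_spec => h; case: eqP => a0 //.
  + have [k F] : (Z.of_nat p | A * 2 * Z.of_nat (a + p * u))%Z.
      by apply/Z.mod_divide => //; lia.
    have [k' F'] := Z.gauss _ _ _ (ex_intro _ k F : (Z.of_nat p | _)%Z)
      ltac:(by rewrite Z.gcd_comm).
    have pa : (Z.of_nat p | Z.of_nat a)%Z by exists (k' - Z.of_nat u)%Z; lia.
    by have := divide_small pa; lia.
  + case: h; apply/Z.mod_divide; first by lia.
    rewrite a0 add0n Nat2Z.inj_mul; exists (A * 2 * Z.of_nat u)%Z. ring.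
rewrite (bigD1_seq 0%N) ?iota_uniq //=; last by rewrite mem_iota; lia.
rewrite big1 => [|i /negbTE ->]; last by ring.
rewrite Cplus_0_r Cmult_comm; f_equal.
have -> : (p * (m * p) = (p * p) * m)%N by lia.
rewrite -(@ez_scal (p * p) m) ?muln_gt0 ?p0 //; f_equal.
by rewrite !(Nat2Z.inj_add, Nat2Z.inj_mul); ring.
Qed.

Lemma prime_gcd (p x : Z) : Znumtheory.prime p -> ~ (p | x)%Z -> Z.gcd x p = 1%Z.
Proof.
move=> pp px; apply/Zgcd_1_rel_prime; apply: rel_prime_sym.
exact: prime_rel_prime.
Qed.

(** If b is congruent to x^2, multiplication of the variable by [x] is a bijection. Otherwise both
    sums are folded by pairing r with -r, and the vanishing complete sum over squares and
    non-squares shows that they are opposite. *)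
Lemma gsum_prime (A b : Z) (p : nat) : Znumtheory.prime (Z.of_nat p) -> Z.odd (Z.of_nat p) ->
  ~ (Z.of_nat p | A)%Z -> ~ (Z.of_nat p | b)%Z ->
  gsum (b * A) 0 p = (IZR (legendre b (Z.of_nat p)) * gsum A 0 p)%C.
Proof.
move=> pp podd pA pb.
have p1 : (1 < Z.of_nat p)%Z by case: pp.
have p0 : (0 < p)%N by lia.
have [L1 L2] := legendre_spec _ _ pp pb.
case: (Classical_Prop.classic (exists x, (Z.of_nat p | x * x - b)%Z)) => R.
- rewrite L1 // Cmult_1_l; case: R => x hx.
  rewrite -(@gsum_unit A x) //.
    apply: gsum_mod => //; last by exists 0%Z; lia.
    by case: hx => k E; exists (- k * A)%Z; nia.
  apply: prime_gcd => // px; apply: pb.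
  have -> : b = (x * x - (x * x - b))%Z by lia.
  by apply: Z.divide_sub_r => //; exact: Z.divide_mul_l.
- rewrite L2 //.
  have [h ph] : exists h : nat, p = (2 * h + 1)%N.
    have [k Ek] : exists k, Z.of_nat p = (2 * k + 1)%Z.
      by apply/Z.odd_spec.
    by exists (Z.to_nat k); lia.
  pose f x := ez p (A * x).
  have fq x y : (Z.of_nat p | x - y)%Z -> f x = f y.
    by move=> [k E]; apply: ez_mod => //; exists (A * k)%Z; nia.
  pose r1 := [seq Z.of_nat r | r <- iota 1 h].
  have inr x : x \in r1 -> (0 < x <= Z.of_nat h)%Z.
    by move/mapP=> [r + ->]; rewrite mem_iota; lia.
  have ur1 : uniq r1 by rewrite map_inj_uniq ?iota_uniq // => x y; lia.
  have sr1 : size r1 = h by rewrite size_map size_iota.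
  clearbody r1.
  have half c : ~ (Z.of_nat p | c)%Z ->
    gsum (c * A) 0 p = (1 + 2 * \csum_(x <- r1) f (c * (x * x))%Z)%C.
    move=> pc; rewrite gsumE.
    pose g x := f (c * (x * x))%Z.
    have gq x y : (Z.of_nat p | x - y)%Z -> g x = g y.
      by move=> [k E]; apply: fq; exists (c * k * (x + y))%Z; nia.
    have -> : \csum_(r <- iota 0 p) ez p (c * A * (Z.of_nat r * Z.of_nat r)) =
        \csum_(r <- iota 0 p) g (Z.of_nat r).
      by apply: eq_bigr => r _; rewrite /g /f; f_equal; ring.
    rewrite -(csum_residue_system (s := map id (0%Z :: r1 ++ map Z.opp r1)) p0 gq).
    + rewrite big_map big_cons big_cat /= big_map.
      have -> : g 0%Z = RtoC 1.
        by rewrite /g /f; apply: ez_mult => //; exists 0%Z; lia.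
      have -> : \csum_(x <- r1) g (- x)%Z = \csum_(x <- r1) g x.
        by apply: eq_bigr => x _; rewrite /g; f_equal; ring.
      by rewrite /g; ring.
    + by rewrite size_map /= size_cat !size_map sr1; lia.
    + apply: uniq_modP => //.
        rewrite /= cat_uniq ur1 map_inj_uniq ?ur1; last by move=> x y; lia.
        rewrite andbT mem_cat; apply/andP; split.
          apply/negP => /orP[/inr|/mapP[x /inr]]; lia.
        apply/hasPn => x /mapP[y /inr hy ->]; apply/negP => /inr; lia.
      have bd x : x \in 0%Z :: r1 ++ map Z.opp r1 -> (Z.abs x <= Z.of_nat h)%Z.
        rewrite in_cons mem_cat => /or3P[/eqP ->|/inr|/mapP[y /inr hy ->]]; lia.
      move=> x y /bd hx /bd hy /divide_small; lia.
  have p_b := half b pb.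
  have p_1 : ~ (Z.of_nat p | 1)%Z by move/Z.divide_1_r_nonneg; lia.
  have E1 : gsum A 0 p = (1 + 2 * \csum_(x <- r1) f (x * x)%Z)%C.
    rewrite -{1}(Z.mul_1_l A) (half 1%Z p_1); do 2!f_equal.
    by apply: eq_bigr => x _; rewrite Z.mul_1_l.
  rewrite p_b E1.
  have S0 : (1 + \csum_(x <- r1) f (b * (x * x))%Z +
      \csum_(x <- r1) f (x * x)%Z = 0)%C.
    (* [0], [x ^ 2] and [b x ^ 2], for [1 <= x <= h], represent all residues. *)
    have := csum_ez A p0.
    case: Z.eqb_spec => [E|_].
      by case: pA; apply/Z.mod_divide => //; lia.
    rewrite -/(\csum_(i <- iota 0 p) f (Z.of_nat i)) => Ez; rewrite -[RHS]Ez.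
    rewrite -(csum_residue_system (s := map (fun x : bool * Z =>
      if x.1 then (b * (x.2 * x.2))%Z else (x.2 * x.2)%Z)
      ((false, 0%Z) :: map (pair true) r1 ++ map (pair false) r1)) p0 fq).
    + rewrite big_map big_cons big_cat !big_map /=.
      have -> : f (0 * 0)%Z = RtoC 1 by apply: ez_mult => //; exists 0%Z; lia.
      ring.
    + by rewrite size_map /= size_cat !size_map sr1; lia.
    + have nz x : (0 < x <= Z.of_nat h)%Z -> ~ (Z.of_nat p | x)%Z.
        by move=> hx /divide_small; lia.
      have sq0 x : (0 < x <= Z.of_nat h)%Z -> ~ (Z.of_nat p | x * x)%Z.
        by move=> hx /(prime_mult _ pp)[] /nz; apply.
      have bsq0 x : (0 < x <= Z.of_nat h)%Z -> ~ (Z.of_nat p | b * (x * x))%Z.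
        by move=> hx /(prime_mult _ pp)[// | /sq0]; apply.
      have sqinj x y : (0 < x <= Z.of_nat h)%Z -> (0 < y <= Z.of_nat h)%Z ->
          (Z.of_nat p | x * x - y * y)%Z -> x = y.
        move=> hx hy; have -> : (x * x - y * y = (x - y) * (x + y))%Z by ring.
        by move/(prime_mult _ pp) => [] /divide_small; lia.
      have cross x y : (0 < x <= Z.of_nat h)%Z -> (0 < y <= Z.of_nat h)%Z ->
          ~ (Z.of_nat p | b * (x * x) - y * y)%Z.
        move=> hx hy D; apply: R.
        have xp : rel_prime x (Z.of_nat p).
          by apply: rel_prime_sym; apply: prime_rel_prime => //; exact: nz.
        have [u v E] := rel_prime_bezout _ _ xp.
        exists (y * u)%Z.
        have -> : (y * u * (y * u) - b = - (u * u) * (b * (x * x) - y * y) +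
          b * ((u * x) * (u * x) - 1))%Z by ring.
        apply: Z.divide_add_r; first exact: Z.divide_mul_r.
        apply: Z.divide_mul_r.
        have -> : (u * x * (u * x) - 1 = (u * x + 1) * (u * x - 1))%Z by ring.
        by apply: Z.divide_mul_r; exists (- v)%Z; lia.
      apply: uniq_modP => //.
        rewrite /= cat_uniq !map_inj_uniq ?ur1; try by move=> ? ? [].
        rewrite andbT mem_cat; apply/andP; split.
          apply/negP => /orP[/mapP[x _ []]//|/mapP[x /inr hx [E]]]; lia.
        by apply/hasPn => x /mapP[y _ ->]; apply/negP => /mapP[].
      have ins z : z \in (false, 0%Z) :: map (pair true) r1 ++ map (pair false) r1 ->
          z = (false, 0%Z) \/ (0 < z.2 <= Z.of_nat h)%Z.
        rewrite in_cons mem_cat => /or3P[/eqP ->|/mapP[x /inr ? ->]|/mapP[x /inr ? ->]];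
          [by left | by right | by right].
      have sym x y : (Z.of_nat p | x - y)%Z -> (Z.of_nat p | y - x)%Z.
        by move=> [k E]; exists (- k)%Z; lia.
      move=> [e1 x] [e2 y] /ins h1 /ins h2 /=.
      case: h1 => [[-> ->]|/= h1]; case: h2 => [[-> ->]|/= h2] //= D.
      * by exfalso; case: e2 D => -[k E]; [apply: (bsq0 _ h2) | apply: (sq0 _ h2)];
          exists (- k)%Z; lia.
      * by exfalso; case: e1 D => -[k E]; [apply: (bsq0 _ h1) | apply: (sq0 _ h1)];
          exists k; lia.
      * case: e1 D; case: e2.
        - move=> D; f_equal; apply: sqinj => //.
          have : (Z.of_nat p | b * (x * x - y * y))%Z.
            by have -> : (b * (x * x - y * y) = b * (x * x) - b * (y * y))%Z by ring.
          by move/(prime_mult _ pp) => [].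
        - by move/cross; case.
        - by move/sym/cross; case.
        - by move=> D; f_equal; apply: sqinj.
  move: S0; set a := \csum_(x <- r1) _; set c := \csum_(x <- r1) _ => S0.
  have -> : a = (1 + a + c - 1 - c)%C by ring.
  have -> : RtoC (IZR (-1)) = (- RtoC 1)%C by rewrite -RtoC_opp.
  by rewrite S0; ring.
Qed.

Lemma prime_divisor (n : Z) : (1 < n)%Z -> exists p, Znumtheory.prime p /\ (p | n)%Z.
Proof.
move=> n1; have n0 : (0 <= n)%Z by lia.
move: n n0 n1; apply: Z_lt_induction => n IH n1.
case: (prime_dec n) => [pn|np]; first by exists n; split => //; exact: Z.divide_refl.
have [m [hm dm]] := not_prime_divide n n1 np.
have [||p [pp pm]] := IH m; try lia.
by exists p; split => //; exact: Z.divide_trans pm dm.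
Qed.

Lemma jacobi_1 (a : Z) : jacobi a 1 = 1%Z.
Proof. by []. Qed.

(** Strong induction, splitting off a prime p. A simple prime factor is separated by [gsum_crt],
    which changes [A]; hence [A] is quantified inside. If p^2 divides n, the two parts are not
    coprime; [gsum_sq] then removes p^2, and the symbol does not notice since (b / p)^2 = 1. *)
Lemma gsum_jacobi (n : nat) : (0 < n)%N -> Z.odd (Z.of_nat n) -> forall b A : Z,
  Z.gcd b (Z.of_nat n) = 1%Z -> Z.gcd A (Z.of_nat n) = 1%Z ->
  gsum (b * A) 0 n = (IZR (jacobi b n) * gsum A 0 n)%C.
Proof.
elim/ltn_ind: n => n IH n0 nodd b A gb gA.
case: (Z_le_gt_dec (Z.of_nat n) 1) => n1.
  have -> : n = 1%N by lia.
  by rewrite !gsum_1 jacobi_1 Cmult_1_l.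
have [p [pp [m Em]]] := prime_divisor (ltac:(lia) : (1 < Z.of_nat n)%Z).
have p1 : (1 < p)%Z by case: pp.
set q := Z.to_nat p; set m' := Z.to_nat m.
have qE : Z.of_nat q = p by rewrite /q; lia.
have mE : Z.of_nat m' = m by rewrite /m'; lia.
have nE : n = (q * m')%N by nia.
have q0 : (0 < q)%N by lia.
have m0' : (0 < m')%N by lia.
have [podd modd] : Z.odd p /\ Z.odd m.
  by move: nodd; rewrite Em Z.odd_mul => /andP[].
have ndiv x : Z.gcd x (Z.of_nat n) = 1%Z -> ~ (p | x)%Z.
  move=> g d; have : (p | Z.gcd x (Z.of_nat n))%Z.
    by apply: Z.gcd_greatest => //; exists m.
  by rewrite g => /Z.divide_1_r_nonneg; lia.
have gm x : Z.gcd x (Z.of_nat n) = 1%Z -> Z.gcd x m = 1%Z.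
  move=> /Zgcd_1_rel_prime g; apply/Zgcd_1_rel_prime.
  apply: rel_prime_sym; apply: (@rel_prime_div (Z.of_nat n)).
    exact: rel_prime_sym.
  by exists p; lia.
have jp x : jacobi x q = legendre x p by exact: jacobi_prime.
have lmod x : ~ (p | x)%Z -> (legendre x p * legendre x p = 1)%Z.
  move=> px; have [L1 L2] := legendre_spec _ _ pp px.
  by case: (Classical_Prop.classic (exists y, (p | y * y - x)%Z)) => [/L1|/L2] ->.
case: (Classical_Prop.classic (p | m)%Z) => [[m2 Em2]|pm].
- set k := Z.to_nat m2.
  have kE : Z.of_nat k = m2 by rewrite /k; lia.
  have m'E : m' = (k * q)%N by nia.
  have k0 : (0 < k)%N by lia.
  have kodd : Z.odd (Z.of_nat k).
    by move: modd; rewrite Em2 Z.odd_mul kE => /andP[].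
  have gk x : Z.gcd x (Z.of_nat n) = 1%Z -> Z.gcd x (Z.of_nat k) = 1%Z.
    move=> /gm/Zgcd_1_rel_prime g; apply/Zgcd_1_rel_prime.
    apply: rel_prime_sym; apply: (@rel_prime_div m).
      exact: rel_prime_sym.
    by exists p; lia.
  have g2 x : Z.gcd x (Z.of_nat n) = 1%Z -> Z.gcd (x * 2) (Z.of_nat q) = 1%Z.
    move=> g; rewrite qE; apply: prime_gcd => // /(prime_mult _ pp)[/(ndiv _ g)//|].
    move=> d; have := Z.divide_pos_le _ _ (ltac:(lia) : (0 < 2)%Z) d => h.
    have E : p = 2%Z by lia.
    by rewrite E in podd.
  have gbA : Z.gcd (b * A) (Z.of_nat n) = 1%Z.
    apply/Zgcd_1_rel_prime; apply: rel_prime_sym; apply: rel_prime_mult;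
      apply: rel_prime_sym; exact/Zgcd_1_rel_prime.
  rewrite nE m'E gsum_sq ?g2 // gsum_sq ?g2 //.
  rewrite jacobi_mul; [|lia|nia].
  rewrite jacobi_mul; [|lia|lia].
  rewrite jp IH ?gk //; last by nia.
  have -> : (legendre b p * (jacobi b k * legendre b p) =
    jacobi b k * (legendre b p * legendre b p))%Z by ring.
  rewrite lmod; last exact: ndiv.
  rewrite Z.mul_1_r; ring.
- have gpm : Z.gcd (Z.of_nat q) (Z.of_nat m') = 1%Z.
    by rewrite qE mE Z.gcd_comm; exact: prime_gcd.
  have mod' : Z.odd (Z.of_nat m') by rewrite mE.
  have ltm : (m' < n)%N by nia.
  have gqm : Z.gcd (A * Z.of_nat q) (Z.of_nat m') = 1%Z.
    apply/Zgcd_1_rel_prime; apply: rel_prime_sym; apply: rel_prime_mult;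
      apply: rel_prime_sym; apply/Zgcd_1_rel_prime => //.
    by rewrite mE; exact: gm.
  rewrite nE !gsum_crt //.
  have -> : (b * A * Z.of_nat q = b * (A * Z.of_nat q))%Z by ring.
  have -> : (b * A * Z.of_nat m' = b * (A * Z.of_nat m'))%Z by ring.
  rewrite IH //; last by rewrite mE; exact: gm.
  rewrite (@gsum_prime (A * Z.of_nat m') b) ?qE //; last 2 first.
  + by move=> /(prime_mult _ pp)[]; [exact: ndiv | rewrite mE].
  + exact: ndiv.
  rewrite jacobi_mul; [|lia|lia].
  by rewrite jp mult_IZR RtoC_mult; ring.
Qed.

Lemma gsum_theta_mult (c : Z) (k n : nat) : (0 < k)%N -> (0 < n)%N ->
  Z.gcd c (Z.of_nat n) = 1%Z ->
  ((Z.of_nat (4 * k) | Z.of_nat n - 1)%Z ->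
     gsum (c * Z.of_nat k) 0 n = (IZR (jacobi c n) * sqrt (INR n))%C) /\
  ((Z.of_nat (4 * k) | Z.of_nat n + 1)%Z ->
     gsum (c * Z.of_nat k) 0 n = (IZR (jacobi c n) * (Ci * sqrt (INR n)))%C).
Proof.
move=> k0 n0 gc; have [G1 G2] := gsum_pm1 k0 n0.
have odd4 (e : Z) : (e = 1 \/ e = -1)%Z -> (Z.of_nat (4 * k) | Z.of_nat n - e)%Z ->
    Z.odd (Z.of_nat n).
  move=> he [q E]; apply/Z.odd_spec.
  by case: he E => -> E; [exists (2 * (q * Z.of_nat k))%Z | exists (2 * (q * Z.of_nat k) - 1)%Z]; nia.
have gcd4 (e : Z) : (e = 1 \/ e = -1)%Z -> (Z.of_nat (4 * k) | Z.of_nat n - e)%Z ->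
    Z.gcd (Z.of_nat k) (Z.of_nat n) = 1%Z.
  move=> he [q E]; apply/Zgcd_1_rel_prime; apply: bezout_rel_prime.
  apply: (Bezout_intro _ _ _ (- e * (4 * q))%Z e).
  by case: he E => -> E; nia.
split=> D.
- have D' : (Z.of_nat (4 * k) | Z.of_nat n - 1)%Z by [].
  rewrite gsum_jacobi ?G1 //; [exact: (odd4 1%Z (or_introl erefl)) |
    exact: (gcd4 1%Z (or_introl erefl))].
- have D' : (Z.of_nat (4 * k) | Z.of_nat n - -1)%Z.
    by have -> : (Z.of_nat n - -1 = Z.of_nat n + 1)%Z by lia.
  rewrite gsum_jacobi ?G2 //; [exact: (odd4 (-1)%Z (or_intror erefl)) |
    exact: (gcd4 (-1)%Z (or_intror erefl))].
Qed.

(** * Modularity of theta *)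

(** The root of a point of the upper half-plane lies in the open first quadrant, and rotation by -i
    keeps it in the right half-plane. *)
Lemma Csqrt_opp_upper (z : C) : upper z -> Csqrt (- z)%C = (- (Ci * Csqrt z))%C.
Proof.
rewrite /upper => z0; have [E p] := Csqrt_spec z.
apply: Csqrt_unique.
  transitivity (Ci * Ci * (Csqrt z * Csqrt z))%C; first by ring.
  by rewrite E Ci2; ring.
left; move: E p; case: (Csqrt z) => a b; rewrite /Re /Im /= => E p.
have : Im z = a * b + b * a by rewrite -E.
by rewrite /Im in z0 *; nra.
Qed.

Lemma Csqrt_inv (z : C) : 0 < Re z -> Csqrt (/ z)%C = (/ Csqrt z)%C.
Proof.
move=> z0; have zC : z <> RtoC 0 by move=> E; move: z0; rewrite E /=; lra.
have E := Csqrt_mult z0 (Re_inv_pos z0).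
rewrite Cinv_r // Csqrt_R ?sqrt_1 in E; last by lra.
have sC := @Csqrt_neq0 z zC.
have -> : Csqrt (/ z)%C = (/ Csqrt z * (Csqrt z * Csqrt (/ z)))%C by field.
by rewrite -E; ring.
Qed.

Lemma moebius_den_neq0 (a b c d : Z) (z : C) : SL2Z a b c d -> upper z ->
  (IZR c * z + IZR d)%C <> RtoC 0.
Proof.
rewrite /SL2Z /upper => det z0 E.
have E1 : Re (IZR c * z + IZR d)%C = 0 by rewrite E.
have E2 : Im (IZR c * z + IZR d)%C = 0 by rewrite E.
move: E1 E2 z0; case: z {E} => x y; rewrite /Re /Im /= => E1 E2 y0.
have c0 : IZR c = 0 by nra.
have d0 : IZR d = 0 by rewrite c0 in E1; lra.
have := eq_IZR _ _ c0; have := eq_IZR _ _ d0; nia.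
Qed.

Lemma SL2Z_C (a b c d : Z) : SL2Z a b c d ->
  (IZR a * IZR d - IZR b * IZR c)%C = RtoC 1.
Proof.
by move=> det; rewrite -!RtoC_mult -RtoC_minus -!mult_IZR -minus_IZR det.
Qed.

Lemma moebius_upper (a b c d : Z) (z : C) : SL2Z a b c d -> upper z ->
  upper (moebius a b c d z).
Proof.
move=> det z0; have W0 := @moebius_den_neq0 a b c d z det z0.
have D : IZR a * IZR d - IZR b * IZR c = 1.
  by rewrite -!mult_IZR -minus_IZR det.
move: z0 W0; rewrite /moebius /upper; case: z => x y; rewrite /Im /= => y0 W0.
set u := IZR c * x - 0 * y + IZR d; set v := IZR c * y + 0 * x + 0.
have p0 : 0 < u * (u * 1) + v * (v * 1).
  have [h|h] : u <> 0 \/ v <> 0.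
    case: (Req_dec u 0) => hu; last by left.
    case: (Req_dec v 0) => hv; last by right.
    case: W0; rewrite /Cplus /Cmult /RtoC /=; f_equal; [exact: hu | exact: hv].
  - by have := Rsqr_pos_lt _ h; rewrite /Rsqr; nra.
  - by have := Rsqr_pos_lt _ h; rewrite /Rsqr; nra.
have -> : (IZR a * x - 0 * y + IZR b) * (- v / (u * (u * 1) + v * (v * 1))) +
  (IZR a * y + 0 * x + 0) * (u / (u * (u * 1) + v * (v * 1))) =
  (IZR a * IZR d - IZR b * IZR c) * y / (u * (u * 1) + v * (v * 1)).
  by rewrite /u /v; field; rewrite /u /v in p0; lra.
by rewrite D; apply: Rdiv_lt_0_compat => //; lra.
Qed.

(* Completing the square; [s] is an inverse of [- 2 A] modulo [n]. *)
Lemma gsum_square (A s m e : Z) (n : nat) : (0 < n)%N ->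
  (Z.of_nat n | 2 * A * s + 1)%Z -> (s = 2 * e)%Z ->
  gsum A m n = (gsum A 0 n * ez n (e * (m * m)))%C.
Proof.
move=> n0 [q Eq] se.
pose f x := ez n (A * (x * x)).
have fq x y : (Z.of_nat n | x - y)%Z -> f x = f y.
  by move=> [k E]; apply: ez_mod => //; exists (A * k * (x + y))%Z; nia.
rewrite (gsumE A n).
rewrite -(csum_residue_system (f := f)
  (s := map (fun r => (Z.of_nat r - s * m)%Z) (iota 0 n)) n0 fq).
- rewrite big_map big_distrl /=; apply: eq_bigr => r _.
  rewrite /f -ez_plus; apply: ez_mod => //.
  have -> : (A * (Z.of_nat r * Z.of_nat r) + m * Z.of_nat r -
    (A * ((Z.of_nat r - s * m) * (Z.of_nat r - s * m)) + e * (m * m)) =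
    (2 * A * s + 1) * (m * Z.of_nat r) - e * m * m * (2 * A * s + 1))%Z.
    by rewrite se; ring.
  by rewrite Eq; exists (q * (m * Z.of_nat r) - e * m * m * q)%Z; ring.
- by rewrite size_map size_iota.
- apply: uniq_modP => //; first exact: iota_uniq.
  move=> x y; rewrite !mem_iota => hx hy.
  have -> : (Z.of_nat x - s * m - (Z.of_nat y - s * m) = Z.of_nat x - Z.of_nat y)%Z.
    by ring.
  by move/divide_small; lia.
Qed.

Lemma kernel_inv (t : C) (m : Z) : t <> RtoC 0 ->
  theta_kernel (/ t) (IZR m) = e2pi (IZR (m * m) * (Ci / (2 * t)))%C.
Proof.
move=> t0; rewrite mult_IZR e2pi_kernel; f_equal.
transitivity (- (Ci * Ci) / t)%C; last by field.
by rewrite Ci2; field.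
Qed.

(* [moebius a b c d z = b / d + z / (d (c z + d))]. *)
Lemma theta_law_gauss (k : nat) (a b c d e : Z) (z : C) : (0 < k)%N ->
  SL2Z a b c d -> upper z -> (c = 4 * Z.of_nat k * e)%Z ->
  theta (INR k * moebius a b c d z)%C =
  (gsum (Z.of_nat k * b * Z.sgn d) 0 (Z.abs_nat d) *
   Csqrt ((IZR c * z + IZR d) / IZR d) * theta (INR k * z))%C.
Proof.
move=> k0 det z0 ce.
have d0 : d <> 0%Z by move=> d0; move: det; rewrite /SL2Z d0 ce; nia.
have K0 : 0 < INR k by exact: INR_gt0.
have KC : RtoC (INR k) <> RtoC 0 by move/RtoC_inj; lra.
have zC : z <> RtoC 0 by move=> E; move: z0; rewrite /upper E /=; lra.
set n := Z.abs_nat d.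
have n0 : (0 < n)%N by rewrite /n; lia.
have dC : RtoC (IZR d) <> RtoC 0 by move/RtoC_inj/eq_IZR.
have nE : Z.of_nat n = (Z.sgn d * d)%Z by rewrite /n; lia.
have WC := @moebius_den_neq0 a b c d z det z0.
have DC := SL2Z_C det.
(* A / n = k b / d with the positive denominator n = |d|: the image under the matrix of 0,
   multiplied by k. *)
set A := (Z.of_nat k * b * Z.sgn d)%Z.
set w := moebius a b c d z; set W := (IZR c * z + IZR d)%C in WC *.
have w0 : upper (INR k * w)%C by apply: upper_scal => //; exact: moebius_upper.
have kz0 : upper (INR k * z)%C by exact: upper_scal.
have H := theta_gauss A w0 n0.
have tE : tau A n (INR k * w)%C = (- (2 * Ci * INR k * IZR d * z / W))%C.
  rewrite /tau INR_IZR_INZ nE /A !mult_IZR !RtoC_mult -!INR_IZR_INZ.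
  have -> : (IZR (Z.sgn d) * IZR d * (INR k * w) - INR k * IZR b * IZR (Z.sgn d) =
    IZR (Z.sgn d) * INR k * (IZR d * w - IZR b))%C by ring.
  have -> : (IZR d * w - IZR b = (IZR a * IZR d - IZR b * IZR c) * z / W)%C.
    by rewrite /w /moebius -/W; rewrite /W in WC *; field.
  rewrite DC.
  have ss : (IZR (Z.sgn d) * IZR (Z.sgn d))%C = RtoC 1.
    by rewrite -RtoC_mult -mult_IZR; do 2!f_equal; lia.
  transitivity (- (2 * Ci * INR k * IZR d * z / W *
     (IZR (Z.sgn d) * IZR (Z.sgn d))))%C; first by rewrite /Cdiv; ring.
  by rewrite ss; ring.
set t := tau _ _ _ in H tE.
have t0 : 0 < Re t.
  rewrite Re_tau; rewrite /upper in w0; apply: Rmult_lt_0_compat => //.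
  have : 0 < INR n by apply: lt_0_INR; lia.
  by nra.
have tC : t <> RtoC 0 by move=> E; move: t0; rewrite E /=; lra.
have E1 : (Csqrt t * theta (INR k * w) =
    gsum A 0 n * theta (- (/ (4 * (INR k * z)))))%C.
  apply: (is_usum_unique H).
  apply: is_usum_ext (is_usum_scal (gsum A 0 n) (theta_usum _)) => [m|]; last first.
    by apply: upper_neg_inv; apply: upper_scal => //; lra.
  (* The inverse is explicit: 2 A (2 e sgn d) + 1 = 4 k e b + 1 = b c + 1 = a d, a multiple of n. *)
  rewrite (@gsum_square A (2 * (e * Z.sgn d)) m (e * Z.sgn d)) //; last first.
    have -> : (2 * A * (2 * (e * Z.sgn d)) + 1 = a * d)%Z.
      rewrite /A; have ss : (Z.sgn d * Z.sgn d = 1)%Z by lia.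
      transitivity (4 * Z.of_nat k * e * b * (Z.sgn d * Z.sgn d) + 1)%Z; first by ring.
      by rewrite ss -ce; move: det; rewrite /SL2Z; lia.
    rewrite nE; exists (a * Z.sgn d)%Z.
    transitivity (a * d * (Z.sgn d * Z.sgn d))%Z; last by ring.
    by have -> : (Z.sgn d * Z.sgn d = 1)%Z by [lia]; ring.
  rewrite kernel_inv //.
  have -> : ez n (e * Z.sgn d * (m * m)) =
      e2pi (IZR (m * m) * (IZR c / (4 * INR k * IZR d)))%C.
    rewrite /ez; f_equal.
    have nR : INR n <> 0 by apply: not_0_INR; lia.
    rewrite RtoC_div // INR_IZR_INZ nE ce !mult_IZR !RtoC_mult -!INR_IZR_INZ.
    have sC : RtoC (IZR (Z.sgn d)) <> RtoC 0 by move/RtoC_inj/eq_IZR; lia.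
    by field; do !split => //; move/RtoC_inj; lra.
  transitivity (gsum A 0 n * (e2pi (IZR (m * m) * (Ci / (2 * t))) *
    e2pi (IZR (m * m) * (IZR c / (4 * INR k * IZR d)))))%C; last by ring.
  f_equal.
  (* The phase from completing the square merges with the dual kernel: i / (2 t) + c / (4 k d) = - 1
     / (4 k z). A second inversion then returns to k z. *)
  rewrite -e2pi_plus -Cmult_plus_distr_l; do 2!f_equal.
  rewrite tE.
  transitivity (- (/ 4) * ((W - IZR c * z) / (INR k * IZR d * z)))%C.
    by rewrite /W; field; do !split.
  by rewrite /W; field; do !split; first [exact: Ci_neq0 | done].
rewrite theta_inv_4 // in E1.
have st := @Csqrt_neq0 t tC.
have -> : theta (INR k * w)%C = (/ Csqrt t * (Csqrt t * theta (INR k * w)))%C.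
  by field.
have t2 : 0 < Re (- (2 * Ci * (INR k * z)))%C.
  by rewrite Re_mul_Ci; rewrite /upper in kz0; lra.
rewrite E1 -Csqrt_inv //.
have -> : (W / IZR d = / t * - (2 * Ci * (INR k * z)))%C.
  by rewrite tE; field; do !split => //; exact: Ci_neq0.
by rewrite Csqrt_mult //; [ring | exact: Re_inv_pos].
Qed.

Lemma Cconj_R (x : R) : Cconj (RtoC x) = RtoC x.
Proof. by rewrite /Cconj /RtoC /=; f_equal; ring. Qed.

(** Modulo d one has b c = -1. Multiplying the variable of the Gauss sum by the unit c therefore
    replaces b by -c, up to the sign of d, and [gsum_theta_mult] evaluates the result. *)
Lemma theta_law (k : nat) (N a b c d : Z) (z : C) : (0 < k)%N ->
  (4 * Z.of_nat k | N)%Z -> Gamma1 N a b c d -> upper z ->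
  theta (INR k * moebius a b c d z)%C =
  (IZR (qsymbol c d) * Csqrt (IZR c * z + IZR d) * theta (INR k * z))%C.
Proof.
move=> k0 kN [det [_ [Nd Nc]]] z0.
have [e ce] := Z.divide_trans _ _ _ kN Nc.
have [g de] := Z.divide_trans _ _ _ kN Nd.
have d0 : d <> 0%Z by move=> d0; move: de; rewrite d0; nia.
set n := Z.abs_nat d; have n0 : (0 < n)%N by rewrite /n; lia.
have gcd1 : Z.gcd c d = 1%Z.
  apply/Zgcd_1_rel_prime; apply: bezout_rel_prime.
  by apply: (Bezout_intro _ _ _ (- b)%Z a); move: det; rewrite /SL2Z; lia.
have gcn : Z.gcd c (Z.of_nat n) = 1%Z.
  by rewrite /n Zabs2Nat.id_abs Z.gcd_abs_r.
have [G1 G2] := gsum_theta_mult k0 n0 gcn.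
rewrite (@theta_law_gauss k a b c d e) //; last by lia.
f_equal.
have qs : qsymbol c d = ((if (d <? 0)%Z then Z.sgn c else 1) * jacobi c n)%Z.
  (* For c = 0 the symbol is 1 by convention; coprimality makes d a unit, and d congruent to 1
     modulo 4 k excludes -1. *)
  rewrite /qsymbol gcd1 /=; case: Z.eqb_spec => // c0.
  have d1 : d = 1%Z by move: gcd1 de; rewrite c0 Z.gcd_0_l; nia.
  by rewrite /n d1 c0.
have dR : IZR d <> 0 by move/eq_IZR.
set W := (IZR c * z + IZR d)%C.
have N0 : 0 < INR n by exact: INR_gt0.
have sN := sqrt_lt_R0 _ N0.
have sNC : RtoC (sqrt (INR n)) <> RtoC 0 by move/RtoC_inj; lra.
have sqrt_scal V : Csqrt (RtoC (/ INR n) * V)%C = (/ sqrt (INR n) * Csqrt V)%C.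
  rewrite Csqrt_scal; last exact: Rinv_0_lt_compat.
  by rewrite sqrt_inv RtoC_inv //; lra.
have conjJ x : Cconj (IZR (jacobi c n) * x)%C = (IZR (jacobi c n) * Cconj x)%C.
  by case: x => p q; rewrite /Cconj /Cmult /RtoC /=; f_equal; ring.
rewrite -(@gsum_unit _ c) // qs; case: Z.ltb_spec => hd.
- have nE : Z.of_nat n = (- d)%Z by rewrite /n; lia.
  have c0 : c <> 0%Z by move=> c0; move: gcd1 de; rewrite c0 Z.gcd_0_l; nia.
  have -> : gsum (Z.of_nat k * b * Z.sgn d * (c * c)) 0 n =
      (IZR (jacobi c n) * (Ci * sqrt (INR n)))%C.
    rewrite -G2; last by rewrite nE; exists (- g)%Z; lia.
    apply: gsum_mod => //; last by exists 0%Z; lia.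
    have -> : Z.sgn d = (-1)%Z by lia.
    rewrite nE; exists (Z.of_nat k * a * c)%Z; move: det; rewrite /SL2Z => det.
    transitivity (- (Z.of_nat k * c * (b * c + 1)))%Z; first by ring.
    have -> : (b * c = a * d - 1)%Z by lia.
    by ring.
  have -> : (W / IZR d)%C = (RtoC (/ INR n) * - W)%C.
    rewrite RtoC_inv ?INR_IZR_INZ ?nE ?opp_IZR ?RtoC_opp; last by lra.
    by field; move/RtoC_inj; lra.
  rewrite sqrt_scal.
  have ImW : Im W = IZR c * Im z by rewrite /W; case: (z) => p q; rewrite /Im /=; ring.
  rewrite /upper in z0.
  (* The root of -W is -i or i times the root of W according to the half-plane of W, that is, to the
     sign of c. Multiplied by the i of the Gauss sum, this is sgn c. *)
  have [cp|cn] : (0 < c \/ c < 0)%Z by lia.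
  + have Wu : upper W by rewrite /upper ImW; apply: Rmult_lt_0_compat => //; exact: IZR_lt.
    rewrite Csqrt_opp_upper //.
    have -> : Z.sgn c = 1%Z by lia.
    rewrite Z.mul_1_l.
    transitivity (IZR (jacobi c n) * (- (Ci * Ci)) * Csqrt W)%C; first by field.
    by rewrite Ci2; ring.
  + have Wu : upper (- W)%C.
      rewrite /upper; have -> : Im (- W)%C = - Im W by [].
      by rewrite ImW; have := IZR_lt _ _ cn; nra.
    have := Csqrt_opp_upper Wu; have -> : (- - W = W)%C by ring.
    move=> ->.
    have -> : Z.sgn c = (-1)%Z by lia.
    rewrite mult_IZR RtoC_mult.
    have -> : RtoC (IZR (-1)) = (- RtoC 1)%C by rewrite -RtoC_opp.
    by field.
- have nE : Z.of_nat n = d by rewrite /n; lia.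
  have -> : gsum (Z.of_nat k * b * Z.sgn d * (c * c)) 0 n =
      (IZR (jacobi c n) * sqrt (INR n))%C.
    have -> : gsum (Z.of_nat k * b * Z.sgn d * (c * c)) 0 n =
        gsum (- (c * Z.of_nat k)) (- 0) n.
      apply: gsum_mod => //; last by exists 0%Z; lia.
      have -> : Z.sgn d = 1%Z by lia.
      rewrite nE; exists (Z.of_nat k * a * c)%Z; move: det; rewrite /SL2Z => det.
      transitivity (Z.of_nat k * c * (b * c + 1))%Z; first by ring.
      have -> : (b * c = a * d - 1)%Z by lia.
      by ring.
    rewrite gsum_conj G1; last by rewrite nE; exists g; lia.
    by rewrite conjJ Cconj_R.
  have -> : (W / IZR d)%C = (RtoC (/ INR n) * W)%C.
    rewrite RtoC_inv ?INR_IZR_INZ ?nE; last by lra.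
    by field; move/RtoC_inj; lra.
  rewrite sqrt_scal.
  by rewrite Z.mul_1_l; field.
Qed.

(** * Expansions at the cusps *)

Lemma is_usum_series (f : nat -> C) (l : C) : is_usum f l -> is_Cseries f l.
Proof.
move=> H; rewrite /is_Cseries /is_series.
apply/filterlim_locally_ball_norm => eps.
have [F0 HF] := H eps (cond_pos eps).
exists (\max_(j <- F0) j).+1 => n hn.
have E : sum_n f n = \csum_(i <- iota 0 n.+1) f i.
  elim: n {hn} => [|n IH]; first by rewrite sum_O /= big_seq1.
  by rewrite sum_Sn IH -(addn1 n.+1) iotaD big_cat /= big_seq1.
rewrite E; apply: HF; first exact: iota_uniq.
move=> j Hj; rewrite mem_iota /= add0n.
have := @leq_bigmax_seq _ F0 xpredT id j Hj isT.
by move/leP: hn; lia.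
Qed.

(** Terms with equal exponent v m^2 are grouped by [is_usum_push]. The free factor [v] lets theta
    functions of different natural widths be expanded with one common width [w]. *)
Lemma fourier_of_theta_series (coef : Z -> C) (v w : nat) (F : C -> C) :
  (0 < v)%N -> (0 < w)%N ->
  (forall z, upper z -> is_usum (fun m : Z =>
     coef m * e2pi (IZR (m * m) * (INR v * z / INR w)))%C (F z)) ->
  exists g : nat -> C, fourier w g F.
Proof.
move=> v0 w0 H.
pose p (m : Z) := (Z.abs_nat m * Z.abs_nat m * v)%N.
pose fib (j : nat) := [seq m <- [seq (Z.of_nat i - Z.of_nat j)%Z | i <- iota 0 (2 * j).+1] | p m == j].
have ufib j : uniq (fib j).
  by apply: filter_uniq; rewrite map_inj_uniq ?iota_uniq // => a b; lia.
have mfib m j : (m \in fib j) = (p m == j).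
  rewrite mem_filter andb_idr // => /eqP E; apply/mapP.
  exists (Z.to_nat (m + Z.of_nat j)); last by rewrite /p in E; nia.
  by rewrite mem_iota /p in E *; nia.
exists (fun j => \csum_(m <- fib j) coef m) => z z0.
apply: is_usum_series.
apply: is_usum_ext (is_usum_push ufib mfib (H z z0)) => j.
rewrite big_distrl /=; apply: eq_big_seq => m; rewrite mfib => /eqP E.
do 2!f_equal.
have -> : IZR (m * m) = INR (Z.abs_nat m * Z.abs_nat m).
  by rewrite mult_INR !INR_IZR_INZ -mult_IZR; f_equal; lia.
by rewrite -E /p !mult_INR !RtoC_mult /Cdiv; ring.
Qed.

Lemma fourier_ext (w : nat) (g : nat -> C) (F G : C -> C) :
  (forall z, upper z -> F z = G z) -> fourier w g F -> fourier w g G.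
Proof. by move=> E H z z0; rewrite -E //; exact: H. Qed.

Lemma fourier_plus (w : nat) (g1 g2 : nat -> C) (F G : C -> C) :
  fourier w g1 F -> fourier w g2 G ->
  fourier w (fun m => g1 m + g2 m)%C (fun z => F z + G z)%C.
Proof.
move=> H1 H2 z z0.
have := is_series_plus _ _ _ _ (H1 z z0) (H2 z z0).
by apply: is_series_ext => m; rewrite /plus /=; ring.
Qed.

Lemma fourier_scal (w : nat) (x : C) (g : nat -> C) (F : C -> C) :
  fourier w g F -> fourier w (fun m => x * g m)%C (fun z => x * F z)%C.
Proof.
move=> H z z0.
have := is_series_scal_l x _ _ (H z z0).
by apply: is_series_ext => m; exact: Cmult_assoc.
Qed.

Lemma fourier_sum (w : nat) (r : seq nat) (F : nat -> C -> C) :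
  (forall k, k \in r -> exists g, fourier w g (F k)) ->
  exists g, fourier w g (fun z => \csum_(k <- r) F k z).
Proof.
elim: r => [_|k r IH H].
  exists (fun _ => RtoC 0) => z _; rewrite big_nil; apply: is_usum_series.
  apply: is_usum_ext (@is_usum_0 nat) => m; ring.
have [g1 H1] := H k (mem_head _ _).
have [g2 H2] := IH (fun j hj => H j (mem_behead (s := k :: r) hj)).
exists (fun m => g1 m + g2 m)%C; apply: fourier_ext (fourier_plus H1 H2) => z _.
by rewrite big_cons.
Qed.

(* [moebius a b c d z = a / c - 1 / (c (c z + d))]. *)
Lemma theta_cusp_pos (k v w : nat) (a b c d : Z) : (0 < k)%N -> (0 < v)%N ->
  w = (4 * k * v)%N -> SL2Z a b c d -> (0 < c)%Z ->
  exists g : nat -> C, fourier w g (fun z =>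
    / Csqrt (IZR c * z + IZR d) * theta (INR k * moebius a b c d z))%C.
Proof.
move=> k0 v0 wE det c0.
have w0 : (0 < w)%N by rewrite wE; nia.
set n := Z.to_nat c; have nE : Z.of_nat n = c by rewrite /n; lia.
have n0 : (0 < n)%N by lia.
have K0 : 0 < INR k by exact: INR_gt0.
have KC : RtoC (INR k) <> RtoC 0 by move/RtoC_inj; lra.
have VC : RtoC (INR v) <> RtoC 0.
  by move/RtoC_inj; have : 0 < INR v by [apply: lt_0_INR; lia]; lra.
have nR : INR n = IZR c by rewrite INR_IZR_INZ nE.
have cR : 0 < IZR c by exact: IZR_lt.
have cC : RtoC (IZR c) <> RtoC 0 by move/RtoC_inj; lra.
(* Here i / (2 tau) = (c z + d) / (4 k c) = z / (4 k) + d / (4 k c): the first summand gives the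
   width, the second a constant phase. *)
pose coef (m : Z) := (e2pi (IZR (m * m) * (IZR d / (4 * INR k * IZR c))) *
  gsum (Z.of_nat k * a) m n)%C.
pose Q : C := Csqrt (2 * Ci * INR k * IZR c)%C.
have QC : Q <> RtoC 0.
  apply: Csqrt_neq0; do !apply: Cmult_neq_0 => //; last exact: Ci_neq0.
  by move/RtoC_inj; lra.
have [|g Hg] := @fourier_of_theta_series coef v w (fun z =>
  Q * (/ Csqrt (IZR c * z + IZR d) * theta (INR k * moebius a b c d z)))%C v0 w0 _.
  move=> z z0; set W := (IZR c * z + IZR d)%C; set u := moebius a b c d z.
  have WC := @moebius_den_neq0 a b c d z det z0.
  have u0 : upper (INR k * u)%C by apply: upper_scal => //; exact: moebius_upper.
  have H := theta_gauss (Z.of_nat k * a) u0 n0.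
  have tE : tau (Z.of_nat k * a) n (INR k * u)%C = (2 * Ci * INR k * IZR c / W)%C.
    rewrite /tau nR mult_IZR RtoC_mult -INR_IZR_INZ.
    have -> : (IZR c * (INR k * u) - INR k * IZR a = INR k * (IZR c * u - IZR a))%C.
      by ring.
    have -> : (IZR c * u - IZR a = - ((IZR a * IZR d - IZR b * IZR c) / W))%C.
      by rewrite /u /moebius /W; field.
    by rewrite (SL2Z_C det) /Cdiv; ring.
  set t := tau _ _ _ in H tE.
  have t0 : 0 < Re t.
    rewrite Re_tau; rewrite /upper in u0; apply: Rmult_lt_0_compat => //.
    by rewrite nR; nra.
  have tC : t <> RtoC 0 by move=> E; move: t0; rewrite E /=; lra.
  have Wu : upper W.
    rewrite /upper; have -> : Im W = IZR c * Im z.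
      by rewrite /W; case: (z) => p q; rewrite /Im /=; ring.
    exact: Rmult_lt_0_compat.
  have sW := @Csqrt_neq0 W WC.
  (* W t = 2 i k c is constant, but the branch must be checked: the roots have arguments in (0, PI /
     2) and (-PI / 4, PI / 4), so their product has argument above -PI / 4 and below 3 PI / 4. Its
     square is on the positive imaginary axis, which leaves PI / 4. *)
  have QE : Q = (Csqrt W * Csqrt t)%C.
    apply: Csqrt_unique.
      have [E1 _] := Csqrt_spec W; have [E2 _] := Csqrt_spec t.
      transitivity ((Csqrt W * Csqrt W) * (Csqrt t * Csqrt t))%C; first by ring.
      by rewrite E1 E2 tE; field.
    left; have [E1 P1] := Csqrt_spec W; have [E2 _] := Csqrt_spec t.
    have [T1 T2] := Csqrt_half t0.
    have PE : ((Csqrt W * Csqrt t) * (Csqrt W * Csqrt t) = 2 * Ci * INR k * IZR c)%C.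
      transitivity ((Csqrt W * Csqrt W) * (Csqrt t * Csqrt t))%C; first by ring.
      by rewrite E1 E2 tE; field.
    have ImW : Im W = 2 * (Re (Csqrt W) * Im (Csqrt W)).
      by rewrite -{1}E1 /Re /Im /=; ring.
    rewrite /upper in Wu.
    have [s1 s2] : 0 < Re (Csqrt W) /\ 0 < Im (Csqrt W).
      by case: P1 => [h|[h1 h2]]; nra.
    set P := (Csqrt W * Csqrt t)%C in PE *.
    have P2 : 0 < Re P + Im P.
      have -> : Re P + Im P = Re (Csqrt W) * (Re (Csqrt t) + Im (Csqrt t)) +
         Im (Csqrt W) * (Re (Csqrt t) - Im (Csqrt t)) by rewrite /P /Re /Im /=; ring.
      by move/Rabs_def2: T2 => T2; nra.
    have P3 : 0 < Re P * Im P.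
      have : Im (P * P)%C = 2 * INR k * IZR c by rewrite PE /Im /=; ring.
      have -> : Im (P * P)%C = 2 * (Re P * Im P) by rewrite /Re /Im /=; ring.
      have : 0 < INR k * IZR c by exact: Rmult_lt_0_compat.
      lra.
    by nra.
  have -> : (Q * (/ Csqrt W * theta (INR k * u)) = Csqrt t * theta (INR k * u))%C.
    by rewrite QE; field.
  apply: is_usum_ext H => m; rewrite kernel_inv // /coef.
  set G := gsum _ _ _; set x := e2pi _; set y := e2pi _; set s := e2pi _.
  have -> : x = (y * s)%C; last by ring.
  rewrite /x /y /s -e2pi_plus -Cmult_plus_distr_l; do 2!f_equal.
  have wR : RtoC (INR w) = (4 * INR k * INR v)%C.
    rewrite wE !mult_INR -!RtoC_mult; do 2!f_equal; rewrite /=; ring.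
  rewrite tE wR.
  by rewrite /W; rewrite /W in WC; field; do !split => //; exact: Ci_neq0.
exists (fun m => / Q * g m)%C.
apply: (fourier_ext _ (fourier_scal (x := (/ Q)%C) Hg)) => z z0.
set X := (/ Csqrt _ * _)%C; by field.
Qed.

Lemma moebius_opp (a b c d : Z) (z : C) : SL2Z a b c d -> upper z ->
  moebius (- a) (- b) (- c) (- d) z = moebius a b c d z.
Proof.
move=> det z0; have WC := @moebius_den_neq0 a b c d z det z0.
rewrite /moebius !opp_IZR !RtoC_opp; field; split => //.
move=> E; apply: WC.
have -> : (IZR c * z + IZR d = - (- IZR c * z + - IZR d))%C by ring.
by rewrite E; ring.
Qed.

(** For c < 0 the negated matrix has the same action, and the changed sign under the root costs the
    constant i. For c = 0 the action is translation by the integer b d, which leaves theta (k z)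
    unchanged. *)
Lemma theta_cusp (k v w : nat) (a b c d : Z) : (0 < k)%N -> (0 < v)%N ->
  w = (4 * k * v)%N -> SL2Z a b c d ->
  exists g : nat -> C, fourier w g (fun z =>
    half_pow (IZR c * z + IZR d) (- 1) * theta (INR k * moebius a b c d z))%C.
Proof.
move=> k0 v0 wE det.
have hp x : half_pow x (-1) = (/ Csqrt x)%C by rewrite /half_pow /= Cmult_1_r.
have [c0|[c0|c0]] : (0 < c \/ c < 0 \/ c = 0)%Z by lia.
- have [g Hg] := theta_cusp_pos k0 v0 wE det c0; exists g.
  by apply: (fourier_ext _ Hg) => z _; rewrite hp.
- have det' : SL2Z (- a) (- b) (- c) (- d) by move: det; rewrite /SL2Z; lia.
  have c0' : (0 < - c)%Z by lia.
  have [g Hg] := theta_cusp_pos k0 v0 wE det' c0'.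
  exists (fun m => Ci * g m)%C.
  apply: (fourier_ext _ (fourier_scal (x := Ci) Hg)) => z z0.
  have WC := @moebius_den_neq0 _ _ _ _ z det' z0.
  rewrite hp moebius_opp //; set W := (_ + _)%C in WC *.
  have Wu : upper W.
    rewrite /upper; have -> : Im W = IZR (- c) * Im z.
      by rewrite /W; case: (z) => p q; rewrite /Im /=; ring.
    by apply: Rmult_lt_0_compat => //; exact: IZR_lt.
  have -> : (IZR c * z + IZR d = - W)%C.
    by rewrite /W !opp_IZR !RtoC_opp; ring.
  rewrite Csqrt_opp_upper //.
  have sW := @Csqrt_neq0 W WC.
  have iC := Ci_neq0.
  set th := theta _.
  transitivity (- (Ci * Ci) * / (- (Ci * Csqrt W)) * th)%C; last first.
    by rewrite Ci2; ring.
  by field; do !split.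
- subst c; have [ad d1] : a = d /\ (d = 1 \/ d = -1)%Z.
    have E : (a * d = 1)%Z by move: det; rewrite /SL2Z; lia.
    by case: (Z.eq_mul_1 _ _ E) => h; rewrite h in E *; lia.
  have dd : (d * d = 1)%Z by lia.
  have w0 : (0 < w)%N by rewrite wE; nia.
  have K0 : 0 < INR k by exact: INR_gt0.
  have [|g Hg] := @fourier_of_theta_series (fun _ => RtoC 1) (k * w) w
    (fun z => theta (INR k * z))%C (ltac:(nia)) w0 _.
    move=> z z0; have kz0 : upper (INR k * z)%C by exact: upper_scal.
    apply: is_usum_ext (theta_usum kz0) => m.
    rewrite Cmult_1_l; do 2!f_equal; rewrite mult_INR RtoC_mult; field.
    by move/RtoC_inj; have : 0 < INR w by [apply: lt_0_INR; lia]; lra.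
  exists (fun m => / Csqrt (IZR d) * g m)%C.
  apply: (fourier_ext _ (fourier_scal (x := (/ Csqrt (IZR d))%C) Hg)) => z z0.
  have -> : (IZR 0 * z + IZR d = IZR d)%C by ring.
  rewrite hp; f_equal.
  have kz0 : upper (INR k * z)%C by exact: upper_scal.
  have dC : RtoC (IZR d) <> RtoC 0 by move/RtoC_inj/eq_IZR; lia.
  have -> : moebius a b 0 d z = (z + IZR (b * d))%C.
    rewrite /moebius ad; have -> : (IZR 0 * z + IZR d = IZR d)%C by ring.
    have -> : (z + IZR (b * d) = (IZR d * z + IZR b * IZR (d * d)) / IZR d)%C.
      by rewrite !mult_IZR !RtoC_mult; field.
    by rewrite dd Cmult_1_r.
  have kz1 : upper (INR k * (z + IZR (b * d)))%C.
    apply: upper_scal => //; move: z0; rewrite /upper.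
    by have -> : Im (z + IZR (b * d))%C = Im z by rewrite /Im /=; ring.
  apply: (is_usum_unique (theta_usum kz0)).
  apply: is_usum_ext (theta_usum kz1) => m.
  have -> : (IZR (m * m) * (INR k * (z + IZR (b * d))) =
    IZR (m * m) * (INR k * z) + IZR (m * m * (Z.of_nat k * (b * d))))%C.
    by rewrite INR_IZR_INZ !mult_IZR !RtoC_mult; ring.
  by rewrite e2pi_plus e2pi_Z Cmult_1_r.
Qed.

(** * Holomorphy of Fourier series *)

Lemma poly_exp_bound (c : R) (j : nat) : 0 < c -> exists M, 0 <= M /\
  forall v, 0 <= v -> (1 + v) ^ j * exp (- (c * v)) <= M.
Proof.
(* The j-th power of 1 + v <= (1 + 1 / c') exp(c' v) spends j of the j + 1 shares of the decay. *)
move=> c0; set c' := c / INR j.+1.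
have j0 : 0 < INR j.+1 by apply: lt_0_INR; lia.
have c'0 : 0 < c' by exact: Rdiv_lt_0_compat.
have L0 : 0 < 1 + / c' by have := Rinv_0_lt_compat _ c'0; lra.
exists ((1 + / c') ^ j); split; first by apply: pow_le; lra.
move=> v v0.
have H : 1 + v <= (1 + / c') * exp (c' * v).
  apply: Rle_trans (_ : (1 + / c') * (1 + c' * v) <= _).
    have -> : (1 + / c') * (1 + c' * v) = 1 + v + (c' * v + / c') by field; lra.
    have := Rinv_0_lt_compat _ c'0; have := Rmult_le_pos _ _ (Rlt_le _ _ c'0) v0; lra.
  apply: Rmult_le_compat_l; first by lra.
  exact: exp_ineq1_le.
apply: Rle_trans (_ : ((1 + / c') * exp (c' * v)) ^ j * exp (- (c * v)) <= _).
  apply: Rmult_le_compat_r; first exact: Rlt_le (exp_pos _).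
  by apply: pow_incr; lra.
rewrite Rpow_mult_distr Rmult_assoc -[X in _ <= X]Rmult_1_r.
apply: Rmult_le_compat_l; first by apply: pow_le; lra.
have -> : exp (c' * v) ^ j = exp (INR j * (c' * v)).
  elim: j {c' j0 c'0 L0 H} (c' * v) => [|j IH] x; first by rewrite Rmult_0_l exp_0.
  by rewrite -tech_pow_Rmult IH -exp_plus S_INR; f_equal; ring.
rewrite -exp_plus -exp_0; apply: exp_le.
have -> : c = c' * INR j.+1 by rewrite /c'; field; lra.
rewrite S_INR.
have -> : INR j * (c' * v) + - (c' * (INR j + 1) * v) = - (c' * v) by ring.
by have := Rmult_le_pos _ _ (Rlt_le _ _ c'0) v0; lra.
Qed.

Lemma rbounded_poly_exp (c : R) (j : nat) : 0 < c ->
  rbounded (fun m : nat => (1 + INR m) ^ j * exp (- (c * INR m))).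
Proof.
move=> c0; have [M [M0 HM]] := poly_exp_bound (j + 2) c0.
apply: (rbounded_le (g := fun m : nat => M * / (1 + INR m) ^ 2)).
  move=> m; have m0 := pos_INR m.
  have p0 : 0 < (1 + INR m) ^ 2 by apply: pow_lt; lra.
  apply: (Rmult_le_reg_r ((1 + INR m) ^ 2)) => //.
  rewrite [M * _ * _]Rmult_assoc Rinv_l ?Rmult_1_r; last by lra.
  by have := HM _ m0; rewrite pow_add; lra.
apply: rbounded_scal => //; exists (2 / 1) => F uF.
apply: rsum_nat_le => // [m|J]; last by apply: rsum_inv_sq; lra.
by apply: Rlt_le; apply: Rinv_0_lt_compat; apply: pow_lt; have := pos_INR m; lra.
Qed.

Lemma rbounded_prod (I J : eqType) (g : I -> R) (h : J -> R) :
  (forall i, 0 <= g i) -> (forall j, 0 <= h j) -> rbounded g -> rbounded h ->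
  rbounded (fun x : I * J => g x.1 * h x.2).
Proof.
move=> g0 h0 [B1 H1] [B2 H2]; exists (B1 * B2) => F uF.
set F1 := undup (map fst F); set F2 := undup (map snd F).
apply: Rle_trans (_ : \rsum_(x <- [seq (i, j) | i <- F1, j <- F2]) (g x.1 * h x.2) <= _).
  apply: rsum_sub => //.
  - by move=> i; exact: Rmult_le_pos.
  - by apply: allpairs_uniq; rewrite ?undup_uniq // => -[? ?] [? ?].
  - move=> [i j] Hx; apply/allpairsP; exists (i, j); split => //=.
    + by rewrite mem_undup; apply/mapP; exists (i, j).
    + by rewrite mem_undup; apply/mapP; exists (i, j).
rewrite big_allpairs /=.
have -> : \rsum_(i <- F1) \rsum_(j <- F2) (g i * h j) =
   (\rsum_(i <- F1) g i) * (\rsum_(j <- F2) h j).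
  by rewrite big_distrl /=; apply: eq_bigr => i _; rewrite big_distrr.
apply: Rmult_le_compat; try exact: rsum_ge0.
- by apply: H1; exact: undup_uniq.
- by apply: H2; exact: undup_uniq.
Qed.

Lemma Cexp_taylor (u : C) :
  Cmod (Cexp u - 1 - u)%C <= 2 * (Cmod u ^ 2 * exp (Cmod u)).
Proof.
have D t : Cder (fun t => Cexp (u * RtoC t)%C) t (u * Cexp (u * t))%C.
  by have := Cder_exp (Cder_linear u 0 t); apply: Cder_ext => [x|]; rewrite !Cplus_0_r.
have := @taylor1 (fun t => Cexp (u * RtoC t)%C) (fun t => u * Cexp (u * t))%C
  (fun t => u * (u * Cexp (u * t)))%C 0 1 (Cmod u ^ 2 * exp (Cmod u)).
rewrite Rplus_0_l !Cmult_0_r !Cmult_1_r Cexp_0 Cmult_1_r Cmult_1_l.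
move=> H; apply: Rle_trans (_ : 2 * (Cmod u ^ 2 * exp (Cmod u)) * 1 ^ 2 <= _);
  last by rewrite pow1 Rmult_1_r; exact: Rle_refl.
apply: H.
  by apply: Rmult_le_pos; [exact: pow2_ge_0 | exact: Rlt_le (exp_pos _)].
move=> t; rewrite Rminus_0_r Rabs_R1 => ht; split; first exact: D.
split.
  apply: Cder_ext (Cder_mult (Cder_const u t) (D t)) => //; ring.
rewrite !Cmod_mult Cmod_Cexp.
have -> : Cmod u * (Cmod u * exp (Re (u * t)%C)) = Cmod u ^ 2 * exp (Re (u * t)%C).
  by ring.
apply: Rmult_le_compat_l; first exact: pow2_ge_0.
apply: exp_le; apply: Rle_trans (Rle_abs _) _.
apply: Rle_trans (re_le_Cmod _) _; rewrite Cmod_mult Cmod_R.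
have := Cmod_ge_0 u; nra.
Qed.

Lemma fourier_term_bound (a : nat -> C) (K y : R) (z : C) (m : nat) :
  0 <= K -> Cmod (a m) <= K * (1 + INR m) ^ 2 -> y <= Im z ->
  Cmod (a m * e2pi (INR m * z))%C <=
    K * ((1 + INR m) ^ 2 * exp (- (2 * PI * y * INR m))).
Proof.
move=> K0 aK yz; have -> : K * ((1 + INR m) ^ 2 * exp (- (2 * PI * y * INR m))) =
  K * (1 + INR m) ^ 2 * exp (- (2 * PI * y * INR m)) by ring.
apply: Cmod_mult_le => //; rewrite Cmod_e2pi; apply: exp_le.
have -> : Im (INR m * z)%C = INR m * Im z.
  by case: (z) => p q; rewrite /Im /=; ring.
have := PI_RGT_0; have := pos_INR m => m0 P0.
have : 2 * PI * INR m * y <= 2 * PI * INR m * Im z.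
  by apply: Rmult_le_compat_l => //; nra.
lra.
Qed.

Lemma is_derive_C (f : C -> C) (z l : C) (B d : R) : 0 <= B -> 0 < d ->
  (forall h, Cmod h < d -> Cmod (f (z + h) - f z - h * l)%C <= B * Cmod h ^ 2) ->
  @is_derive C_AbsRing C_NormedModule f z l.
Proof.
move=> B0 d0 H; split; first exact: is_linear_scal_l.
move=> x Hx eps; have <- : z = x := is_filter_lim_locally_unique _ _ Hx.
apply: locally_le_locally_norm.
have e0 := cond_pos eps.
have d'0 : 0 < Rmin d (eps / (B + 1)).
  by apply: Rmin_pos => //; apply: Rdiv_lt_0_compat; lra.
exists (mkposreal _ d'0) => y; rewrite /ball_norm /= => hy.
have hy' : Cmod (y - z)%C < Rmin d (eps / (B + 1)) by exact: hy.
have h1 : Cmod (y - z)%C < d by apply: Rlt_le_trans hy' (Rmin_l _ _).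
have h2 : Cmod (y - z)%C <= eps / (B + 1).
  by apply: Rlt_le; apply: Rlt_le_trans hy' (Rmin_r _ _).
have := H _ h1.
have -> : (z + (y - z) = y)%C by ring.
move=> K1; apply: Rle_trans (_ : B * Cmod (y - z)%C ^ 2 <= _); first exact: K1.
have n0 := Cmod_ge_0 (y - z)%C.
apply: Rle_trans (_ : eps * Cmod (y - z)%C <= _); last exact: Rle_refl.
have -> : B * Cmod (y - z)%C ^ 2 = B * Cmod (y - z)%C * Cmod (y - z)%C by ring.
apply: Rmult_le_compat_r => //.
apply: Rle_trans (_ : (B + 1) * (eps / (B + 1)) <= _); first by apply: Rmult_le_compat; lra.
by right; field; lra.
Qed.

(** Termwise differentiation with a quadratic remainder from [Cexp_taylor]. For |h| < Im z / 2 the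
    growth exp(2 PI m |h|) uses up at most half of the decay, and the remainder raises the weight
    from (1 + m)^2 to (1 + m)^4. *)
Lemma fourier_holomorphic (a : nat -> C) (f : C -> C) (K : R) : 0 <= K ->
  (forall m, Cmod (a m) <= K * (1 + INR m) ^ 2) ->
  (forall z, upper z -> is_usum (fun m : nat => a m * e2pi (INR m * z))%C (f z)) ->
  holomorphic f.
Proof.
move=> K0 aK Hf z z0; rewrite /upper in z0.
have P0 := PI_RGT_0; have P4 := PI_4.
set y := Im z in z0.
have y2 : 0 < 2 * PI * (y / 2) by nra.
pose T (m : nat) := (2 * PI * Ci * INR m)%C.
have TM m : Cmod (T m) = 2 * PI * INR m.
  rewrite /T !Cmod_mult !Cmod_R.
  rewrite Cmod_Ci.
  by rewrite !Rabs_pos_eq; [ring | exact: pos_INR | lra | lra].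
have b0 := rbounded_poly_exp 4 y2.
have [D HD] : exists D, is_usum (fun m => T m * (a m * e2pi (INR m * z)))%C D.
  apply: (ex_usum (g := fun m => 8 * K * ((1 + INR m) ^ 4 *
      exp (- (2 * PI * (y / 2) * INR m))))); last by apply: rbounded_scal => //; lra.
  move=> m; have m0 := pos_INR m.
  have := fourier_term_bound K0 (aK m) (_ : y / 2 <= Im z) => /(_ ltac:(rewrite -/y; lra)) h1.
  have h2 : Cmod (T m) <= 8 * (1 + INR m) ^ 2 by rewrite TM; nra.
  apply: Rle_trans (Cmod_mult_le h2 h1) _; right; ring.
have [B HB] := rbounded_poly_exp 4 y2.
set B' := 2 * (64 * K * B).
have B0 : 0 <= B by have := HB [::] isT; rewrite big_nil.
exists D; apply: (@is_derive_C f z D B' (y / 2)).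
- by rewrite /B'; do !apply: Rmult_le_pos => //; lra.
- by lra.
move=> h hd.
have zh : upper (z + h)%C.
  rewrite /upper; have -> : Im (z + h)%C = y + Im h by [].
  have := im_le_Cmod h; move/(Rle_trans _ _ _)/(_ (Rlt_le _ _ hd))/Rabs_le_between; lra.
have H := is_usum_plus (is_usum_plus (Hf _ zh) (is_usum_scal (- RtoC 1)%C (Hf z z0)))
  (is_usum_scal (- h)%C HD).
have -> : (f (z + h) - f z - h * D = f (z + h) + - RtoC 1 * f z + - h * D)%C by ring.
have h0 := Cmod_ge_0 h.
have -> : B' * Cmod h ^ 2 = (128 * K * Cmod h ^ 2) * B by rewrite /B'; ring.
apply: (is_usum_bound H) => F uF.
apply: Rle_trans (_ : \rsum_(m <- F) (128 * K * Cmod h ^ 2 * ((1 + INR m) ^ 4 *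
   exp (- (2 * PI * (y / 2) * INR m)))) <= _); last first.
  rewrite -big_distrr /=; apply: Rmult_le_compat_l; last exact: HB.
  by do !apply: Rmult_le_pos => //; lra.
apply: rsum_le => m _ _; have m0 := pos_INR m.
have -> : (a m * e2pi (INR m * (z + h)) + - RtoC 1 * (a m * e2pi (INR m * z)) +
   - h * (T m * (a m * e2pi (INR m * z))) =
   (a m * e2pi (INR m * z)) * (Cexp (T m * h) - 1 - T m * h))%C.
  have -> : e2pi (INR m * (z + h))%C = (e2pi (INR m * z) * Cexp (T m * h))%C.
    by rewrite /e2pi -Cexp_plus /T; f_equal; ring.
  ring.
have h1 := fourier_term_bound K0 (aK m) (Rle_refl (Im z)).
have h2 := Cexp_taylor (T m * h)%C; rewrite Cmod_mult TM in h2.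
apply: Rle_trans (Cmod_mult_le h1 h2) _.
set X := 1 + INR m; rewrite -/y.
have e1 : exp (- (2 * PI * y * INR m)) * exp (2 * PI * INR m * Cmod h) <=
    exp (- (2 * PI * (y / 2) * INR m)).
  rewrite -exp_plus; apply: exp_le.
  have : 2 * PI * INR m * Cmod h <= 2 * PI * INR m * (y / 2).
    by apply: Rmult_le_compat_l; [nra | lra].
  lra.
have -> : K * (X ^ 2 * exp (- (2 * PI * y * INR m))) *
  (2 * ((2 * PI * INR m * Cmod h) ^ 2 * exp (2 * PI * INR m * Cmod h))) =
  (2 * K * X ^ 2 * (2 * PI * INR m) ^ 2 * Cmod h ^ 2) *
  (exp (- (2 * PI * y * INR m)) * exp (2 * PI * INR m * Cmod h)) by ring.
have -> : 128 * K * Cmod h ^ 2 * (X ^ 4 * exp (- (2 * PI * (y / 2) * INR m))) =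
  (2 * K * X ^ 2 * (64 * X ^ 2) * Cmod h ^ 2) * exp (- (2 * PI * (y / 2) * INR m)) by ring.
have X2 := pow2_ge_0 X; have hh := pow2_ge_0 (Cmod h).
have pp := pow2_ge_0 (2 * PI * INR m).
have k1 : (2 * PI * INR m) ^ 2 <= 64 * X ^ 2.
  have : 2 * PI * INR m <= 8 * X by rewrite /X; nra.
  have : 0 <= 2 * PI * INR m by nra.
  by move=> ? ?; nra.
apply: Rmult_le_compat => //.
- by do !apply: Rmult_le_pos => //; lra.
- by apply: Rmult_le_pos; exact: Rlt_le (exp_pos _).
- apply: Rmult_le_compat_r => //; apply: Rmult_le_compat_l => //.
  by do !apply: Rmult_le_pos => //; lra.
Qed.

(** * Sums over square classes *)

Lemma square_decomposition (k : nat) : (0 < k)%N -> exists x : nat * nat,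
  k = (x.1 * (x.2 * x.2))%N /\ forall d, (d * d %| x.1)%N -> d = 1%N.
Proof.
elim/ltn_ind: k => k IH k0.
case: (Classical_Prop.classic (forall d, (d * d %| k)%N -> d = 1%N)) => [h|h].
  by exists (k, 1%N); rewrite /= !muln1.
have [d Hd] := Classical_Pred_Type.not_all_ex_not _ _ h.
have [/dvdnP[q E] d1] := Classical_Prop.imply_to_and _ _ Hd.
have q0 : (0 < q)%N by case: q E => //; lia.
have d2 : (1 < d)%N by lia.
have [|//|[s u] /= [Eq Hs]] := IH q; first by nia.
by exists (s, u * d)%N; split => //=; rewrite E Eq; nia.
Qed.

(** After division by the gcd, a^2 and b^2 are coprime, so a^2 divides s' and b^2 divides s; both
    are 1. *)
Lemma squarefree_unique (s s' A B : nat) : (0 < A)%N -> (0 < B)%N ->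
  (forall d, (d * d %| s)%N -> d = 1%N) ->
  (forall d, (d * d %| s')%N -> d = 1%N) ->
  (s * (A * A) = s' * (B * B))%N -> s = s'.
Proof.
move=> A0 B0 Hs Hs' E.
have g0 : (0 < gcdn A B)%N by rewrite gcdn_gt0 A0.
have [a Ea] := dvdnP (dvdn_gcdl A B); have [b Eb] := dvdnP (dvdn_gcdr A B).
have cab : coprime a b.
  have := gcdn_gt0 A B; have : gcdn A B = (gcdn a b * gcdn A B)%N.
    by rewrite {1}Ea {2}Eb -muln_gcdl.
  move=> F _; rewrite /coprime; apply/eqP; nia.
have E2 : (s * (a * a) = s' * (b * b))%N.
  apply/eqP; rewrite -(eqn_pmul2r (m := (gcdn A B * gcdn A B)%N)) ?muln_gt0 ?g0 //.
  apply/eqP; move: E Ea Eb; set g := gcdn A B; clearbody g; clear.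
  by move=> E Ea Eb; subst A B; nia.
have ca : coprime (a * a) (b * b) by rewrite !(coprimeMl, coprimeMr) cab.
have a1 : a = 1%N.
  by apply: Hs'; rewrite -(Gauss_dvdl _ ca) -E2 dvdn_mull.
have b1 : b = 1%N.
  by apply: Hs; rewrite coprime_sym in ca; rewrite -(Gauss_dvdl _ ca) E2 dvdn_mull.
by move: E2; rewrite a1 b1 !muln1.
Qed.

(** The comparison with the integral is made by telescoping x^(- de) with de = al - 1; the step
    inequality follows from ln x <= ln (x + 1) - 1 / (x + 1). *)
Lemma rbounded_Rpower (al : R) : 1 < al ->
  rbounded (fun j : nat => Rpower (INR j.+1) (- al)).
Proof.
move=> al1; set de := al - 1; have de0 : 0 < de by rewrite /de; lra.
have step x : 0 < x -> de * Rpower (x + 1) (- al) <=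
    Rpower x (- de) - Rpower (x + 1) (- de).
  move=> x0; have x1 : 0 < x + 1 by lra.
  have l : ln x <= ln (x + 1) - / (x + 1).
    have -> : ln (x + 1) - / (x + 1) = ln ((x + 1) * exp (- / (x + 1))).
      by rewrite ln_mult ?ln_exp //; exact: exp_pos.
    have hx : x <= (x + 1) * exp (- / (x + 1)).
      have := exp_ineq1_le (- / (x + 1)) => h.
      have {1}-> : x = (x + 1) * (1 + - / (x + 1)) by field; lra.
      by apply: Rmult_le_compat_l => //; lra.
    case: hx => [hx|<-]; last exact: Rle_refl.
    by apply: Rlt_le; exact: ln_increasing.
  have E : Rpower (x + 1) (- al) = Rpower (x + 1) (- de) * / (x + 1).
    have -> : / (x + 1) = Rpower (x + 1) (- 1) by rewrite Rpower_Ropp Rpower_1.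
    by rewrite -Rpower_plus; f_equal; rewrite /de; ring.
  have G : Rpower (x + 1) (- de) * (1 + de * / (x + 1)) <= Rpower x (- de).
    apply: Rle_trans (_ : Rpower (x + 1) (- de) * exp (de * / (x + 1)) <= _).
      apply: Rmult_le_compat_l; first exact: Rlt_le (exp_pos _).
      exact: exp_ineq1_le.
    rewrite /Rpower -exp_plus; apply: exp_le; nra.
  by rewrite E; lra.
exists (1 + / de) => F uF; apply: rsum_nat_le => //.
  by move=> j; exact: Rlt_le (exp_pos _).
have D J : \rsum_(j <- iota 0 J.+1) Rpower (INR j.+1) (- al) <=
    1 + / de * (1 - Rpower (INR J.+1) (- de)).
  elim: J => [|J IH].
    by rewrite big_seq1 /Rpower /= ln_1 !Rmult_0_r exp_0; lra.
  move: IH; rewrite -(addn1 J.+1) (iotaD 0 J.+1 1).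
  set r := iota 0 J.+1 => IH; rewrite big_cat add0n [iota _ 1]/= big_seq1.
  rewrite [X in X <= _]/= addn1.
  have J0 : 0 < INR J.+1 by apply: lt_0_INR; lia.
  have := step _ J0; rewrite -(S_INR J.+1) => h.
  move: IH h; set S := \rsum_(j <- r) _; set p := Rpower (INR J.+2) (- al).
  set q := Rpower (INR J.+1) _; set q' := Rpower (INR J.+2) (- de) => IH h.
  have : p <= / de * (q - q').
    apply: (Rmult_le_reg_l de) => //.
    by rewrite -Rmult_assoc Rinv_r ?Rmult_1_l; lra.
  lra.
case=> [|J]; first by rewrite big_nil; have := Rinv_0_lt_compat _ de0; lra.
apply: Rle_trans (D J) _.
have : 0 <= / de * Rpower (INR J.+1) (- de).
  by apply: Rmult_le_pos; [apply: Rlt_le; exact: Rinv_0_lt_compat | exact: Rlt_le (exp_pos _)].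
lra.
Qed.

Lemma uniq_nat_size (s : seq nat) (X : R) : 0 <= X -> uniq s ->
  (forall n, n \in s -> INR n.+1 <= X) -> INR (size s) <= X.
Proof.
move=> X0 us H; case: (Rle_lt_dec (INR (size s)) X) => // hX.
case E : (size s) => [|L]; first by rewrite /=.
have /hasP[n ns hn] : has (fun n => (L <= n)%N) s.
  apply/negPn/negP => /hasPn h.
  have : (size s <= size (iota 0 L))%N.
    apply: uniq_leq_size => // n /h; rewrite mem_iota; lia.
  by rewrite size_iota E; lia.
apply: Rle_trans (H n ns); apply: le_INR; lia.
Qed.

Lemma cauchy_schwarz (I : Type) (r : seq I) (P : pred I) (x y : I -> R) :
  (\rsum_(i <- r | P i) (x i * y i)) ^ 2 <=
  (\rsum_(i <- r | P i) (x i ^ 2)) * (\rsum_(i <- r | P i) (y i ^ 2)).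
Proof.
elim: r => [|i r IH]; first by rewrite !big_nil; lra.
rewrite !big_cons; case: (P i) => //.
move: IH; set A := \rsum_(j <- r | P j) (x j * y j).
set Xs := \rsum_(j <- r | P j) _; set Y := \rsum_(j <- r | P j) _ => IH.
have X0 : 0 <= Xs by apply: rsum_ge0 => j; exact: pow2_ge_0.
have Y0 : 0 <= Y by apply: rsum_ge0 => j; exact: pow2_ge_0.
suff : 2 * A * (x i * y i) <= x i ^ 2 * Y + Xs * y i ^ 2 by nra.
case: (Req_dec (x i) 0) => [->|xi].
  have := Rmult_le_pos _ _ X0 (pow2_ge_0 (y i)); lra.
have := pow2_ge_0 (y i * Xs - x i * A) => h.
case: X0 => [Xp|X00].
- apply: (Rmult_le_reg_l Xs) => //.
  have : A ^ 2 * x i ^ 2 <= Xs * Y * x i ^ 2.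
    by apply: Rmult_le_compat_r => //; exact: pow2_ge_0.
  nra.
- have A0 : A = 0 by rewrite -X00 in IH; nra.
  by rewrite A0 -X00; have := Rmult_le_pos _ _ (pow2_ge_0 (x i)) Y0; lra.
Qed.

(** * Fourier coefficients *)

(** Counts positive integers n.+1 with v (n + 1)^2 = m; the range up to m misses none. At m = 0 it
    is 0, so the constant term of theta is treated apart. *)
Definition rep (v m : nat) : nat :=
  count (fun n => v * (n.+1 * n.+1) == m)%N (iota 0 m).

Lemma rep_le1 (v m : nat) : (0 < v)%N -> (rep v m <= 1)%N.
Proof.
move=> v0; rewrite /rep -size_filter.
case E : [seq n <- iota 0 m | _] => [|n s] //.
have us : uniq (n :: s) by rewrite -E; apply: filter_uniq; exact: iota_uniq.
have me i : i \in n :: s -> (v * (i.+1 * i.+1) = m)%N.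
  by rewrite -E mem_filter => /andP[/eqP].
have En := me n (mem_head _ _).
have : (size (n :: s) <= size [:: n])%N; last by [].
apply: uniq_leq_size => // i /me Ei; rewrite mem_seq1; apply/eqP.
have : (i.+1 * i.+1 = n.+1 * n.+1)%N.
  by apply/eqP; rewrite -(eqn_pmul2l v0) Ei En.
nia.
Qed.

Lemma rep_big (v m L : nat) : (0 < v)%N -> (m <= L)%N ->
  rep v m = count (fun n => v * (n.+1 * n.+1) == m)%N (iota 0 L).
Proof.
move=> v0 mL; rewrite /rep -(subnKC mL) iotaD count_cat.
rewrite [X in (_ + X)%N](_ : _ = 0%N) ?addn0 //.
apply/eqP; rewrite -leqn0 leqNgt -has_count; apply/hasPn => n.
by rewrite mem_iota; nia.
Qed.

Lemma rep_eq0 (v m : nat) : (m < v)%N -> rep v m = 0%N.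
Proof.
move=> mv; apply/eqP; rewrite -leqn0 leqNgt -has_count; apply/hasPn => n.
by rewrite mem_iota; nia.
Qed.

(** Exchanging the counts leaves the number of n >= 1 with v n^2 <= M. This is where the
    normalization by the square root of [M] comes from. *)
Lemma sum_rep (v M : nat) : (0 < v)%N ->
  \rsum_(m <- iota 1 M) INR (rep v m) <= sqrt (INR M) * / sqrt (INR v).
Proof.
move=> v0.
have V0 : 0 < INR v by exact: INR_gt0.
have -> : \rsum_(m <- iota 1 M) INR (rep v m) =
    INR (count (fun n => v * (n.+1 * n.+1) \in iota 1 M)%N (iota 0 M)).
  have E m : m \in iota 1 M -> rep v m =
      count (fun n => v * (n.+1 * n.+1) == m)%N (iota 0 M).
    by rewrite mem_iota => hm; apply: rep_big => //; lia.
  rewrite (eq_big_seq _ (fun m hm => f_equal INR (E m hm))).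
  have -> : forall c : nat -> nat, \rsum_(m <- iota 1 M) INR (c m) =
      INR (\sum_(m <- iota 1 M) c m)%N.
    move=> c; apply: (big_ind2 (fun x (y : nat) => x = INR y)) => //.
    by move=> x1 x2 y1 y2 -> ->; rewrite plus_INR.
  f_equal.
  elim: (iota 0 M) => [|n r IH]; first by rewrite /= big1.
  rewrite /= big_split /= IH; f_equal.
  rewrite -(count_uniq_mem _ (iota_uniq 1 M)) -sum1_count [RHS]big_mkcond.
  by apply: eq_bigr => m _ /=; rewrite [in RHS]eq_sym; case: eqP.
have -> : sqrt (INR M) * / sqrt (INR v) = sqrt (INR M / INR v).
  by rewrite sqrt_div_alt.
rewrite -size_filter; apply: uniq_nat_size.
- exact: sqrt_pos.
- by apply: filter_uniq; exact: iota_uniq.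
- move=> n; rewrite mem_filter mem_iota => /andP[hn _].
  have n0 : 0 <= INR n.+1 by exact: pos_INR.
  rewrite -(sqrt_pow2 (INR n.+1)) //; apply: sqrt_le_1_alt.
  apply: (Rmult_le_reg_l (INR v)) => //.
  have -> : INR v * (INR M / INR v) = INR M by field; lra.
  have -> : INR v * INR n.+1 ^ 2 = INR (v * (n.+1 * n.+1)).
    by rewrite !mult_INR; ring.
  by apply: le_INR; lia.
Qed.

Definition sq_roots (v m : nat) : seq nat :=
  [seq n <- iota 0 m | v * (n.+1 * n.+1) == m]%N.

Definition theta_fiber (v m : nat) : seq Z :=
  if m is 0%N then [:: 0%Z] else
  [seq Z.of_nat n.+1 | n <- sq_roots v m] ++
  [seq (- Z.of_nat n.+1)%Z | n <- sq_roots v m].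

Lemma theta_series (v : nat) (z : C) : (0 < v)%N -> upper z ->
  is_usum (fun m : nat => INR (if m is 0%N then 1%N else 2 * rep v m)%N *
    e2pi (INR m * z))%C (theta (INR v * z)).
Proof.
move=> v0 z0.
have V0 : 0 < INR v by exact: INR_gt0.
pose p (n : Z) := (v * (Z.abs_nat n * Z.abs_nat n))%N.
have ufib m : uniq (theta_fiber v m).
  case: m => [|m] //; rewrite /theta_fiber cat_uniq.
  have uF : uniq (sq_roots v m.+1) by apply: filter_uniq; exact: iota_uniq.
  apply/and3P; split.
  - by rewrite map_inj_uniq // => x y; lia.
  - by apply/hasPn => x /mapP[n _ ->]; apply/negP => /mapP[k _]; lia.
  - by rewrite map_inj_uniq // => x y; lia.
have mfib (n : Z) m : (n \in theta_fiber v m) = (p n == m).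
  case: m => [|m]; rewrite /theta_fiber.
    by rewrite mem_seq1; apply/eqP/eqP; rewrite /p; nia.
  rewrite mem_cat; apply/orP/eqP => [[/mapP[k + ->]|/mapP[k + ->]]|E].
  - by rewrite mem_filter => /andP[/eqP <- _]; rewrite /p; nia.
  - by rewrite mem_filter => /andP[/eqP <- _]; rewrite /p; nia.
  - have n0 : n <> 0%Z by move=> n0; move: E; rewrite /p n0; nia.
    have kin : (Z.abs_nat n).-1 \in sq_roots v m.+1.
      rewrite mem_filter mem_iota; apply/andP; split; last by rewrite /p in E; nia.
      by apply/eqP; rewrite -E /p prednK //; lia.
    case: (Z_lt_le_dec n 0) => hn; [right | left];
      by apply/mapP; exists (Z.abs_nat n).-1 => //; lia.
apply: is_usum_ext (is_usum_push ufib mfib (theta_usum (upper_scal V0 z0))) => m.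
have E n : n \in theta_fiber v m -> e2pi (IZR (n * n) * (INR v * z))%C =
    e2pi (INR m * z)%C.
  rewrite mfib => /eqP <-; f_equal; rewrite /p !mult_INR !RtoC_mult.
  have -> : RtoC (IZR (n * n)) = (INR (Z.abs_nat n) * INR (Z.abs_nat n))%C.
    by rewrite -RtoC_mult -mult_INR INR_IZR_INZ; do 2!f_equal; lia.
  ring.
rewrite (eq_big_seq _ E).
have -> : \csum_(n <- theta_fiber v m) e2pi (INR m * z) =
   (INR (size (theta_fiber v m)) * e2pi (INR m * z))%C.
  elim: (theta_fiber v m) => [|n s IH]; first by rewrite big_nil /=; ring.
  have -> : INR (size (n :: s)) = INR (size s) + 1 by exact: S_INR.
  by rewrite big_cons IH RtoC_plus; ring.
do 3!f_equal; case: (m) => [|m'] //; rewrite /theta_fiber.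
by rewrite size_cat !size_map size_filter /rep; lia.
Qed.

Lemma Rpower_bound (K b : R) (k : nat) : 0 <= K -> 0 <= b ->
  K * Rpower (INR k.+1) (- b) <= K.
Proof.
move=> K0 b0; rewrite -[X in _ <= X]Rmult_1_r; apply: Rmult_le_compat_l => //.
rewrite -exp_0; apply: exp_le.
have : 0 <= ln (INR k.+1).
  rewrite -ln_1; have : 1 <= INR k.+1 by rewrite -INR_1; apply: le_INR; lia.
  by case=> [h|<-]; [apply: Rlt_le; apply: ln_increasing; lra | exact: Rle_refl].
by nra.
Qed.

Section Coefficients.
Variables (a : nat -> C) (K beta : R).
Hypothesis K_pos : 0 < K.
Hypothesis beta_gt : 1 / 4 < beta.
Hypothesis a_bound : forall k : nat,
  Cmod (a k) <= K * Rpower (INR k.+1) (- beta).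

Let a_le k : Cmod (a k) <= K.
Proof. by apply: Rle_trans (a_bound k) _; apply: Rpower_bound; lra. Qed.

(* From here on [a k] is the coefficient of index [k + 1], and a pair [(n, k)]
   stands for the indices [n + 1] and [k + 1]. *)
Definition xi_fiber (m : nat) : seq (nat * nat) :=
  [seq x <- [seq (n, k) | n <- iota 0 m, k <- iota 0 m]
     | x.2.+1 * (x.1.+1 * x.1.+1) == m]%N.

Definition xi_coef (m : nat) : C := \csum_(x <- xi_fiber m) a x.2.

(** The absolutely convergent double series: summed by rows it is the series of h (n^2 z), by fibres
    the Fourier series. *)
Definition xi_fun (z : C) : C := usum (fun x : nat * nat =>
  a x.2 * e2pi (INR (x.2.+1 * (x.1.+1 * x.1.+1)) * z))%C.

Lemma xi_double (z : C) : upper z -> is_usum (fun x : nat * nat =>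
  a x.2 * e2pi (INR (x.2.+1 * (x.1.+1 * x.1.+1)) * z))%C (xi_fun z).
Proof.
rewrite /upper => z0; apply: usum_correct.
have P0 := PI_RGT_0; have c0 : 0 < PI * Im z by nra.
have R := rbounded_poly_exp 0 c0.
have pos (n : nat) : 0 <= (1 + INR n) ^ 0 * exp (- (PI * Im z * INR n)).
  by rewrite /= Rmult_1_l; exact: Rlt_le (exp_pos _).
apply: (ex_usum (g := fun x : nat * nat => K *
  (((1 + INR x.1) ^ 0 * exp (- (PI * Im z * INR x.1))) *
   ((1 + INR x.2) ^ 0 * exp (- (PI * Im z * INR x.2)))))); last first.
  by apply: rbounded_scal; [lra | exact: (rbounded_prod pos pos R R)].
move=> [n k] /=; rewrite !Rmult_1_l; apply: Cmod_mult_le => //.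
rewrite Cmod_e2pi -exp_plus; apply: exp_le.
set v := (k.+1 * (n.+1 * n.+1))%N.
have -> : Im (INR v * z)%C = INR v * Im z by rewrite /Im /=; ring.
have h : INR n + INR k <= INR v + INR v.
  by rewrite -!plus_INR; apply: le_INR; rewrite /v; nia.
have := Rmult_le_compat_l _ _ _ (Rlt_le _ _ c0) h; lra.
Qed.

Lemma xi_series (z : C) : upper z ->
  is_usum (fun m => xi_coef m * e2pi (INR m * z))%C (xi_fun z).
Proof.
move=> z0.
have ufib m : uniq (xi_fiber m).
  apply: filter_uniq; apply: allpairs_uniq; rewrite ?iota_uniq //.
  by move=> -[? ?] [? ?].
pose p (x : nat * nat) := (x.2.+1 * (x.1.+1 * x.1.+1))%N.
have mfib x m : (x \in xi_fiber m) = (p x == m).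
  case: x => n k; rewrite mem_filter andb_idr // /p /= => /eqP E.
  have hk : (k.+1 <= m)%N by rewrite -E leq_pmulr.
  have hn : (n.+1 <= m)%N.
    by rewrite -E; apply: leq_trans (leq_pmull _ (ltn0Sn k)); exact: leq_pmulr.
  by apply/allpairsP; exists (n, k); rewrite !mem_iota.
apply: is_usum_ext (is_usum_push ufib mfib (xi_double z0)) => m.
rewrite /xi_coef big_distrl /=; apply: eq_big_seq => x; rewrite mfib => /eqP <-.
by [].
Qed.

Lemma xi_coefE (m : nat) :
  xi_coef m = \csum_(k <- iota 0 m) (a k * INR (rep k.+1 m)).
Proof.
rewrite /xi_coef /xi_fiber big_filter big_mkcond big_allpairs exchange_big /=.
apply: eq_bigr => k _; rewrite -big_mkcond /= /rep.
elim: (iota 0 m) => [|n r IH]; first by rewrite big_nil /=; ring.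
rewrite big_cons /= IH; case: eqP => _; rewrite /nat_of_bool; last by rewrite add0n.
by rewrite add1n S_INR RtoC_plus; ring.
Qed.

Lemma xi_coef_bound (m : nat) : Cmod (xi_coef m) <= K * (1 + INR m) ^ 2.
Proof.
rewrite xi_coefE; apply: Rle_trans (csum_mod _ _ _) _.
apply: Rle_trans (_ : \rsum_(k <- iota 0 m) K <= _).
  apply: rsum_le => k _ _; rewrite -[X in _ <= X]Rmult_1_r.
  apply: Cmod_mult_le => //; rewrite Cmod_R Rabs_pos_eq; last exact: pos_INR.
  by rewrite -INR_1; apply: le_INR; have := @rep_le1 k.+1 m (ltn0Sn k); lia.
have -> : \rsum_(k <- iota 0 m) K = INR m * K.
  elim: m => [|m IH]; first by rewrite big_nil /=; ring.
  by rewrite -(addn1 m) iotaD big_cat /= big_seq1 IH plus_INR INR_1; ring.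
have := pos_INR m; nra.
Qed.

(** The 1 / 2 compensates for n and -n in theta. It leaves a constant term, which [xi_coef] does not
    have. *)
Definition f_approx (k0 : nat) (z : C) : C :=
  \csum_(k <- iota 0 k0) (a k / 2 * theta (INR k.+1 * z)).

Definition f_coef (k0 m : nat) : C :=
  \csum_(k <- iota 0 k0) (a k / 2 * INR (if m is 0%N then 1 else 2 * rep k.+1 m)%N).

Lemma f_series (k0 : nat) (z : C) : upper z ->
  is_usum (fun m => f_coef k0 m * e2pi (INR m * z))%C (f_approx k0 z).
Proof.
move=> z0.
have := is_usum_finite (iota 0 k0) (fun k =>
  is_usum_scal (a k / 2)%C (theta_series (ltn0Sn k) z0)).
apply: is_usum_ext => m; rewrite /f_coef big_distrl /=.
by apply: eq_bigr => k _; ring.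
Qed.

Lemma f_coef_bound (k0 m : nat) :
  Cmod (f_coef k0 m) <= (INR k0 * K) * (1 + INR m) ^ 2.
Proof.
apply: Rle_trans (csum_mod _ _ _) _.
apply: Rle_trans (_ : \rsum_(k <- iota 0 k0) K <= _).
  apply: rsum_le => k _ _.
  apply: Rle_trans (_ : (K / 2) * 2 <= _); last by right; field.
  apply: Cmod_mult_le.
    rewrite Cmod_div; last by move/RtoC_inj; lra.
    rewrite Cmod_R Rabs_pos_eq; last by lra.
    by apply: Rmult_le_compat_r => //; lra.
  rewrite Cmod_R Rabs_pos_eq; last exact: pos_INR.
  have -> : 2 = INR 2 by rewrite /=; ring.
  by apply: le_INR; case: m => [|m]; [lia | have := @rep_le1 k.+1 m.+1 (ltn0Sn k); lia].
have -> : \rsum_(k <- iota 0 k0) K = INR k0 * K.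
  elim: k0 => [|n IH]; first by rewrite big_nil /=; ring.
  by rewrite -(addn1 n) iotaD big_cat /= big_seq1 IH plus_INR INR_1; ring.
have := pos_INR m => m0; have := Rmult_le_pos _ _ (pos_INR k0) (Rlt_le _ _ K_pos).
by move=> h; rewrite -[X in X <= _]Rmult_1_r; apply: Rmult_le_compat_l => //; nra.
Qed.

(** The range M + k0 is the same for all m up to [M], so the sums over m and k can later be
    exchanged; the added k contribute nothing, as k + 1 exceeds m. *)
Lemma coef_diff (k0 m M : nat) : (0 < m)%N -> (m <= M)%N ->
  (xi_coef m - f_coef k0 m)%C =
  \csum_(k <- iota 0 (M + k0) | ~~ (k < k0)%N) (a k * INR (rep k.+1 m)).
Proof.
move=> m0 mM.
have ext L L' : (L <= L')%N -> (forall k, (L <= k)%N -> rep k.+1 m = 0%N) ->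
    \csum_(k <- iota 0 L') (a k * INR (rep k.+1 m)) =
    \csum_(k <- iota 0 L) (a k * INR (rep k.+1 m)).
  move=> LL H; rewrite -(subnKC LL) iotaD big_cat /= add0n.
  have -> : \csum_(k <- iota L (L' - L)) (a k * INR (rep k.+1 m)) = RtoC 0.
    rewrite big_seq big1 // => k; rewrite mem_iota => hk.
    by rewrite H /=; [ring | lia].
  by rewrite Cplus_0_r.
rewrite xi_coefE -(ext m (M + k0)%N); [|lia|by move=> k hk; apply: rep_eq0; lia].
rewrite (bigID (fun k => (k < k0)%N)) /=.
have -> : f_coef k0 m = \csum_(k <- iota 0 (M + k0) | (k < k0)%N) (a k * INR (rep k.+1 m)).
  rewrite addnC iotaD big_cat /= [X in _ = (_ + X)%C]big_seq_cond.
  rewrite [X in _ = (_ + X)%C]big1 ?Cplus_0_r; last first.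
    by move=> k /andP[]; rewrite mem_iota; lia.
  rewrite /f_coef big_seq [RHS]big_seq_cond.
  apply: eq_big => [k|k]; first by rewrite mem_iota; lia.
  case: m m0 {mM ext} => // m _ _; rewrite mult_INR RtoC_mult.
  have -> : RtoC (INR 2) = RtoC 2 by f_equal; rewrite /=; ring.
  by field; move/RtoC_inj; lra.
by ring.
Qed.

Lemma Rpower_pos x y : 0 < Rpower x y. Proof. exact: exp_pos. Qed.

Lemma mean_square_bound : exists (Z : R) (G : nat -> R), 0 <= Z /\
  (forall k, 0 <= G k) /\ rbounded G /\ forall k0 M : nat, (0 < M)%N ->
  \rsum_(m <- iota 1 M) (Cmod (xi_coef m - f_coef k0 m)%C ^ 2) <=
  Z * sqrt (INR M) * \rsum_(k <- iota 0 (M + k0) | ~~ (k < k0)%N) G k.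
Proof.
(* The midpoint between 1 and 4 beta. *)
set rho := (1 + 4 * beta) / 2.
have rho1 : 1 < rho by rewrite /rho; lra.
have rho2 : rho < 4 * beta by rewrite /rho; lra.
have [su Hsu] := ClassicalChoice.choice _ (fun k : nat => square_decomposition (ltn0Sn k)).
pose s k := (su k).1; pose u k := (su k).2.
have dec k : k.+1 = (s k * (u k * u k))%N by case: (Hsu k).
have sqf k : forall d, (d * d %| s k)%N -> d = 1%N by case: (Hsu k).
have u0 k : (0 < u k)%N by have := dec k; case: (u k) => //; lia.
have s0 k : (0 < s k)%N by have := dec k; case: (s k) => //; lia.
have [Z HZ] := rbounded_Rpower rho1.
have Z0 : 0 <= Z by have := HZ [::] isT; rewrite big_nil.
(* 2 beta comes from the squared coefficient, 1 / 2 from [sum_rep], and u^rho from the weight. With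
   k + 1 = s u^2 this is s^(- (2 beta + 1/2)) u^(- (4 beta + 1 - rho)). *)
pose G k := Rpower (INR k.+1) (- (2 * beta + / 2)) * Rpower (INR (u k)) rho.
have G0 k : 0 <= G k.
  by apply: Rmult_le_pos; exact: Rlt_le (Rpower_pos _ _).
exists (Z * K ^ 2), G; split.
  by apply: Rmult_le_pos => //; exact: pow2_ge_0.
split => //; split.
  apply: (rbounded_inj (p := fun k => ((s k).-1, (u k).-1))
    (h := fun x : nat * nat => Rpower (INR x.1.+1) (- (2 * beta + / 2)) *
       Rpower (INR x.2.+1) (- (4 * beta + 1 - rho)))).
  - move=> k l [h1 h2]; have e1 : s k = s l by have := s0 k; have := s0 l; lia.
    have e2 : u k = u l by have := u0 k; have := u0 l; lia.
    by apply: succn_inj; rewrite !dec e1 e2.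
  - move=> k; rewrite /G [(_, _).1]/= [(_, _).2]/= !prednK // dec !mult_INR; right.
    have U0 : 0 < INR (u k) by apply: lt_0_INR; have := u0 k; lia.
    have S0 : 0 < INR (s k) by apply: lt_0_INR; have := s0 k; lia.
    have UU : 0 < INR (u k) * INR (u k) by exact: Rmult_lt_0_compat.
    rewrite -!Rpower_mult_distr // Rmult_assoc Rmult_assoc -!Rpower_plus.
    by do 2!f_equal; field.
  - apply: (rbounded_prod (g := fun j : nat => Rpower (INR j.+1) (- (2 * beta + / 2)))
      (h := fun j : nat => Rpower (INR j.+1) (- (4 * beta + 1 - rho)))).
    + by move=> i; exact: Rlt_le (Rpower_pos _ _).
    + by move=> i; exact: Rlt_le (Rpower_pos _ _).
    + by apply: rbounded_Rpower; lra.
    + by apply: rbounded_Rpower; lra.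
move=> k0 M M0.
set r := iota 0 (M + k0); set P := fun k : nat => ~~ (k < k0)%N.
pose c k := Cmod (a k) ^ 2 * Rpower (INR (u k)) rho.
have c0 k : 0 <= c k.
  by apply: Rmult_le_pos; [exact: pow2_ge_0 | exact: Rlt_le (Rpower_pos _ _)].
have Rsq x y : Rpower x (y / 2) ^ 2 = Rpower x y.
  rewrite /= Rmult_1_r -Rpower_plus; f_equal; field.
have rep01 k m : INR (rep k.+1 m) ^ 2 = INR (rep k.+1 m).
  have := @rep_le1 k.+1 m (ltn0Sn k).
  by case: (rep k.+1 m) => [|[|?]] // _; rewrite /=; ring.
have step m : (0 < m)%N -> (m <= M)%N -> Cmod (xi_coef m - f_coef k0 m)%C ^ 2 <=
    Z * \rsum_(k <- r | P k) (c k * INR (rep k.+1 m)).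
  move=> m0 mM; rewrite (coef_diff k0 m0 mM).
  (* Because [rep] is 0 or 1 it equals its square, so a copy goes to each factor and the factor with
     u^(- rho / 2) is also restricted to the contributing k. *)
  apply: Rle_trans (_ : (\rsum_(k <- r | P k)
     ((Cmod (a k) * Rpower (INR (u k)) (rho / 2) * INR (rep k.+1 m)) *
      (Rpower (INR (u k)) (- rho / 2) * INR (rep k.+1 m)))) ^ 2 <= _).
    apply: pow_incr; split; first exact: Cmod_ge_0.
    apply: Rle_trans (csum_mod _ _ _) _; right; apply: eq_bigr => k _.
    rewrite Cmod_mult Cmod_R Rabs_pos_eq; last exact: pos_INR.
    have -> : Cmod (a k) * Rpower (INR (u k)) (rho / 2) * INR (rep k.+1 m) *
      (Rpower (INR (u k)) (- rho / 2) * INR (rep k.+1 m)) =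
      Cmod (a k) * (Rpower (INR (u k)) (rho / 2) * Rpower (INR (u k)) (- rho / 2)) *
      INR (rep k.+1 m) ^ 2 by ring.
    rewrite rep01 -Rpower_plus.
    have -> : rho / 2 + - rho / 2 = 0 by field.
    rewrite Rpower_O; first by ring.
    by apply: lt_0_INR; have := u0 k; lia.
  apply: Rle_trans (cauchy_schwarz _ _ _ _) _.
  rewrite Rmult_comm; apply: Rmult_le_compat.
  - by apply: rsum_ge0 => k; exact: pow2_ge_0.
  - by apply: rsum_ge0 => k; exact: pow2_ge_0.
  - have -> : \rsum_(k <- r | P k) ((Rpower (INR (u k)) (- rho / 2) * INR (rep k.+1 m)) ^ 2) =
      \rsum_(k <- [seq k <- r | P k & rep k.+1 m != 0%N]) Rpower (INR (u k).-1.+1) (- rho).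
      rewrite big_filter big_mkcondr; apply: eq_bigr => k _.
      rewrite Rpow_mult_distr rep01 Rsq prednK //.
      have := @rep_le1 k.+1 m (ltn0Sn k).
      by case: (rep k.+1 m) => [|[|?]] // _; rewrite /=; ring.
    (* All contributing k have the squarefree part of m as their [s k], so [u] is injective on them
       and their sum is a partial sum of the series bounded by [Z]. The predecessor is the index
       shift of that series. *)
    have := HZ (map (fun k => (u k).-1) [seq k <- r | P k & rep k.+1 m != 0%N]).
    rewrite big_map; apply; rewrite map_inj_in_uniq.
      by apply: filter_uniq; exact: iota_uniq.
    have rw k : rep k.+1 m != 0%N -> exists n, (k.+1 * (n.+1 * n.+1) = m)%N.
      by rewrite -lt0n -has_count => /hasP[n _ /eqP]; exists n.
    move=> k l; rewrite !mem_filter => /andP[/andP[_ /rw[n En]] _].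
    move=> /andP[/andP[_ /rw[n' En']] _] h.
    have e2 : u k = u l by have := u0 k; have := u0 l; lia.
    have e1 : s k = s l.
      apply: (@squarefree_unique _ _ (u k * n.+1) (u l * n'.+1)) => //.
      + by rewrite muln_gt0 u0.
      + by rewrite muln_gt0 u0.
      + exact: sqf.
      + exact: sqf.
      + have : (s k * (u k * u k) * (n.+1 * n.+1) = s l * (u l * u l) * (n'.+1 * n'.+1))%N.
          by rewrite -!dec En En'.
        have sq x y z : (x * (y * z * (y * z)) = x * (y * y) * (z * z))%N by nia.
        by rewrite !sq.
    by apply: succn_inj; rewrite !dec e1 e2.
  - right; apply: eq_bigr => k _.
    by rewrite !Rpow_mult_distr rep01 Rsq.
apply: Rle_trans (_ : \rsum_(m <- iota 1 M)
    (Z * \rsum_(k <- r | P k) (c k * INR (rep k.+1 m))) <= _).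
  by apply: rsum_le => m; rewrite mem_iota => hm _; apply: step; lia.
rewrite -big_distrr [X in X <= _]/=.
have -> : Z * K ^ 2 * sqrt (INR M) * (\rsum_(k <- r | P k) G k) =
  Z * (K ^ 2 * (sqrt (INR M) * (\rsum_(k <- r | P k) G k))) by ring.
apply: Rmult_le_compat_l => //.
rewrite exchange_big [X in X <= _]/=.
have -> : K ^ 2 * (sqrt (INR M) * (\rsum_(k <- r | P k) G k)) =
  \rsum_(k <- r | P k) (K ^ 2 * sqrt (INR M) * G k).
  by rewrite -Rmult_assoc big_distrr.
apply: rsum_le => k _ _; rewrite -big_distrr [X in X <= _]/=.
apply: Rle_trans (_ : c k * (sqrt (INR M) * / sqrt (INR k.+1)) <= _).
  by apply: Rmult_le_compat_l => //; exact: sum_rep.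
have k1 : 0 < INR k.+1 by apply: lt_0_INR; lia.
have -> : / sqrt (INR k.+1) = Rpower (INR k.+1) (- / 2).
  by rewrite Rpower_Ropp Rpower_sqrt.
rewrite /c /G.
have -> : - (2 * beta + / 2) = - / 2 + (- beta + - beta) by ring.
rewrite !Rpower_plus.
set p := Rpower (INR k.+1) (- / 2); set q := Rpower (INR k.+1) (- beta).
set t := Rpower (INR (u k)) rho.
have p0 : 0 <= p by exact: Rlt_le (Rpower_pos _ _).
have t0 : 0 <= t by exact: Rlt_le (Rpower_pos _ _).
have -> : Cmod (a k) ^ 2 * t * (sqrt (INR M) * p) =
  Cmod (a k) ^ 2 * (t * (sqrt (INR M) * p)) by ring.
have -> : K ^ 2 * sqrt (INR M) * (p * (q * q) * t) =
  (K * q) ^ 2 * (t * (sqrt (INR M) * p)) by ring.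
apply: Rmult_le_compat_r.
  by apply: Rmult_le_pos => //; apply: Rmult_le_pos => //; exact: sqrt_pos.
by apply: pow_incr; split; [exact: Cmod_ge_0 | exact: a_bound].
Qed.

Lemma mean_square_limsup (eps : R) : 0 < eps -> exists k0 : nat,
  Rbar_lt (LimSup_seq (fun M => / sqrt (INR M) *
    sum_n (fun m => Cmod (xi_coef m - f_coef k0 m)%C ^ 2) M)) (eps ^ 2).
Proof.
move=> e0; have [Z [G [Z0 [G0 [bG H]]]]] := mean_square_bound.
have e2 : 0 < eps ^ 2 by apply: pow_lt.
(* A tail of [G] this small, multiplied by [Z], is at most eps^2 / 4; Z + 1 avoids division by 0. *)
have d0 : 0 < eps ^ 2 / (4 * (Z + 1)) by apply: Rdiv_lt_0_compat; lra.
have [F0 HF0] := rbounded_tail G0 bG d0.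
set k0 := (\max_(j <- F0) j).+1; exists k0.
set D0 := Cmod (xi_coef 0 - f_coef k0 0)%C ^ 2.
have D00 : 0 <= D0 by exact: pow2_ge_0.
apply: (Rbar_le_lt_trans _ (eps ^ 2 / 2)); last by rewrite /=; lra.
rewrite -(LimSup_seq_const (eps ^ 2 / 2)).
apply: LimSup_le.
(* The constant terms differ by a fixed amount. Beyond [M1] its square [D0], divided by sqrt M, is
   at most eps^2 / 4, so the total stays below eps^2 / 2. *)
have [M1 HM1] := INR_unbounded ((4 * D0 / eps ^ 2) ^ 2 + 1).
exists M1 => M hM.
have hM' : (4 * D0 / eps ^ 2) ^ 2 + 1 < INR M.
  by apply: Rlt_le_trans HM1 _; apply: le_INR.
have q0 := pow2_ge_0 (4 * D0 / eps ^ 2).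
have M0 : 0 < INR M by lra.
have M0' : (0 < M)%N by case: (M) M0 => [|?] //=; lra.
have sM : 0 < sqrt (INR M) by exact: sqrt_lt_R0.
have E : sum_n (fun m => Cmod (xi_coef m - f_coef k0 m)%C ^ 2) M =
    D0 + \rsum_(m <- iota 1 M) (Cmod (xi_coef m - f_coef k0 m)%C ^ 2).
  elim: (M) => [|n IH]; first by rewrite sum_O big_nil /D0 Rplus_0_r.
  rewrite sum_Sn IH -(addn1 n) (iotaD 1 n 1) big_cat /= big_seq1 addn1.
  by rewrite /plus /= add1n Rplus_assoc.
rewrite E; apply: (Rmult_le_reg_l (sqrt (INR M))) => //.
rewrite -Rmult_assoc Rinv_r ?Rmult_1_l; last by lra.
have h1 := H k0 M M0'.
have h2 : \rsum_(k <- iota 0 (M + k0) | ~~ (k < k0)%N) G k < eps ^ 2 / (4 * (Z + 1)).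
  rewrite -big_filter; apply: HF0; first by apply: filter_uniq; exact: iota_uniq.
  move=> j; rewrite mem_filter => /andP[hj _]; apply/negP => jF.
  by have := @leq_bigmax_seq _ F0 xpredT id j jF isT; rewrite /k0 in hj; lia.
have h3 : D0 <= sqrt (INR M) * (eps ^ 2 / 4).
  have : 4 * D0 / eps ^ 2 <= sqrt (INR M).
    rewrite -(sqrt_pow2 (4 * D0 / eps ^ 2)).
      by apply: sqrt_le_1_alt; lra.
    by apply: Rmult_le_pos; [lra | apply: Rlt_le; exact: Rinv_0_lt_compat].
  move=> h; have -> : D0 = 4 * D0 / eps ^ 2 * (eps ^ 2 / 4) by field; lra.
  by apply: Rmult_le_compat_r => //; lra.
have h4 : (Z * sqrt (INR M) * (\rsum_(k <- iota 0 (M + k0) | ~~ (k < k0)%N) G k) <=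
    sqrt (INR M) * (eps ^ 2 / 4))%coqR.
  apply: Rle_trans (_ : Z * sqrt (INR M) * (eps ^ 2 / (4 * (Z + 1))) <= _).
    apply: Rmult_le_compat_l; last exact: Rlt_le.
    by apply: Rmult_le_pos => //; lra.
  have -> : Z * sqrt (INR M) * (eps ^ 2 / (4 * (Z + 1))) =
    sqrt (INR M) * (Z * (eps ^ 2 / (4 * (Z + 1)))) by ring.
  apply: Rmult_le_compat_l; first by lra.
  have -> : eps ^ 2 / 4 = (Z + 1) * (eps ^ 2 / (4 * (Z + 1))) by field; lra.
  by apply: Rmult_le_compat_r; lra.
lra.
Qed.

Lemma Cpow_one (z : C) : (z ^ 1)%C = z.
Proof. by rewrite /= Cmult_1_r. Qed.

(** The factorial makes the level a multiple of 4 k for every k up to k0, as [theta_law] requires,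
    and serves as common width at all cusps. *)
Lemma f_modular (k0 : nat) : modular_form 1 (4 * Z.of_nat (k0`!)) (f_approx k0).
Proof.
have fact_dvd k : k \in iota 0 k0 -> exists v, (0 < v)%N /\ (k0`! = k.+1 * v)%N.
  rewrite mem_iota => hk.
  have /dvdnP[v Ev] : (k.+1 %| k0`!)%N by apply: dvdn_fact; lia.
  exists v; split; last by rewrite Ev mulnC.
  by have := fact_gt0 k0; rewrite Ev; case: v {Ev}.
split; [|split].
- apply: (fourier_holomorphic (K := INR k0 * K)).
  + by apply: Rmult_le_pos; [exact: pos_INR | lra].
  + exact: (f_coef_bound k0).
  + exact: f_series.
- move=> a' b c d z Hg z0.
  rewrite /f_approx /half_pow /Cpowz !Cpow_one big_distrr /=.
  apply: eq_big_seq => k /fact_dvd[v [v0 Ev]].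
  rewrite (@theta_law k.+1 (4 * Z.of_nat (k0`!))) //; last first.
    by rewrite Ev Nat2Z.inj_mul; exists (Z.of_nat v); ring.
  by rewrite -/(INR k.+1); ring.
- move=> a' b c d det; exists (4 * k0`!)%N.
  have [g Hg] : exists g, fourier (4 * k0`!) g (fun z => \csum_(k <- iota 0 k0)
     (a k / 2 * (half_pow (IZR c * z + IZR d) (- 1) *
        theta (INR k.+1 * moebius a' b c d z)))).
    apply: fourier_sum => k /fact_dvd[v [v0 Ev]].
    have [g Hg] := @theta_cusp k.+1 v (4 * k0`!) a' b c d (ltn0Sn k) v0
      (ltac:(by rewrite Ev mulnA)) det.
    by exists (fun m => a k / 2 * g m)%C; exact: fourier_scal.
  exists g; split; first by have := fact_gt0 k0; lia.
  apply: fourier_ext Hg => z _; rewrite /f_approx big_distrr /=.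
  by apply: eq_bigr => k _; ring.
Qed.
End Coefficients.

(** * From the double series to the almost modular form *)

Lemma is_Cseries_unique (f : nat -> C) (l1 l2 : C) :
  is_Cseries f l1 -> is_Cseries f l2 -> l1 = l2.
Proof.
move=> H1 H2.
exact: (@filterlim_locally_unique nat C_AbsRing C_NormedModule eventually _
  (sum_n f) l1 l2 H1 H2).
Qed.

Lemma upper_square (n : nat) (z : C) : upper z -> upper (INR n.+1 ^ 2 * z)%C.
Proof.
move=> z0; have V : 0 < INR n.+1 by apply: lt_0_INR; lia.
have -> : (INR n.+1 ^ 2 = INR n.+1 * INR n.+1)%C by rewrite /= Cmult_1_r.
rewrite -Cmult_assoc; apply: upper_scal; first exact: V.
apply: upper_scal; [exact: V | exact: z0].
Qed.

(** Each row of the double series has an unconditional sum by the coefficient bound; uniqueness of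
    ordered sums identifies it with the value of [h]. *)
Lemma xi_fun_rows (a : nat -> C) (K beta : R) (h : C -> C) (z : C) :
  0 < K -> 1 / 4 < beta ->
  (forall k : nat, Cmod (a k) <= K * Rpower (INR k.+1) (- beta)) ->
  (forall z, upper z -> is_Cseries (fun j : nat => a j * e2pi (INR j.+1 * z))%C (h z)) ->
  upper z -> is_Cseries (fun j : nat => h (INR j.+1 ^ 2 * z)%C) (xi_fun a z).
Proof.
move=> K0 b0 ab Hh z0; apply: is_usum_series.
have D := xi_double K0 b0 ab z0.
apply: is_usum_rows D _ => n.
have zn := upper_square n z0.
have E k : (a k * e2pi (INR (k.+1 * (n.+1 * n.+1)) * z) =
  a k * e2pi (INR k.+1 * (INR n.+1 ^ 2 * z)))%C.
  do 2!f_equal; rewrite !mult_INR !RtoC_mult.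
  by generalize (RtoC (INR k.+1)) (RtoC (INR n.+1)) => x y; ring.
have [l Hl] : exists l, is_usum (fun k => a k * e2pi (INR (k.+1 * (n.+1 * n.+1)) * z))%C l.
  have y0 := zn; rewrite /upper in y0.
  have P0 := PI_RGT_0.
  have c0 : 0 < 2 * PI * Im (INR n.+1 ^ 2 * z)%C by nra.
  apply: (ex_usum (g := fun k => K * ((1 + INR k) ^ 0 *
     exp (- (2 * PI * Im (INR n.+1 ^ 2 * z)%C * INR k))))); last first.
    by apply: rbounded_scal; [lra | exact: rbounded_poly_exp].
  move=> k; rewrite E; apply: Cmod_mult_le.
    by apply: Rle_trans (ab k) _; apply: Rpower_bound; lra.
  rewrite Cmod_e2pi [(1 + INR k) ^ 0]/= Rmult_1_l; apply: exp_le.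
  set w := (INR n.+1 ^ 2 * z)%C in y0 c0 *.
  have -> : Im (INR k.+1 * w)%C = INR k.+1 * Im w by rewrite /Im /=; ring.
  by rewrite S_INR; nra.
have H' : is_Cseries (fun k => a k * e2pi (INR (k.+1 * (n.+1 * n.+1)) * z))%C
    (h (INR n.+1 ^ 2 * z)%C).
  by move: (Hh _ zn); apply: is_series_ext => k; rewrite E.
by rewrite -(is_Cseries_unique (is_usum_series Hl) H').
Qed.

Lemma xi_fun_almost_modular (h : C -> C) (h_hat : nat -> C) (K beta : R) :
  (forall z : C, upper z ->
     is_Cseries (fun j : nat => (h_hat j.+1 * e2pi (INR j.+1 * z))%C) (h z)) ->
  0 < K -> 1 / 4 < beta ->
  (forall k : nat, (1 <= k)%coq_nat ->
     Cmod (h_hat k) <= K / Rpower (INR k) beta) ->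
  (forall z : C, upper z -> is_Cseries (fun j : nat => h (INR j.+1 ^ 2 * z)%C)
     (xi_fun (fun k => h_hat k.+1) z)) /\
  almost_modular_half (xi_fun (fun k => h_hat k.+1)).
Proof.
move=> hf K0 b0 hb; set a := fun k => h_hat k.+1.
have ab k : Cmod (a k) <= K * Rpower (INR k.+1) (- beta).
  by rewrite Rpower_Ropp; apply: hb; lia.
have S z := xi_series K0 b0 ab (z := z).
have fou (g : nat -> C) (F : C -> C) : (forall z, upper z ->
    is_usum (fun m => g m * e2pi (INR m * z))%C (F z)) -> fourier 1 g F.
  move=> H z z0; apply: is_usum_series; apply: is_usum_ext (H z z0) => m.
  by do 2!f_equal; rewrite INR_1; field; move/RtoC_inj; lra.
split; first by move=> z z0; exact: (xi_fun_rows K0 b0 ab).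
split; [|split].
- apply: (fourier_holomorphic (K := K)) S; first by lra.
  exact: (xi_coef_bound K0 b0 ab).
- move=> z z0.
  have z1 : upper (z + 1)%C.
    by move: z0; rewrite /upper; have -> : Im (z + 1)%C = Im z by rewrite /Im /=; ring.
  apply: (is_usum_unique (S _ z1)); apply: is_usum_ext (S _ z0) => m.
  by rewrite Cmult_plus_distr_l Cmult_1_r e2pi_plus e2pi_nat Cmult_1_r.
- exists (xi_coef a); split; first exact: fou.
  move=> eps e0.
  have [k0 Hk0] := mean_square_limsup b0 ab e0.
  exists (4 * Z.of_nat (k0`!))%Z, (f_approx a k0), (f_coef a k0).
  have f0 := fact_gt0 k0.
  split; first by lia.
  split; first by exists (Z.of_nat (k0`!)); lia.
  split; first exact: (f_modular K0 b0 ab).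
  split => //; apply: fou => z z0; exact: f_series.
Qed.
End ThetaSeries.

Theorem theorem2 (h : C -> C) (h_hat : nat -> C) (K beta : R)
  (h_hol : holomorphic h) (h_per : periodic h)
  (h_fourier : forall z : C, upper z ->
     is_Cseries (fun j : nat => (h_hat (S j) * e2pi (INR (S j) * z))%C) (h z))
  (K_pos : 0 < K) (beta_gt : 1 / 4 < beta)
  (h_bound : forall k : nat, (1 <= k)%nat ->
     Cmod (h_hat k) <= K / Rpower (INR k) beta) :
  exists xi : C -> C,
    (forall z : C, upper z ->
       is_Cseries (fun j : nat => h (INR (S j) ^ 2 * z)%C) (xi z)) /\
    almost_modular_half xi.
Proof.
exists (ThetaSeries.xi_fun (fun k => h_hat (S k))).
exact (ThetaSeries.xi_fun_almost_modular
  h_fourier K_pos beta_gt h_bound).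
Qed.
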